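(* $(\mathcal{A},\mathcal{H},D)$ is an equivariant odd spectral triple with nontrivial Chern character if and only if $D$ is given by $D: e^{(n)}_{ij}\mapsto d(n,i)e^{(n)}_{ij}$ with $d(n,i)$ real ($n\in\{0,\frac12,1,\ldots\}$, $i\in\{-n,\ldots,n\}$) and the $d(n,i)$'s obey the following conditions: (1) $d(n+\frac12,i+\frac12)-d(n,i)=O(1)$; (2) $d(n+\frac12,i-\frac12)-d(n,i)=O(n+i+1)$; (3) given any nonnegative real $N$, there exist positive integers $k$ and $l$ such that each of the sets $T(k),S(l,0),\ldots,S(l,k)$ is contained in either $\{x\in\mathbb{R}:x>N\}$ or $\{x\in\mathbb{R}:x<-N\}$; (4) there exist positive integers $k$ and $l$ such that in each of the sets $T(k),S(l,0),\ldots,S(l,k)$ all elements are of the same sign, and there are two sets in this collection whose elements are of opposite sign. Here, with $a,b$ ranging over nonnegative integers, $$T(k)=\left\{d\left(\tfrac{b+a}{2},\tfrac{b-a}{2}\right): a>k,\ b\geq 0\right\},\qquad S(l,r)=\left\{d\left(\tfrac{b+r}{2},\tfrac{b-r}{2}\right): b>l\right\}\quad(0\le r\le k).$$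
   Context: Fix a real number $q\in(0,1)$. $\mathcal{A}=C(SU_q(2))$ is the $C^*$-algebra generated by $\alpha,\beta$ subject to $\alpha^*\alpha+\beta^*\beta=I$, $\alpha\alpha^*+q^2\beta\beta^*=I$, $\alpha\beta-q\beta\alpha=0$, $\alpha\beta^*-q\beta^*\alpha=0$, $\beta^*\beta=\beta\beta^*$; $\mathcal{A}_f$ is the dense $*$-subalgebra generated by $\alpha,\beta$. $\mathcal{H}$ is the GNS space of the (faithful) Haar state of $\mathcal{A}$. It has an orthonormal basis $\{e^{(n)}_{ij}: n=0,\frac12,1,\ldots;\ i,j=-n,-n+1,\ldots,n\}$ (normalized matrix entries of the irreducible representations), and $\mathcal{A}$ acts faithfully on $\mathcal{H}$ by $$\alpha e^{(n)}_{ij}=a_+(n,i,j)e^{(n+1/2)}_{i-1/2,j-1/2}+a_-(n,i,j)e^{(n-1/2)}_{i-1/2,j-1/2},\quad \beta e^{(n)}_{ij}=b_+(n,i,j)e^{(n+1/2)}_{i+1/2,j-1/2}+b_-(n,i,j)e^{(n-1/2)}_{i+1/2,j-1/2},$$ $$a_+=\Bigl(q^{2(n+i)+2(n+j)+2}\tfrac{(1-q^{2n-2j+2})(1-q^{2n-2i+2})}{(1-q^{4n+2})(1-q^{4n+4})}\Bigr)^{1/2},\quad a_-=\Bigl(\tfrac{(1-q^{2n+2j})(1-q^{2n+2i})}{(1-q^{4n})(1-q^{4n+2})}\Bigr)^{1/2},$$ $$b_+=-\Bigl(q^{2(n+j)}\tfrac{(1-q^{2n-2j+2})(1-q^{2n+2i+2})}{(1-q^{4n+2})(1-q^{4n+4})}\Bigr)^{1/2},\quad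 b_-=\Bigl(q^{2(n+i)}\tfrac{(1-q^{2n+2j})(1-q^{2n-2i})}{(1-q^{4n})(1-q^{4n+2})}\Bigr)^{1/2},$$ where terms involving basis vectors with indices out of range are zero. Odd spectral triple: $(\mathcal{A},\mathcal{H},D)$ is an odd spectral triple if $D$ is self-adjoint on $\mathcal{H}$, has compact resolvent, and $[D,a]$ is bounded for all $a\in\mathcal{A}_f$. Equivariance: let $A_0 e^{(n)}_{ij}=q^je^{(n)}_{ij}$, and $A_1e^{(n)}_{ij}=(q^{-2n}+q^{2n+2}-q^{-2j}-q^{2j+2})^{1/2}e^{(n)}_{i,j+1}$ if $j<n$, $A_1e^{(n)}_{in}=0$. An operator is equivariant if it commutes with $A_0,A_1,A_1^*$. Standing convention: the equivariant self-adjoint operators with discrete spectrum under consideration are those of the form $e^{(n)}_{ij}\mapsto d(n,i)e^{(n)}_{ij}$ with $d(n,i)$ real (the self-adjoint diagonal operator with these eigenvalues). The spectral triple is equivariant if $D$ is equivariant in this sense. Index pairing: let $P$ be the projection onto the $-1$ eigenspace of $\mathrm{sign}\,D$ (the finite-dimensional kernel of $D$, if any, may be assigned either sign). For an invertible $\gamma$ in $\mathcal{A}$ (or in $M_k(\mathcal{A})$, with $P$ replaced by $P\otimes I_k$), $P\gamma P$ is Fredholm on the range of $P$, and the $K$-theory–$K$-homology pairing is $\langle[\gamma],[(\mathcal{A},\mathcal{H},D)]\rangle=-\mathrm{index}(P\gamma P)$, defining a homomorphism $K_1(\mathcal{A})\to\mathbb{Z}$. The Chern character of the spectral triple is nontrivial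 if this homomorphism is nonzero. The $O(\cdot)$ bounds are uniform over all admissible $(n,i)$. ''Of the same sign'' means all positive or all negative. *)

(* Defs.v *)
From HB Require Import structures.
From mathcomp Require Import all_boot all_order all_algebra.
From mathcomp Require Import complex.
From mathcomp Require Import all_classical all_reals all_analysis.
From mathcomp Require Import ring lra.

Set Implicit Arguments.
Unset Strict Implicit.
Unset Printing Implicit Defensive.

Import Order.TTheory GRing.Theory Num.Theory.
Import numFieldNormedType.Exports.

Local Open Scope classical_set_scope.
Local Open Scope ring_scope.
Local Open Scope complex_scope.

Section SquareSummable.
Context {R : realType} {T : choiceType}.
Implicit Types (u v : T -> R[i]).

Definition sqmod (z : R[i]) : R := complex.Re z ^+ 2 + complex.Im z ^+ 2.

Definition sqsum v : \bar R := \esum_(x in [set: T]) (sqmod (v x))%:E.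

Definition square_summable : {pred T -> R[i]} := fun v => `[< (sqsum v < +oo)%E >].

Lemma sqmod_ge0 z : 0 <= sqmod z.
Proof. by rewrite addr_ge0// sqr_ge0. Qed.

Lemma sqmod_eq0 z : sqmod z = 0 -> z = 0.
Proof.
case: z => a b /eqP; rewrite /sqmod /= paddr_eq0 ?sqr_ge0// !sqrf_eq0.
by case/andP => /eqP -> /eqP ->.
Qed.

Lemma sqmodM z w : sqmod (z * w) = sqmod z * sqmod w.
Proof. by case: z => a b; case: w => c d; rewrite /sqmod /=; ring. Qed.

Lemma sqmodD_le (s : R) z w : 0 < s ->
  sqmod (z + w) <= (1 + s) * sqmod z + (1 + s^-1) * sqmod w.
Proof.
move=> s0; case: z => a b; case: w => c d; rewrite /sqmod /=.
rewrite -subr_ge0.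
have -> : (1 + s) * (a ^+ 2 + b ^+ 2) + (1 + s^-1) * (c ^+ 2 + d ^+ 2) -
  ((a + c) ^+ 2 + (b + d) ^+ 2) = s^-1 * ((s * a - c) ^+ 2 + (s * b - d) ^+ 2).
  by field; rewrite gt_eqF.
by rewrite mulr_ge0 ?invr_ge0 ?(ltW s0)// addr_ge0// sqr_ge0.
Qed.

Lemma sqsum_ge0 v : (0 <= sqsum v)%E.
Proof. by apply: esum_ge0 => x _; rewrite lee_fin sqmod_ge0. Qed.

Lemma esumZl_le (c : R) (a : T -> \bar R) : 0 <= c -> (forall x, (0 <= a x)%E) ->
  (\esum_(x in [set: T]) (c%:E * a x) <= c%:E * \esum_(x in [set: T]) a x)%E.
Proof.
move=> c0 a0; apply: ge_ereal_sup => _ [F [finF FT] <-].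
rewrite -ge0_mule_fsumr//; apply: lee_wpmul2l; first by rewrite lee_fin.
by apply: esum_ge; exists F.
Qed.

Lemma sqsumD_le (s : R) u v : 0 < s ->
  (sqsum (u + v)%R <= (1 + s)%:E * sqsum u + (1 + s^-1)%:E * sqsum v)%E.
Proof.
move=> s0; have s1 : 0 <= 1 + s by rewrite addr_ge0// ltW.
have s2 : 0 <= 1 + s^-1 by rewrite addr_ge0// ?invr_ge0 ltW.
have nn (w : T -> R[i]) x : (0 <= (sqmod (w x))%:E)%E by rewrite lee_fin sqmod_ge0.
apply: (@le_trans _ _ (\esum_(x in [set: T])
   ((1 + s)%:E * (sqmod (u x))%:E + (1 + s^-1)%:E * (sqmod (v x))%:E))%E).
  by apply: le_esum => x _; rewrite lee_fin; exact: sqmodD_le.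
rewrite esumD; last 2 first.
  by move=> x _; rewrite mule_ge0// lee_fin.
  by move=> x _; rewrite mule_ge0// lee_fin.
by apply: leeD; apply: esumZl_le.
Qed.

Lemma sqsumZ_le (c : R[i]) v : (sqsum (c *: v)%R <= (sqmod c)%:E * sqsum v)%E.
Proof.
have v0 x : (0 <= (sqmod (v x))%:E)%E by rewrite lee_fin sqmod_ge0.
apply: le_trans (esumZl_le (sqmod_ge0 c) v0).
by apply: le_esum => x _; rewrite -EFinM lee_fin sqmodM.
Qed.

Fact square_summable_submod_closed : submod_closed square_summable.
Proof.
split.
  apply/asboolP; rewrite /sqsum esum1 ?ltry// => x _.
  by rewrite /sqmod /= expr0n /= addr0.
move=> c u v /asboolP u2 /asboolP v2; apply/asboolP.
apply: le_lt_trans (sqsumD_le _ _ ltr01) _.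
have fin (a : R) (b : \bar R) : 0 <= a -> (b < +oo -> a%:E * b < +oo)%E.
  by move=> a0; apply: lte_mul_pinfty; rewrite ?lee_fin.
apply: lte_add_pinfty; apply: (fin _ _) => //.
  by apply: le_lt_trans (sqsumZ_le _ _) _; apply: (fin _ _); rewrite ?sqmod_ge0.
Qed.

HB.instance Definition _ :=
  GRing.isSubmodClosed.Build _ _ square_summable square_summable_submod_closed.

End SquareSummable.

Section EllTwo.
Variables (R : realType) (T : choiceType).

Record l2 := L2 {l2val :> T -> R[i]; l2_summable : l2val \in square_summable}.

HB.instance Definition _ := [isSub for l2val].
HB.instance Definition _ := [Choice of l2 by <:].
HB.instance Definition _ := [SubChoice_isSubLmodule of l2 by <:].

Implicit Types u v : l2.

Definition l2norm v : R := Num.sqrt (fine (sqsum v)).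

Lemma l2sum_fin v : sqsum v \is a fin_num.
Proof. by rewrite ge0_fin_numE ?sqsum_ge0//; exact/asboolP/(l2_summable v). Qed.

Lemma l2norm_sq v : ((l2norm v ^+ 2)%:E = sqsum v)%E.
Proof. by rewrite sqr_sqrtr ?fine_ge0 ?sqsum_ge0// fineK ?l2sum_fin. Qed.

Lemma l2norm_ge0 v : 0 <= l2norm v.
Proof. exact: sqrtr_ge0. Qed.

Lemma l2norm_eq0 v : l2norm v = 0 -> v = 0.
Proof.
move=> v0; apply: val_inj; apply/funext => x; apply: sqmod_eq0.
apply/eqP; rewrite eq_le sqmod_ge0 andbT -lee_fin.
have <- : sqsum v = (0 : R)%:E by rewrite -l2norm_sq v0 expr0n.
apply: esum_ge; exists [set x]; first by split.
by rewrite fsbig_set1.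
Qed.

Lemma l2normZ_le (c : R[i]) v : l2norm (c *: v) <= Num.sqrt (sqmod c) * l2norm v.
Proof.
rewrite -(@ler_pXn2r _ 2)// ?nnegrE ?mulr_ge0 ?sqrtr_ge0// exprMn.
rewrite (sqr_sqrtr (sqmod_ge0 c)) -lee_fin (EFinM (sqmod c)) !l2norm_sq.
exact: sqsumZ_le.
Qed.

Lemma l2normZ (c : R[i]) v : l2norm (c *: v) = Num.sqrt (sqmod c) * l2norm v.
Proof.
apply/eqP; rewrite eq_le l2normZ_le /=.
have [->|c0] := eqVneq c 0.
  by rewrite /sqmod /= expr0n /= addr0 sqrtr0 mul0r l2norm_ge0.
have c1 : 0 < sqmod c.
  rewrite lt_neqAle sqmod_ge0 andbT eq_sym.
  by apply: contra_neq c0; exact: sqmod_eq0.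
have := l2normZ_le c^-1 (c *: v); rewrite scalerA mulVf// scale1r.
have -> : sqmod c^-1 = (sqmod c)^-1.
  apply: (@mulfI _ (sqmod c)); first by rewrite gt_eqF.
  by rewrite -sqmodM divff// divff ?gt_eqF// /sqmod /= expr1n expr0n /= addr0.
by rewrite sqrtrV ?(ltW c1)// -ler_pdivrMl ?invr_gt0 ?sqrtr_gt0// invrK.
Qed.

Lemma l2normD u v : l2norm (u + v) <= l2norm u + l2norm v.
Proof.
have [/l2norm_eq0 ->|u0] := eqVneq (l2norm u) 0; first by rewrite add0r lerDr l2norm_ge0.
have [/l2norm_eq0 ->|v0] := eqVneq (l2norm v) 0; first by rewrite addr0 lerDl l2norm_ge0.
have A : 0 < l2norm u by rewrite lt_neqAle eq_sym u0 l2norm_ge0.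
have B : 0 < l2norm v by rewrite lt_neqAle eq_sym v0 l2norm_ge0.
rewrite -(@ler_pXn2r _ 2)// ?nnegrE ?addr_ge0 ?l2norm_ge0//.
have := sqsumD_le u v (divr_gt0 B A); rewrite -[_ + _]/(l2val (u + v)).
rewrite -!l2norm_sq -!EFinM -EFinD lee_fin => /le_trans; apply.
by rewrite le_eqVlt; apply/orP; left; apply/eqP; field; rewrite u0 v0.
Qed.

Fact l2_ler_normD u v : (l2norm (u + v))%:C <= (l2norm u)%:C + (l2norm v)%:C.
Proof. by rewrite -rmorphD lecR l2normD. Qed.

Fact l2_normrZ (c : R[i]) v : (l2norm (c *: v))%:C = `|c| * (l2norm v)%:C.
Proof. by rewrite l2normZ rmorphM normc_def. Qed.

Fact l2_normr0_eq0 v : (l2norm v)%:C = 0 -> v = 0.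
Proof. by case=> /l2norm_eq0. Qed.

HB.instance Definition _ :=
  Lmodule_isNormed.Build R[i] l2 l2_ler_normD l2_normrZ l2_normr0_eq0.

End EllTwo.

Section Operators.
Context {R : realType}.

Section InnerProduct.
Context {T : choiceType}.
Implicit Types (u v w : l2 R T).

(* the sum of an absolutely summable real family *)
Definition rsum (f : T -> R) : R :=
  fine (\esum_(x in [set: T]) ((EFin \o f)^\+ x)%E)
  - fine (\esum_(x in [set: T]) ((EFin \o f)^\- x)%E).

Definition ip u v : R[i] :=
  rsum (fun x => complex.Re (u x * conjc (v x)))
  +i* rsum (fun x => complex.Im (u x * conjc (v x))).

Definition finite_supp v := finite_set [set x | v x != 0].

End InnerProduct.

Section Hilbert.
Context {T : choiceType}.
Local Notation H := (l2 R T).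
Implicit Types (D S : set (H * H)) (a b K P F : H -> H) (u v w : H).

(* for linear maps of normed modules, continuous means bounded *)
Definition bounded_op a := linear a /\ continuous a.

Definition compact_op K :=
  bounded_op K /\ compact (closure (K @` [set v | `|v| <= 1])).

(* Unbounded operators are given by their graphs: D (v, w) means that v is in
   the domain of D and D v = w. *)
Definition adjoint D : set (H * H) :=
  [set uw | forall v Dv, D (v, Dv) -> ip Dv uw.1 = ip v uw.2].

Definition self_adjoint D :=
  dense [set v | exists w, D (v, w)] /\ adjoint D = D.

Definition compact_resolvent D :=
  forall z : R[i], complex.Im z != 0 ->
  exists2 K, compact_op K & forall u v, K u = v <-> D (v, u + z *: v).

(* The second component says in particular that a preserves the domain of D. *)
Definition bounded_commutator D a :=
  exists M : R, forall v Dv, D (v, Dv) ->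
  exists2 Dav, D (a v, Dav) & `|Dav - a Dv| <= M%:C * `|v|.

(* F = sign D, with the convention sign 0 = 1; a self-adjoint D with compact
   resolvent has a total set of eigenvectors, so that F is determined. *)
Definition is_sign D F :=
  bounded_op F /\
  forall (l : R) v, D (v, l%:C *: v) -> F v = if l < 0 then - v else v.

Definition orthogonal_projection P (E : set H) :=
  forall v, E (P v) /\ forall u, E u -> ip (v - P v) u = 0.

End Hilbert.

Section Index.
Context {V : lmodType R[i]}.
Implicit Types (A B : set V) (f : V -> V).

(* dim (A / B) = n, for linear subspaces B of A *)
Definition quotient_dim A B (n : nat) :=
  exists e : 'I_n -> V,
  [/\ forall k, A (e k),
      forall c : 'I_n -> R[i], B (\sum_k c k *: e k) -> forall k, c k = 0
    & forall v, A v -> exists c : 'I_n -> R[i], B (v - \sum_k c k *: e k)].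

(* f maps the subspace A into itself, its restriction to A is Fredholm, and the
   index of this restriction is z. *)
Definition fredholm_index A f (z : int) :=
  (forall v, A v -> A (f v)) /\
  exists m n : nat,
  [/\ quotient_dim (A `&` [set v | f v = 0]) [set 0] m,
      quotient_dim A (f @` A) n
    & z = m%:Z - n%:Z].

End Index.

End Operators.

(* The index set of the basis e^(n)_ij: the triple (m, s, t) of natural numbers
   stands for n = m/2, i = s - n and j = t - n. *)
Definition label :=
  {x : nat * nat * nat | (x.1.2 <= x.1.1)%N && (x.2 <= x.1.1)%N}.

Section SUq2.
Context {R : realType}.
Local Notation H := (l2 R label).
Implicit Types (x y : label) (n i j : R) (u v w : H).

Definition n_of x : R := (sval x).1.1%:R / 2.
Definition i_of x : R := (sval x).1.2%:R - n_of x.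
Definition j_of x : R := (sval x).2%:R - n_of x.

(* ebasis n i j is 0 when (n, i, j) is out of range *)
Definition e_fun n i j x : R[i] :=
  ((n_of x == n) && (i_of x == i) && (j_of x == j))%:R.

Lemma n_of_ge0 x : 0 <= n_of x.
Proof. by rewrite /n_of divr_ge0. Qed.

Lemma ni_bounds x : 0 <= n_of x + i_of x <= 2 * n_of x.
Proof.
rewrite /i_of addrC subrK ler0n /= /n_of mulrC divfK ?pnatr_eq0// ler_nat.
by case: x => /= y /andP[].
Qed.

Lemma nj_bounds x : 0 <= n_of x + j_of x <= 2 * n_of x.
Proof.
rewrite /j_of addrC subrK ler0n /= /n_of mulrC divfK ?pnatr_eq0// ler_nat.
by case: x => /= y /andP[].
Qed.

Lemma label_inj x y :
  n_of x = n_of y -> i_of x = i_of y -> j_of x = j_of y -> x = y.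
Proof.
case: x => [[[m s] t] xP]; case: y => [[[m' s'] t'] yP].
rewrite /i_of /j_of /n_of /= => n i j; apply: val_inj => /=.
have /eqP : m%:R = m'%:R :> R by lra.
have /eqP : s%:R = s'%:R :> R by lra.
have /eqP : t%:R = t'%:R :> R by lra.
by rewrite !eqr_nat => /eqP -> /eqP -> /eqP ->.
Qed.

Fact e_summable n i j : e_fun n i j \in square_summable.
Proof.
have efE x : (e_fun n i j x != 0) =
    (n_of x == n) && (i_of x == i) && (j_of x == j).
  by rewrite /e_fun pnatr_eq0 eqb0 negbK.
have sq x : sqmod (e_fun n i j x) = (e_fun n i j x != 0)%:R.
  rewrite efE /e_fun; case: (_ && _ && _).
    by rewrite /sqmod /= expr1n expr0n /= addr0.
  by rewrite /sqmod /= expr0n /= addr0.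
apply/asboolP; rewrite /sqsum; under eq_esum do rewrite sq.
have [[y yP]|no] := pselect (exists y, e_fun n i j y != 0); last first.
  rewrite esum1 ?ltry// => x _.
  by case: eqP => //= /eqP xP; exfalso; apply: no; exists x.
have yx x : (e_fun n i j x != 0) -> x = y.
  move: yP; rewrite !efE => /andP[/andP[/eqP n1 /eqP i1] /eqP j1].
  move=> /andP[/andP[/eqP n2 /eqP i2] /eqP j2].
  by apply: label_inj; congruence.
apply: (@le_lt_trans _ _ (\esum_(x in [set y]) 1%E)%E); last first.
  by rewrite esum_set1// ltry.
rewrite [leRHS]esum_mkcond; apply: le_esum => x _.
case: ifPn => [_|]; first by rewrite lee_fin; case: (_ != _).
by rewrite notin_setE /=; case: eqP => // /eqP/yx ->.
Qed.

Definition ebasis n i j : H := L2 (e_summable n i j).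

(* the term c(n,i,j) v_y, where (n,i,j) is the label of the index y with triple t;
   0 when t is out of range *)
Definition pull (c : R -> R -> R -> R) (v : label -> R[i])
    (t : option (nat * nat * nat)) : R[i] :=
  if obind insub t is Some y
  then (c (n_of y) (i_of y) (j_of y))%:C * v y else 0.

Lemma pull_summable (c : R -> R -> R -> R) v
    (src : label -> option (nat * nat * nat)) (M : R) :
  (forall y, `|c (n_of y) (i_of y) (j_of y)| <= M) ->
  (forall x x', src x = src x' -> src x -> x = x') ->
  (fun x => pull c v (src x)) \in square_summable.
Proof.
move=> cM inj; pose s x := obind insub (src x) : option label.
have sinj x x' : s x -> s x = s x' -> x = x'.
  rewrite /s; case E: (src x) => [t|//]; case E': (src x') => [t'|] /=; last first.
    by case: insub.
  case: insubP => //= y _ yt _; case: insubP => //= y' _ y't' -[yy].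
  by apply: inj; rewrite E // E' -yt -y't' yy.
pose A := [set x | isSome (s x)]; pose h x := odflt x (s x).
have hinj : set_inj A h.
  move=> x x'; rewrite !inE /A /= /h => sx sx'.
  move: (sinj x x' sx).
  by case: (s x) sx => // y _; case: (s x') sx' => // y' _ /= + yy; apply; rewrite yy.
have M0 : 0 <= M ^+ 2 by rewrite sqr_ge0.
have f0 x : (0 <= (sqmod (v x))%:E)%E by rewrite lee_fin sqmod_ge0.
pose g x : \bar R := (if x \in A then (sqmod (v (h x)))%:E else 0)%E.
have g0 x : (0 <= g x)%E by rewrite /g; case: ifP.
apply/asboolP; apply: (@le_lt_trans _ _ ((M ^+ 2)%:E * sqsum v)%E); last first.
  apply: lte_mul_pinfty; rewrite ?lee_fin//.
  by move: (l2sum_fin v); rewrite ge0_fin_numE ?sqsum_ge0.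
apply: (@le_trans _ _ ((M ^+ 2)%:E * \esum_(x in [set: label]) g x)%E).
  apply: le_trans (esumZl_le M0 g0); apply: le_esum => x _.
  have : (x \in A) = s x by apply/idP/idP; rewrite inE.
  rewrite /g => ->; rewrite /pull -/(s x) /h; case: (s x) => [y|] /=.
    rewrite -EFinM lee_fin sqmodM ler_wpM2r ?sqmod_ge0//.
    rewrite /sqmod /= expr0n /= addr0 -[X in X <= _]real_normK ?num_real//.
    by rewrite ler_pXn2r ?nnegrE ?(le_trans _ (cM y)).
  by rewrite mule0 lee_fin /sqmod /= expr0n /= addr0.
apply: lee_wpmul2l; first by rewrite lee_fin.
rewrite -(esum_mkcond A (fun x => (sqmod (v (h x)))%:E)).
rewrite -(esum_image A h (fun y => (sqmod (v y))%:E) hinj).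
by rewrite esum_mkcond; apply: le_esum => x _; case: ifP.
Qed.

Section Coefficients.
Variable q : R.

Definition a_plus n i j := Num.sqrt
  (q `^ (2 * (n + i) + 2 * (n + j) + 2)
   * ((1 - q `^ (2 * n - 2 * j + 2)) * (1 - q `^ (2 * n - 2 * i + 2))
      / ((1 - q `^ (4 * n + 2)) * (1 - q `^ (4 * n + 4))))).

Definition a_minus n i j := Num.sqrt
  ((1 - q `^ (2 * n + 2 * j)) * (1 - q `^ (2 * n + 2 * i))
   / ((1 - q `^ (4 * n)) * (1 - q `^ (4 * n + 2)))).

Definition b_plus n i j := - Num.sqrt
  (q `^ (2 * (n + j))
   * ((1 - q `^ (2 * n - 2 * j + 2)) * (1 - q `^ (2 * n + 2 * i + 2))
      / ((1 - q `^ (4 * n + 2)) * (1 - q `^ (4 * n + 4))))).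

Definition b_minus n i j := Num.sqrt
  (q `^ (2 * (n + i))
   * ((1 - q `^ (2 * n + 2 * j)) * (1 - q `^ (2 * n - 2 * i))
      / ((1 - q `^ (4 * n)) * (1 - q `^ (4 * n + 2))))).

(* The coordinates of alpha v and beta v; alpha_e and beta_e below give the action
   on the basis. *)
Definition alpha_fun v x : R[i] :=
  let: (m, s, t) := sval x in
  pull a_plus v (if m is m'.+1 then Some (m', s, t) else None)
  + pull a_minus v (Some (m.+1, s.+1, t.+1)).

Definition beta_fun v x : R[i] :=
  let: (m, s, t) := sval x in
  pull b_plus v
    (match m, s with m'.+1, s'.+1 => Some (m', s', t) | _, _ => None end)
  + pull b_minus v (Some (m.+1, s, t.+1)).

End Coefficients.

Section Generators.
Variables (q : R) (hq : 0 < q < 1).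

Lemma q_gt0_le1 : 0 < q <= 1. Proof. by case/andP: hq => -> /ltW ->. Qed.

Lemma powR_itv r : 0 <= r -> 0 <= q `^ r <= 1.
Proof. by move=> r0; rewrite powR_ge0 /= -(powRr0 q) ger_powR// q_gt0_le1. Qed.

Lemma subr_powR_itv r : 0 <= r -> 0 <= 1 - q `^ r <= 1.
Proof. by move=> /powR_itv; lra. Qed.

Lemma subr_powR_ge r : 1 <= r -> 1 - q <= 1 - q `^ r.
Proof. by move=> r1; rewrite lerD2l lerN2 ge1r_powR// q_gt0_le1. Qed.

Lemma coef_le (p x y s t : R) :
  0 <= p <= 1 -> 0 <= x <= 1 -> 0 <= y <= 1 ->
  (s == 0) || (1 - q <= s) -> 1 - q <= t ->
  `|Num.sqrt (p * (x * y / (s * t)))| <= (1 - q)^-1.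
Proof.
move=> /andP[p0 p1] /andP[x0 x1] /andP[y0 y1] sP tP.
have d0 : 0 < 1 - q by case/andP: hq; lra.
rewrite ger0_norm ?sqrtr_ge0//.
case/predU1P: sP => [->|sP].
  by rewrite mul0r invr0 !mulr0 sqrtr0 invr_ge0 ltW.
have s0 : 0 < s by apply: lt_le_trans sP.
have t0 : 0 < t by apply: lt_le_trans tP.
have -> : (1 - q)^-1 = Num.sqrt ((1 - q)^-1 ^+ 2).
  by rewrite sqrtr_sqr ger0_norm// invr_ge0 ltW.
apply: ler_wsqrtr.
have pxy : p * (x * y) <= 1 by rewrite mulr_ile1 ?mulr_ge0// mulr_ile1.
rewrite mulrA; apply: le_trans (_ : 1 * (s * t)^-1 <= _).
  by rewrite ler_wpM2r// invr_ge0 mulr_ge0// ltW.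
rewrite mul1r exprVn lef_pV2 ?posrE ?exprn_gt0 ?mulr_gt0// expr2.
by apply: ler_pM => //; exact: ltW.
Qed.

Lemma subr_powR4n x : (1 - q `^ (4 * n_of x) == 0) || (1 - q <= 1 - q `^ (4 * n_of x)).
Proof.
rewrite /n_of; case: ((sval x).1.1) => [|m].
  by rewrite mul0r mulr0 powRr0 subrr eqxx.
by rewrite subr_powR_ge ?orbT// -natr1; have := ler0n R m; lra.
Qed.

Lemma a_plus_bounded x :
  `|a_plus q (n_of x) (i_of x) (j_of x)| <= (1 - q)^-1.
Proof.
have := n_of_ge0 x; have := ni_bounds x.
have := nj_bounds x => nj ni n0.
by apply: coef_le; rewrite ?powR_itv ?subr_powR_itv ?subr_powR_ge ?orbT//; lra.
Qed.

Lemma a_minus_bounded x :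
  `|a_minus q (n_of x) (i_of x) (j_of x)| <= (1 - q)^-1.
Proof.
have := n_of_ge0 x; have := ni_bounds x.
have := nj_bounds x => nj ni n0.
rewrite /a_minus -[X in Num.sqrt X]mul1r.
by apply: coef_le; rewrite ?subr_powR4n ?powR_itv ?subr_powR_itv ?subr_powR_ge ?lexx ?ler01//; lra.
Qed.

Lemma b_plus_bounded x :
  `|b_plus q (n_of x) (i_of x) (j_of x)| <= (1 - q)^-1.
Proof.
have := n_of_ge0 x; have := ni_bounds x.
have := nj_bounds x => nj ni n0; rewrite normrN.
by apply: coef_le; rewrite ?powR_itv ?subr_powR_itv ?subr_powR_ge ?orbT//; lra.
Qed.

Lemma b_minus_bounded x :
  `|b_minus q (n_of x) (i_of x) (j_of x)| <= (1 - q)^-1.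
Proof.
have := n_of_ge0 x; have := ni_bounds x.
have := nj_bounds x => nj ni n0.
by apply: coef_le; rewrite ?subr_powR4n ?powR_itv ?subr_powR_itv ?subr_powR_ge//; lra.
Qed.

Fact alpha_summable v : alpha_fun q v \in square_summable.
Proof.
have -> : alpha_fun q v =
  (fun x => pull (a_plus q) v (let: (m, s, t) := sval x in
     if m is m'.+1 then Some (m', s, t) else None)) +
  (fun x => pull (a_minus q) v (let: (m, s, t) := sval x in
     Some (m.+1, s.+1, t.+1))).
  by apply/funext => -[[[m s] t] xP].
apply: rpredD; apply: pull_summable.
- exact: a_plus_bounded.
- case=> [[[[|m] s] t] xP] [[[[|m'] s'] t'] xP'] //= [mm ss tt] _.
  by apply: val_inj; rewrite /= mm ss tt.
- exact: a_minus_bounded.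
- case=> [[[m s] t] xP] [[[m' s'] t'] xP'] //= [mm ss tt] _.
  by apply: val_inj; rewrite /= mm ss tt.
Qed.

Fact beta_summable v : beta_fun q v \in square_summable.
Proof.
have -> : beta_fun q v =
  (fun x => pull (b_plus q) v (let: (m, s, t) := sval x in
     match m, s with m'.+1, s'.+1 => Some (m', s', t) | _, _ => None end)) +
  (fun x => pull (b_minus q) v (let: (m, s, t) := sval x in
     Some (m.+1, s, t.+1))).
  by apply/funext => -[[[m s] t] xP].
apply: rpredD; apply: pull_summable.
- exact: b_plus_bounded.
- case=> [[[[|m] [|s]] t] xP] [[[[|m'] [|s']] t'] xP'] //= [mm ss tt] _.
  by apply: val_inj; rewrite /= mm ss tt.
- exact: b_minus_bounded.
- case=> [[[m s] t] xP] [[[m' s'] t'] xP'] //= [mm ss tt] _.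
  by apply: val_inj; rewrite /= mm ss tt.
Qed.

Definition alpha v : H := L2 (alpha_summable v).
Definition beta v : H := L2 (beta_summable v).

Lemma pull_e (c : R -> R -> R -> R) y t :
  pull c (ebasis (n_of y) (i_of y) (j_of y)) t =
  (c (n_of y) (i_of y) (j_of y))%:C * (t == Some (sval y))%:R.
Proof.
rewrite /pull; case: t => [t|] /=; last by rewrite mulr0.
case: insubP => [z _ zt|]; last first.
  by case: eqP => [[->]|]; rewrite ?mulr0// (valP y).
rewrite /e_fun; have [zy|zy] := eqVneq z y.
  by rewrite zy !eqxx -zt zy eqxx.
have -> : (Some t == Some (sval y)) = false.
  by apply/negbTE; apply: contra_neq zy => -[ty]; apply: val_inj; rewrite zt ty.
rewrite mulr0; case: eqP => [h1|_]; last by rewrite mulr0.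
case: eqP => [h2|_]; last by rewrite mulr0.
case: eqP => [h3|_]; last by rewrite mulr0.
by move: zy; rewrite (label_inj h1 h2 h3) eqxx.
Qed.

Lemma e_fun_in n i j (m s t : nat) x :
  2 * n = m%:R -> n + i = s%:R -> n + j = t%:R ->
  e_fun n i j x = (sval x == (m, s, t))%:R.
Proof.
move=> nm ns nt; congr (_%:R); congr nat_of_bool.
have -> : n = m%:R / 2 by lra.
have -> : i = s%:R - m%:R / 2 by lra.
have -> : j = t%:R - m%:R / 2 by lra.
case: x => [[[m' s'] t'] xP]; rewrite /i_of /j_of /n_of /= !xpair_eqE.
have -> : (m'%:R / 2 == m%:R / 2 :> R) = (m' == m).
  by rewrite (inj_eq (mulIf _)) ?invr_eq0 ?pnatr_eq0// eqr_nat.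
by case: eqP => //= ->; rewrite !(inj_eq (addIr _)) !eqr_nat.
Qed.

Lemma e_fun_out n i j x :
  [|| n + i < 0, n + j < 0 | 2 * n < 0] -> e_fun n i j x = 0.
Proof.
have := n_of_ge0 x; have := ni_bounds x.
have := nj_bounds x => nj ni n0.
rewrite /e_fun; case: eqP => [<-|//]; case: eqP => [<-|//].
by case: eqP => [<- out|//]; exfalso; move: out; lra.
Qed.

Lemma alpha_e y (n := n_of y) (i := i_of y) (j := j_of y) :
  alpha (ebasis n i j) =
  (a_plus q n i j)%:C *: ebasis (n + 1/2) (i - 1/2) (j - 1/2)
  + (a_minus q n i j)%:C *: ebasis (n - 1/2) (i - 1/2) (j - 1/2).
Proof.
apply: val_inj; apply/funext => x; rewrite /= /alpha_fun.
rewrite [RHS]/(_ * e_fun _ _ _ x + _ * e_fun _ _ _ x).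
rewrite /n /i /j {n i j}.
have -> : e_fun (n_of y + 1/2) (i_of y - 1/2) (j_of y - 1/2) x =
    (sval x == ((sval y).1.1.+1, (sval y).1.2, (sval y).2))%:R.
  by apply: e_fun_in; rewrite /i_of /j_of /n_of
      -?[_.1.1.+1%:R]natr1 -?[_.1.2.+1%:R]natr1; lra.
have -> : e_fun (n_of y - 1/2) (i_of y - 1/2) (j_of y - 1/2) x =
    (((sval x).1.1.+1, (sval x).1.2.+1, (sval x).2.+1) == sval y)%:R.
  case: y => [[[m [|s]] t] yP].
  - rewrite e_fun_out; last by rewrite /i_of /j_of /n_of /=; lra.
    by rewrite /= !xpair_eqE ?andbF.
  case: t yP => [|t] yP.
  - rewrite e_fun_out; last by rewrite /i_of /j_of /n_of /=; lra.
    by rewrite /= !xpair_eqE ?andbF.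
  case: m yP => [|m] yP; first by case/andP: (yP).
  rewrite (@e_fun_in _ _ _ m s t); last 3 first.
  - by rewrite /i_of /j_of /n_of /= -?(natr1 _ m) -?(natr1 _ s) -?(natr1 _ t); lra.
  - by rewrite /i_of /j_of /n_of /= -?(natr1 _ m) -?(natr1 _ s) -?(natr1 _ t); lra.
  - by rewrite /i_of /j_of /n_of /= -?(natr1 _ m) -?(natr1 _ s) -?(natr1 _ t); lra.
  by case: x => [[[]]].
case: x => [[[m s] t] xP]; rewrite /= !pull_e; congr (_ * _%:R + _).
by case: m xP => [|m] xP; case: (sval y) => [[m' s'] t'].
Qed.

Lemma beta_e y (n := n_of y) (i := i_of y) (j := j_of y) :
  beta (ebasis n i j) =
  (b_plus q n i j)%:C *: ebasis (n + 1/2) (i + 1/2) (j - 1/2)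
  + (b_minus q n i j)%:C *: ebasis (n - 1/2) (i + 1/2) (j - 1/2).
Proof.
apply: val_inj; apply/funext => x; rewrite /= /beta_fun.
rewrite [RHS]/(_ * e_fun _ _ _ x + _ * e_fun _ _ _ x).
rewrite /n /i /j {n i j}.
have -> : e_fun (n_of y + 1/2) (i_of y + 1/2) (j_of y - 1/2) x =
    (sval x == ((sval y).1.1.+1, (sval y).1.2.+1, (sval y).2))%:R.
  by apply: e_fun_in; rewrite /i_of /j_of /n_of
      -?[_.1.1.+1%:R]natr1 -?[_.1.2.+1%:R]natr1; lra.
have -> : e_fun (n_of y - 1/2) (i_of y + 1/2) (j_of y - 1/2) x =
    (((sval x).1.1.+1, (sval x).1.2, (sval x).2.+1) == sval y)%:R.
  case: y => [[[m s] [|t]] yP].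
  - rewrite e_fun_out; last by rewrite /i_of /j_of /n_of /=; lra.
    by rewrite /= !xpair_eqE ?andbF.
  case: m yP => [|m] yP; first by case/andP: (yP).
  rewrite (@e_fun_in _ _ _ m s t); last 3 first.
  - by rewrite /i_of /j_of /n_of /= -?(natr1 _ m) -?(natr1 _ s) -?(natr1 _ t); lra.
  - by rewrite /i_of /j_of /n_of /= -?(natr1 _ m) -?(natr1 _ s) -?(natr1 _ t); lra.
  - by rewrite /i_of /j_of /n_of /= -?(natr1 _ m) -?(natr1 _ s) -?(natr1 _ t); lra.
  by case: x => [[[]]].
case: x => [[[m s] t] xP]; rewrite /= !pull_e; congr (_ * _%:R + _).
case: (sval y) => [[m' s'] t'].
by case: m xP => [|m] xP; case: s xP => [|s] xP //=; rewrite !xpair_eqE andbF.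
Qed.

Definition lin_ext (f : label -> H) : set (H * H) :=
  [set vw | finite_supp vw.1 /\
    vw.2 = \sum_(x \in [set x | vw.1 x != 0]) vw.1 x *: f x].

Definition A0 := lin_ext (fun x =>
  (q `^ j_of x)%:C *: ebasis (n_of x) (i_of x) (j_of x)).

Definition a1_coef n j := Num.sqrt
  (q `^ (- 2 * n) + q `^ (2 * n + 2) - q `^ (- 2 * j) - q `^ (2 * j + 2)).

(* at j = n the coefficient and the basis vector are both 0 *)
Definition A1 := lin_ext (fun x =>
  (a1_coef (n_of x) (j_of x))%:C *: ebasis (n_of x) (i_of x) (j_of x + 1)).

(* D and S commute on the linear span of the basis *)
Definition commute_on_span (D S : set (H * H)) :=
  forall v, finite_supp v ->
  exists Dv Sv w, [/\ D (v, Dv), S (v, Sv), D (Sv, w) & S (Dv, w)].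

(* the self-adjoint operator e^(n)_ij |-> d n i *: e^(n)_ij, on its maximal domain *)
Definition diag (d : R -> R -> R) : set (H * H) :=
  [set vw : H * H | forall x, vw.2 x = (d (n_of x) (i_of x))%:C * vw.1 x].

Definition equivariant (D : set (H * H)) :=
  (exists d, D = diag d) /\
  [/\ commute_on_span D A0, commute_on_span D A1
    & commute_on_span D (adjoint A1)].

(* The representation of C(SU_q(2)) on l2 is faithful: C(SU_q(2)) is identified
   with its image, the norm closure of the *-algebra generated by alpha, beta. *)
Inductive Af : (H -> H) -> Prop :=
| Af_alpha : Af alpha
| Af_beta : Af beta
| Af_id : Af id
| Af_add a b : Af a -> Af b -> Af (fun v => a v + b v)
| Af_scale (c : R[i]) a : Af a -> Af (fun v => c *: a v)
| Af_mul a b : Af a -> Af b -> Af (fun v => a (b v))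
| Af_star a b : Af a -> (forall u v, ip (a u) v = ip u (b v)) -> Af b.

Definition CSUq2 : set (H -> H) :=
  [set a | bounded_op a /\ forall eps : R, 0 < eps ->
    exists2 b, Af b & forall v, `|a v - b v| <= eps%:C * `|v|].

Definition odd_spectral_triple (D : set (H * H)) :=
  [/\ self_adjoint D, compact_resolvent D
    & forall a, Af a -> bounded_commutator D a].

Section Pairing.
Variable k : nat.

Definition mx_act (g : 'M[H -> H]_k) (v : 'I_k -> H) : 'I_k -> H :=
  fun r => \sum_s g r s (v s).

Definition GL_CSUq2 (g : 'M[H -> H]_k) :=
  (forall r s, CSUq2 (g r s)) /\
  exists h : 'M[H -> H]_k,
  [/\ forall r s, CSUq2 (h r s), cancel (mx_act g) (mx_act h)
    & cancel (mx_act h) (mx_act g)].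

Definition amplify (P : H -> H) (v : 'I_k -> H) : 'I_k -> H := fun r => P (v r).

(* <[g], [D]> = z *)
Definition index_pairing (D : set (H * H)) (g : 'M[H -> H]_k) (z : int) :=
  exists F P,
  [/\ is_sign D F, orthogonal_projection P [set v | F v = - v]
    & @fredholm_index R ('I_k -> H) (range (amplify P))
        (fun v : 'I_k -> H => amplify P (mx_act g (amplify P v))) (- z)].

End Pairing.

(* every class in K_1 is represented by an invertible matrix over C(SU_q(2)) *)
Definition nontrivial_chern (D : set (H * H)) :=
  exists k (g : 'M[H -> H]_k) (z : int),
  [/\ GL_CSUq2 g, index_pairing D g z & z != 0].

End Generators.

Definition admissible n i :=
  exists m s : nat, [/\ (s <= m)%N, n = m%:R / 2 & i = s%:R - n].

Definition T_set (d : R -> R -> R) (k : nat) : set R :=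
  [set y | exists a b : nat,
    (k < a)%N /\ y = d ((b%:R + a%:R) / 2) ((b%:R - a%:R) / 2)].

Definition S_set (d : R -> R -> R) (l r : nat) : set R :=
  [set y | exists b : nat,
    (l < b)%N /\ y = d ((b%:R + r%:R) / 2) ((b%:R - r%:R) / 2)].

(* the collection T(k), S(l,0), ..., S(l,k) *)
Definition tail_sets (d : R -> R -> R) (k l : nat) : set (set R) :=
  [set X | X = T_set d k \/ exists2 r, (r <= k)%N & X = S_set d l r].

End SUq2.

(* Main.v *)
(* Index the basis by the natural numbers a = n - i, b = n + i, t = n + j and regard
   d as a function of (a, b). Both generators move b with coefficients O(1) and a with
   coefficients O(q^b); at t = 0 the step b -> b + 1 of beta, and at b = t = 0 the step
   a -> a + 1 of alpha, have coefficients bounded below. So bounded commutators amount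
   to d(a, b+1) - d(a, b) = O(1) and d(a+1, b) - d(a, b) = O(b + 1), the latter
   propagating from b = 0 by telescoping.
   Compact resolvent means |d| -> oo; as steps are bounded along the rows and along
   the column b = 0, d keeps a constant sign on far rows and on the end of each row.
   If all these signs agree, P or 1 - P has finite rank, and every index vanishes.
   Otherwise one computes the index of the fundamental unitary: in Clebsch-Gordan
   bases its compression is explicit cell by cell, and counting dimensions gives, up
   to sign, the number of rows a <= k whose sign differs from that of T(k). *)
From HB Require Import structures.
Require Import Defs.
From mathcomp Require Import all_boot all_order all_algebra.
From mathcomp Require Import complex.
From mathcomp Require Import all_classical all_reals all_analysis.
From mathcomp Require Import ring lra zify.

Set Implicit Arguments.
Unset Strict Implicit.
Unset Printing Implicit Defensive.

Import Order.TTheory GRing.Theory Num.Theory.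
Import numFieldNormedType.Exports.

Local Open Scope classical_set_scope.
Local Open Scope ring_scope.
Local Open Scope complex_scope.

(** * Absolutely summable families and inner products *)

(** Why the index can be counted: attach to each cell (a, b) the square with corners (a, b), (a+1,
    b), (a, b+1), (a+1, b+1). In Clebsch-Gordan coordinates the fundamental unitary rotates the
    inputs at (a, b) and (a+1, b+1) into the outputs at (a+1, b) and (a, b+1). Compressing by P
    keeps only the corners of negative sign. If all four signs agree, the block is a full rotation
    or is absent. If each row is of constant sign and the two rows differ, one input and one output
    survive, linked by a factor of modulus at least 1 - q. Both cases are uniformly invertible, and
    only the squares with a <= k and b <= l escape them. So the image and a finite-dimensional space
    Y together span the range of P, and the index is a difference of two finite dimensions. No
    general Fredholm theory enters: the vanishing of the other indices is also reduced to
    finite-dimensional linear algebra. A commutator bound asserts in addition that the domain of D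
    is preserved; this is carried through sums, products and adjoints together with the estimate. *)

Section AbsoluteSums.
Context {R : realType} {T : choiceType}.
Implicit Types f g : T -> R.

Definition esumR f : \bar R := \esum_(x in [set: T]) (f x)%:E.

Definition abs_summable f := (esumR (fun x => `|f x|%R) < +oo)%E.

Lemma ler_abs_summable f g :
  (forall x, `|f x| <= g x) -> (esumR g < +oo)%E -> abs_summable f.
Proof.
by move=> fg; apply: le_lt_trans; apply: le_esum => x _; rewrite lee_fin.
Qed.

Lemma esumR_fin f : (forall x, 0 <= f x) -> abs_summable f -> esumR f \is a fin_num.
Proof.
move=> f0; rewrite ge0_fin_numE; last by apply: esum_ge0 => x _; rewrite lee_fin.
by apply: le_lt_trans; apply: le_esum => x _; rewrite lee_fin ler_norm.
Qed.

Lemma abs_summableD f g :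
  abs_summable f -> abs_summable g -> abs_summable (fun x => f x + g x).
Proof.
move=> sf sg; apply: le_lt_trans (lte_add_pinfty sf sg).
rewrite -esumD; [|by move=> *; rewrite lee_fin..].
by apply: le_esum => x _; rewrite -EFinD lee_fin ler_normD.
Qed.

(** The positive and negative parts in [rsum] are not additive, but any presentation as a difference
    of nonnegative summable families gives the same value, and such presentations add termwise.
    Linearity of [rsum] follows by writing f as (|f| + f) - |f|. *)
Lemma rsum_diff f g : (forall x, 0 <= f x) -> (forall x, 0 <= g x) ->
  abs_summable f -> abs_summable g ->
  rsum (fun x => f x - g x) = fine (esumR f) - fine (esumR g).
Proof.
move=> f0 g0 sf sg.
have fin h : (forall x, 0 <= h x) -> abs_summable h -> esumR h \is a fin_num.
  exact: esumR_fin.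
have sE h : abs_summable h -> summable [set: T] (EFin \o h).
  by move=> sh; apply: le_lt_trans sh; apply: le_esum => x _.
have E : _ = _ := esumB (sE _ sf) (sE _ sg) (fun x _ => f0 x) (fun x _ => g0 x).
have fgE : ((EFin \o f) \- (EFin \o g))%E = EFin \o (fun x => f x - g x).
  by apply/funext => x.
have sfg : summable [set: T] (EFin \o (fun x => f x - g x)).
  by rewrite -fgE; exact: summableB (sE _ sf) (sE _ sg).
rewrite fgE in E; rewrite /rsum -!fineB ?fin//; first by congr fine.
- rewrite (@eq_esum _ _ _ _ (abse \o (EFin \o (fun x => (f x - g x)%R))^\+%E)).
    by rewrite -summableE; exact: summable_funepos.
  by move=> x _; rewrite [RHS]gee0_abs.
- rewrite (@eq_esum _ _ _ _ (abse \o (EFin \o (fun x => (f x - g x)%R))^\-%E)).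
    by rewrite -summableE; exact: summable_funeneg.
  by move=> x _; rewrite [RHS]gee0_abs.
Qed.

Lemma abs_summable_norm f : abs_summable f -> abs_summable (fun x => `|f x|).
Proof. by rewrite /abs_summable; under [X in esumR X]eq_fun do rewrite -normr_id. Qed.

Lemma abs_summable_shift f : abs_summable f -> abs_summable (fun x => `|f x| + f x).
Proof. by move=> sf; apply: abs_summableD => //; exact: abs_summable_norm. Qed.

Lemma esumRD f g : (forall x, 0 <= f x) -> (forall x, 0 <= g x) ->
  abs_summable f -> abs_summable g ->
  fine (esumR (fun x => f x + g x)) = fine (esumR f) + fine (esumR g).
Proof.
move=> f0 g0 sf sg; rewrite -fineD ?esumR_fin// /esumR.
by under eq_esum do rewrite EFinD; rewrite esumD// => *; rewrite lee_fin.
Qed.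

Lemma norm_shift_ge0 (r : R) : 0 <= `|r| + r.
Proof. by rewrite -lerBlDr sub0r -normrN ler_norm. Qed.

Lemma rsumE f : abs_summable f ->
  rsum f = fine (esumR (fun x => `|f x| + f x)) - fine (esumR (fun x => `|f x|)).
Proof.
move=> sf; rewrite -rsum_diff => [|x|x||]; last 4 first.
- exact: norm_shift_ge0.
- exact: normr_ge0.
- exact: abs_summable_shift.
- exact: abs_summable_norm.
by congr rsum; apply/funext => x; rewrite addrC addKr.
Qed.

Lemma rsumD f g : abs_summable f -> abs_summable g ->
  rsum (fun x => f x + g x) = rsum f + rsum g.
Proof.
move=> sf sg; have nf := abs_summable_norm sf; have ng := abs_summable_norm sg.
have pf := abs_summable_shift sf; have pg := abs_summable_shift sg.
have -> : (fun x => f x + g x) =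
    fun x => ((`|f x| + f x) + (`|g x| + g x)) - (`|f x| + `|g x|).
  by apply/funext => x; ring.
have f0 x := norm_shift_ge0 (f x); have g0 x := norm_shift_ge0 (g x).
have -> : rsum (fun x => ((`|f x| + f x) + (`|g x| + g x)) - (`|f x| + `|g x|)) =
    fine (esumR (fun x => (`|f x| + f x) + (`|g x| + g x))) -
    fine (esumR (fun x => `|f x| + `|g x|)).
  by apply: rsum_diff => [x|x||]; [exact: addr_ge0|exact: addr_ge0|exact: abs_summableD..].
rewrite (esumRD f0 g0 pf pg) (esumRD (fun x => normr_ge0 _) (fun x => normr_ge0 _) nf ng).
by rewrite (rsumE sf) (rsumE sg); ring.
Qed.

Lemma rsumN f : abs_summable f -> rsum (fun x => - f x) = - rsum f.
Proof.
move=> sf; rewrite (rsumE sf) opprB -rsum_diff => [|x|x||]; last 4 first.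
- exact: normr_ge0.
- exact: norm_shift_ge0.
- exact: abs_summable_norm.
- exact: abs_summable_shift.
by congr rsum; apply/funext => x; ring.
Qed.

Lemma esumRZ (c : R) f : 0 <= c -> (forall x, 0 <= f x) -> abs_summable f ->
  fine (esumR (fun x => c * f x)) = c * fine (esumR f).
Proof.
move=> c0 f0 sf.
have le (e : R) h : 0 <= e -> (forall x, 0 <= h x) ->
    (esumR (fun x => e * h x)%R <= e%:E * esumR h)%E.
  move=> e0 h0; rewrite /esumR; under eq_esum do rewrite EFinM.
  by apply: esumZl_le => // x; rewrite lee_fin.
have [->|cn0] := eqVneq c 0.
  by rewrite mul0r /esumR esum1// => x _; rewrite mul0r.
(* [le] is one-sided; the reverse inequality is the same one for c^-1. *)
suff -> : esumR (fun x => c * f x) = (c%:E * esumR f)%E by rewrite fineM ?esumR_fin.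
apply/eqP; rewrite eq_le le//= -lee_pdivlMl ?lt0r ?cn0//.
have {1}-> : f = fun x => c^-1 * (c * f x) by apply/funext => x; rewrite mulKf.
by apply: le; [rewrite invr_ge0|move=> x; rewrite mulr_ge0].
Qed.

Lemma abs_summableZ (c : R) f : abs_summable f -> abs_summable (fun x => c * f x).
Proof.
move=> sf; apply: (@ler_abs_summable _ (fun x => `|c| * `|f x|)) => [x|].
  by rewrite normrM.
rewrite /esumR; under eq_esum do rewrite EFinM.
apply: le_lt_trans (esumZl_le _ _) _ => //.
by apply: lte_mul_pinfty; rewrite ?lee_fin.
Qed.

Lemma rsumZ (c : R) f : abs_summable f -> rsum (fun x => c * f x) = c * rsum f.
Proof.
move=> sf.
wlog c0 : c / 0 <= c.
  move=> H; have [/H//|c0] := leP 0 c.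
  rewrite -[RHS]opprK -mulNr -H ?oppr_ge0 ?(ltW c0)// -rsumN ?abs_summableZ//.
  by congr rsum; apply/funext => x; rewrite mulNr opprK.
have -> : (fun x => c * f x) = fun x => c * (`|f x| + f x) - c * `|f x|.
  by apply/funext => x; ring.
have nf := abs_summable_norm sf; have pf := abs_summable_shift sf.
have f0 x := norm_shift_ge0 (f x).
have -> : rsum (fun x => c * (`|f x| + f x) - c * `|f x|) =
    fine (esumR (fun x => c * (`|f x| + f x))) - fine (esumR (fun x => c * `|f x|)).
  apply: rsum_diff => [x|x||]; [exact: mulr_ge0|exact: mulr_ge0|exact: abs_summableZ..].
rewrite (esumRZ c0 f0 pf) (esumRZ c0 (fun x => normr_ge0 _) nf) (rsumE sf).
by rewrite mulrBr.
Qed.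

Lemma rsum_ge0 f : (forall x, 0 <= f x) -> abs_summable f -> rsum f = fine (esumR f).
Proof.
move=> f0 sf; have -> : rsum f = rsum (fun x => f x - 0).
  by congr rsum; apply/funext => x; rewrite subr0.
have s0 : esumR (fun=> 0 : R) = 0%E by rewrite /esumR esum1.
rewrite rsum_diff//; last by rewrite /abs_summable normr0 s0 ltry.
by rewrite s0 subr0.
Qed.

End AbsoluteSums.

Section Reindexing.
Context {R : realType} {T : choiceType}.
Variables (src tgt : T -> option T).
Hypothesis srctgt : forall x y, src x = Some y <-> tgt y = Some x.

(** [src] and [tgt] are mutually inverse partial injections, so both sums run over the same set of
    linked pairs. This is what moves a weighted shift across the inner product. *)
Lemma esum_reindex_partial (h : T -> T -> \bar R) :
  (\esum_(x in [set: T]) (if src x is Some y then h x y else 0) =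
   \esum_(y in [set: T]) (if tgt y is Some x then h x y else 0))%E.
Proof.
pose A := [set x | isSome (src x)]; pose B := [set y | isSome (tgt y)].
transitivity (\esum_(x in A) (if src x is Some y then h x y else 0))%E.
  rewrite [RHS]esum_mkcond; apply: eq_esum => x _.
  by case: ifPn => //; rewrite notin_setE /A /=; case: (src x).
transitivity (\esum_(y in B) (if tgt y is Some x then h x y else 0))%E; last first.
  rewrite [LHS]esum_mkcond; apply: eq_esum => x _.
  by case: ifPn => //; rewrite notin_setE /B /=; case: (tgt x).
rewrite (@reindex_esum _ _ _ A B (fun x => odflt x (src x))).
  apply: eq_esum => x; rewrite /A /=; case E: (src x) => [y|//] _ /=.
  by move/srctgt : E => ->.
split.
- by move=> x; rewrite /A /B /=; case E: (src x) => [y|//] _ /=; move/srctgt : E => ->.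
- move=> x x'; rewrite !inE /A /=.
  case E: (src x) => [y|//] _; case E': (src x') => [y'|//] _ /= yy; subst y'.
  by move/srctgt : E; move/srctgt : E' => -> [].
- move=> y; rewrite /B /=; case E: (tgt y) => [x|//] _; exists x.
    by rewrite /A /=; move/srctgt : E => ->.
  by move/srctgt : E => ->.
Qed.

Lemma rsum_reindex_partial (h : T -> T -> R) :
  rsum (fun x => if src x is Some y then h x y else 0) =
  rsum (fun y => if tgt y is Some x then h x y else 0).
Proof.
rewrite /rsum; congr (fine _ - fine _).
- have E := esum_reindex_partial (fun x y => maxe (h x y)%:E 0%E).
  etransitivity; last etransitivity; [|exact: E|]; apply: eq_esum => x _.
    by rewrite funeposE /=; case: (src x) => //=; rewrite maxxx.
  by rewrite funeposE /=; case: (tgt x) => //=; rewrite maxxx.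
- have E := esum_reindex_partial (fun x y => maxe (- (h x y)%:E)%E 0%E).
  etransitivity; last etransitivity; [|exact: E|]; apply: eq_esum => x _.
    by rewrite funenegE /=; case: (src x) => //=; rewrite oppr0 maxxx.
  by rewrite funenegE /=; case: (tgt x) => //=; rewrite oppr0 maxxx.
Qed.

End Reindexing.

Section L2Arithmetic.
Context {R : realType} {T : choiceType}.
Local Notation H := (l2 R T).
Implicit Types (u v w : H) (c : R[i]) (x y : T).

Lemma l2P u v : (forall x, u x = v x) -> u = v.
Proof. by move=> uv; apply: val_inj; apply/funext. Qed.

Lemma l2_add u v x : (u + v) x = u x + v x. Proof. by []. Qed.
Lemma l2_scale c u x : (c *: u) x = c * u x. Proof. by []. Qed.
Lemma l2_opp u x : (- u) x = - u x. Proof. by []. Qed.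
Lemma l2_sub u v x : (u - v) x = u x - v x. Proof. by []. Qed.
Lemma l2_zero x : (0 : H) x = 0. Proof. by []. Qed.

Lemma l2_sum (I : Type) (r : seq I) (P : pred I) (F : I -> H) x :
  (\sum_(i <- r | P i) F i) x = \sum_(i <- r | P i) F i x.
Proof. by elim/big_rec2: _ => [|i a b _ <-]. Qed.

Lemma l2normE v : `|v| = (l2norm v)%:C. Proof. by []. Qed.

Lemma ler_l2norm v w (M : R) : (`|v| <= M%:C * `|w|) = (l2norm v <= M * l2norm w).
Proof. by rewrite !l2normE -rmorphM lecR. Qed.

Lemma ler_l2norm1 v : (`|v| <= 1) = (l2norm v <= 1).
Proof. by rewrite l2normE -[1 in LHS]/(1%:C) lecR. Qed.

Lemma sqmod_real (r : R) : sqmod r%:C = r ^+ 2.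
Proof. by rewrite /sqmod /= expr0n /= addr0. Qed.

Lemma sqmod0 : sqmod (0 : R[i]) = 0.
Proof. by rewrite (sqmod_real 0) expr0n. Qed.

Lemma sqmodN c : sqmod (- c) = sqmod c.
Proof. by case: c => a b; rewrite /sqmod /= !sqrrN. Qed.

Lemma sqmod_conj c : sqmod (conjc c) = sqmod c.
Proof. by case: c => a b; rewrite /sqmod /= sqrrN. Qed.

Lemma l2norm_sqr v : l2norm v ^+ 2 = fine (esumR (fun x => sqmod (v x))).
Proof. by apply: EFin_inj; rewrite l2norm_sq fineK// l2sum_fin. Qed.

Lemma l2normN v : l2norm (- v) = l2norm v.
Proof. by congr (Num.sqrt (fine _)); apply: eq_esum => x _; rewrite sqmodN. Qed.

Lemma l2normB u v : l2norm (u - v) = l2norm (v - u).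
Proof. by rewrite -l2normN opprB. Qed.

Lemma l2norm0 : l2norm (0 : H) = 0.
Proof. by rewrite -[0](scale0r 0) l2normZ sqmod0 sqrtr0 mul0r. Qed.

Lemma sqmod_summable v : abs_summable (fun x => sqmod (v x)).
Proof.
apply: (@ler_abs_summable _ _ _ (fun x => sqmod (v x))) => [x|].
  by rewrite ger0_norm ?sqmod_ge0.
by have := l2sum_fin v; rewrite ge0_fin_numE ?sqsum_ge0.
Qed.

Lemma sum_sqmod_le v (r : seq T) : uniq r ->
  \sum_(x <- r) sqmod (v x) <= l2norm v ^+ 2.
Proof.
move=> ur; rewrite -lee_fin l2norm_sq; apply: esum_ge; exists [set` r].
  by split=> //; exact: finite_seq.
by rewrite -fsbig_seq// sumEFin.
Qed.

(** Together with [sum_sqmod_le] this reduces norm estimates to finite duplicate-free lists, where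
    coordinatewise bounds can be summed directly. *)
Lemma l2norm_le_sum v (M : R) : 0 <= M ->
  (forall r : seq T, uniq r -> \sum_(x <- r) sqmod (v x) <= M ^+ 2) ->
  l2norm v <= M.
Proof.
move=> M0 vM; rewrite -(@ler_pXn2r _ 2)// ?nnegrE ?l2norm_ge0//.
rewrite -lee_fin l2norm_sq; apply: ge_ereal_sup => _ [F [finF _] <-].
by rewrite fsbig_finite//= sumEFin lee_fin vM// finmap.fset_uniq.
Qed.

Lemma summable_le_sum (f : T -> R[i]) (M : R) :
  (forall r : seq T, uniq r -> \sum_(x <- r) sqmod (f x) <= M) ->
  f \in square_summable.
Proof.
move=> fM; apply/asboolP; apply: (@le_lt_trans _ _ M%:E); last by rewrite ltry.
apply: ge_ereal_sup => _ [F [finF _] <-].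
by rewrite fsbig_finite//= sumEFin lee_fin fM// finmap.fset_uniq.
Qed.

Lemma sqmod_le v x : sqmod (v x) <= l2norm v ^+ 2.
Proof. by have := @sum_sqmod_le v [:: x] isT; rewrite big_seq1. Qed.

End L2Arithmetic.

Section InnerProductTheory.
Context {R : realType} {T : choiceType}.
Local Notation H := (l2 R T).
Implicit Types (u v w : H) (c : R[i]) (x y : T).

Lemma Re_prod_summable u v : abs_summable (fun x => complex.Re (u x * conjc (v x))).
Proof.
apply: (@ler_abs_summable _ _ _ (fun x => sqmod (u x) + sqmod (v x))) => [x|].
  case: (u x) (v x) => [a b] [c d]; rewrite /sqmod /=.
  have := sqr_ge0 (a + c); have := sqr_ge0 (a - c).
  have := sqr_ge0 (b + d); have := sqr_ge0 (b - d).
  by rewrite ler_norml => *; apply/andP; split; nra.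
have := abs_summableD (sqmod_summable u) (sqmod_summable v).
by apply: le_lt_trans; apply: le_esum => x _; rewrite lee_fin ler_norm.
Qed.

Lemma Im_prod_summable u v : abs_summable (fun x => complex.Im (u x * conjc (v x))).
Proof.
apply: (@ler_abs_summable _ _ _ (fun x => sqmod (u x) + sqmod (v x))) => [x|].
  case: (u x) (v x) => [a b] [c d]; rewrite /sqmod /=.
  have := sqr_ge0 (a + d); have := sqr_ge0 (a - d).
  have := sqr_ge0 (b + c); have := sqr_ge0 (b - c).
  by rewrite ler_norml => *; apply/andP; split; nra.
have := abs_summableD (sqmod_summable u) (sqmod_summable v).
by apply: le_lt_trans; apply: le_esum => x _; rewrite lee_fin ler_norm.
Qed.

Lemma ipDl u u' v : ip (u + u') v = ip u v + ip u' v.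
Proof.
apply/eqP; rewrite eq_complex /=; apply/andP; split; apply/eqP.
  rewrite -rsumD; [|exact: Re_prod_summable..].
  by congr rsum; apply/funext => x; rewrite -raddfD -mulrDl.
rewrite -rsumD; [|exact: Im_prod_summable..].
by congr rsum; apply/funext => x; rewrite -raddfD -mulrDl.
Qed.

Lemma ipZl c u v : ip (c *: u) v = c * ip u v.
Proof.
have sR := Re_prod_summable u v; have sI := Im_prod_summable u v.
apply/eqP; rewrite eq_complex; apply/andP; split; apply/eqP.
  have -> : complex.Re (c * ip u v) =
      complex.Re c * rsum (fun x => complex.Re (u x * conjc (v x))) +
      - complex.Im c * rsum (fun x => complex.Im (u x * conjc (v x))).
    by case: c => a b; rewrite /ip /= mulNr.
  rewrite -!rsumZ// -rsumD; [|exact: abs_summableZ..].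
  congr rsum; apply/funext => x; rewrite -[(c *: u) x]/(c * u x).
  by case: c (u x) (v x) => [a b] [a1 b1] [a2 b2] /=; ring.
have -> : complex.Im (c * ip u v) =
    complex.Re c * rsum (fun x => complex.Im (u x * conjc (v x))) +
    complex.Im c * rsum (fun x => complex.Re (u x * conjc (v x))).
  by case: c => a b; rewrite /ip /=.
rewrite -!rsumZ// -rsumD; [|exact: abs_summableZ..].
congr rsum; apply/funext => x; rewrite -[(c *: u) x]/(c * u x).
by case: c (u x) (v x) => [a b] [a1 b1] [a2 b2] /=; ring.
Qed.

Lemma ipC u v : ip v u = conjc (ip u v).
Proof.
rewrite /ip /= -rsumN; last exact: Im_prod_summable.
congr (_ +i* _); congr rsum; apply/funext => x;
  by case: (u x) (v x) => [a1 b1] [a2 b2] /=; ring.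
Qed.

Lemma ipDr u v v' : ip u (v + v') = ip u v + ip u v'.
Proof. by rewrite (ipC (v + v')) (ipC v) (ipC v') ipDl rmorphD. Qed.

Lemma ipZr c u v : ip u (c *: v) = conjc c * ip u v.
Proof. by rewrite (ipC (c *: v)) (ipC v) ipZl rmorphM. Qed.

Lemma ip0l v : ip 0 v = 0.
Proof. by rewrite -(scale0r v) ipZl mul0r. Qed.

Lemma ipBl u u' v : ip (u - u') v = ip u v - ip u' v.
Proof. by rewrite -scaleN1r ipDl ipZl mulN1r. Qed.

Lemma ip_suml (I : Type) (r : seq I) (P : pred I) (F : I -> H) v :
  ip (\sum_(i <- r | P i) F i) v = \sum_(i <- r | P i) ip (F i) v.
Proof. by elim/big_rec2: _ => [|i a b _ <-]; rewrite ?ip0l// ipDl. Qed.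

Lemma ip_eq u v u' v' :
  (forall x, u x * conjc (v x) = u' x * conjc (v' x)) -> ip u v = ip u' v'.
Proof.
move=> E; rewrite /ip; congr (_ +i* _); congr rsum; apply/funext => x;
  by rewrite E.
Qed.

Lemma Re_ip_self u : complex.Re (ip u u) = l2norm u ^+ 2.
Proof.
rewrite /= l2norm_sqr -rsum_ge0; last 2 first.
- by move=> x; exact: sqmod_ge0.
- exact: sqmod_summable.
by congr rsum; apply/funext => x; case: (u x) => a b; rewrite /sqmod /=; ring.
Qed.

Lemma l2normD_sqr u v :
  l2norm (u + v) ^+ 2 = l2norm u ^+ 2 + l2norm v ^+ 2 + 2 * complex.Re (ip u v).
Proof.
rewrite -!Re_ip_self ipDl !ipDr (ipC u v); case: (ip u u) => ? ?; case: (ip v v) => ? ?; case: (ip u v) => ? ?.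
by rewrite /=; ring.
Qed.

(** Cauchy-Schwarz. Squaring the triangle inequality bounds the real part; multiplying [u] by the
    conjugate of [ip u v] turns the real part into the squared modulus. *)
Lemma sqmod_ip_le u v : sqmod (ip u v) <= (l2norm u * l2norm v) ^+ 2.
Proof.
have Re_le w : complex.Re (ip w v) <= l2norm w * l2norm v.
  have := l2normD w v; rewrite -(@ler_pXn2r _ 2)// ?nnegrE ?addr_ge0 ?l2norm_ge0//.
  rewrite l2normD_sqr sqrrD; lra.
have [->|ip0] := eqVneq (ip u v) 0; first by rewrite sqmod0 sqr_ge0.
have s0 : 0 < sqmod (ip u v).
  by rewrite lt_neqAle sqmod_ge0 andbT eq_sym; apply: contra_neq ip0; exact: sqmod_eq0.
have := Re_le (conjc (ip u v) *: u); rewrite ipZl l2normZ sqmod_conj.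
have -> : complex.Re (conjc (ip u v) * ip u v) = sqmod (ip u v).
  by case: (ip u v) => a b; rewrite /sqmod /=; ring.
rewrite -{1}(sqr_sqrtr (ltW s0)) expr2 -mulrA ler_pM2l ?sqrtr_gt0// => h.
rewrite -(sqr_sqrtr (ltW s0)) ler_pXn2r ?nnegrE ?sqrtr_ge0 ?mulr_ge0 ?l2norm_ge0//.
Qed.

Section PointMass.
Variable x : T.

Fact point_summable : (fun y => (y == x)%:R : R[i]) \in square_summable.
Proof.
apply: (@summable_le_sum _ _ _ 1) => r ur.
have [xr|xr] := boolP (x \in r).
  rewrite (bigD1_seq x)//= eqxx big1 ?addr0 => [|y /negbTE ->]; last exact: sqmod0.
  by rewrite (sqmod_real 1) expr1n.
rewrite big_seq big1// => y yr; case: eqP => [yx|_]; last exact: sqmod0.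
by rewrite yx (negbTE xr) in yr.
Qed.

Definition delta : H := L2 point_summable.

Lemma deltaE y : delta y = (y == x)%:R. Proof. by []. Qed.

Lemma ip_delta v : ip delta v = conjc (v x).
Proof.
have pt (f : T -> R) : abs_summable f -> (forall y, y != x -> f y = 0) -> rsum f = f x.
  move=> sf f0; rewrite rsumE//.
  have E (g : T -> R) : (forall y, 0 <= g y) -> (forall y, y != x -> g y = 0) ->
      fine (esumR g) = g x.
    move=> g0 gn; rewrite /esumR (esumID [set x])//; last first.
      by move=> y _; rewrite lee_fin.
    rewrite setTI esum_set1 ?lee_fin// esum1 ?adde0// => y [_ /= /eqP yx].
    by rewrite gn.
  rewrite (E (fun y => `|f y| + f y)) => [|y|y /f0 ->]; last 2 first.
  - exact: norm_shift_ge0.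
  - by rewrite normr0 addr0.
  rewrite (E (fun y => `|f y|)) => [|y|y /f0 ->]; last 2 first.
  - exact: normr_ge0.
  - by rewrite normr0.
  by rewrite addrC addKr.
rewrite /ip !pt; [|exact: Im_prod_summable| |exact: Re_prod_summable|].
- by rewrite deltaE eqxx mul1r; case: (v x) => a b.
- by move=> y /negbTE yx; rewrite deltaE yx mul0r.
- by move=> y /negbTE yx; rewrite deltaE yx mul0r.
Qed.

Lemma l2norm_delta : l2norm delta = 1.
Proof.
apply/eqP; rewrite -(eqrXn2 (n := 2))// ?l2norm_ge0// -Re_ip_self ip_delta deltaE eqxx.
by rewrite expr1n conjc1.
Qed.

End PointMass.

End InnerProductTheory.

(** * Weighted shifts and bounded operators *)

Section WeightedShifts.
Context {R : realType} {T : choiceType}.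
Local Notation H := (l2 R T).
Implicit Types (u v : H) (c : T -> T -> R) (s : T -> option T) (M : R).

Definition partial_inj s := forall x x' y, s x = Some y -> s x' = Some y -> x = x'.

Definition weight_bound c s M := forall x y, s x = Some y -> `|c x y| <= M.

(** The map [s] runs backwards, from the coordinate being computed to the coordinate being read; a
    weighted partial permutation then needs no sum. *)
Definition wshift_fun c s (v : T -> R[i]) x : R[i] :=
  if s x is Some y then (c x y)%:C * v y else 0.

Lemma sum_wshift_fun c s v M (r : seq T) : partial_inj s -> weight_bound c s M ->
  uniq r -> \sum_(x <- r) sqmod (wshift_fun c s v x) <= (M * l2norm v) ^+ 2.
Proof.
move=> sI cM ur; rewrite exprMn.
have upm : uniq (pmap s r).
  elim: r ur => //= x r IH /andP[xr /IH {}IH].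
  case E: (s x) => [y|] //=; rewrite IH andbT mem_pmap.
  by apply/mapP => -[x' x'r E']; move: xr; rewrite (sI _ _ _ E (esym E')) x'r.
apply: (@le_trans _ _ (M ^+ 2 * \sum_(y <- pmap s r) sqmod (v y))); last first.
  by rewrite ler_wpM2l ?sqr_ge0// sum_sqmod_le.
elim: r {ur upm} => [|x r IH] /=; first by rewrite !big_nil mulr0.
rewrite big_cons {1}/wshift_fun; case E: (s x) => [y|] /=; last first.
  by rewrite sqmod0 add0r.
rewrite big_cons mulrDr lerD// sqmodM sqmod_real ler_wpM2r ?sqmod_ge0//.
by rewrite -[leLHS]real_normK ?num_real// lerXn2r ?nnegrE// ?(le_trans _ (cM _ _ E))// cM.
Qed.

(** Total by default: the value is 0 when the family is not square summable, so [wshiftE] requires a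
    bound on the weights. *)
Definition wshift c s v : H := insubd (0 : H) (wshift_fun c s v).

Section Bounded.
Variables (c : T -> T -> R) (s : T -> option T) (M : R).
Hypotheses (sI : partial_inj s) (cM : weight_bound c s M).

Lemma wshiftE v x : wshift c s v x = wshift_fun c s v x.
Proof.
rewrite /wshift insubdK//; apply: (@summable_le_sum _ _ _ ((M * l2norm v) ^+ 2)) => r ur.
exact: sum_wshift_fun.
Qed.

Lemma l2norm_wshift v : 0 <= M -> l2norm (wshift c s v) <= M * l2norm v.
Proof.
move=> M0; apply: l2norm_le_sum => [|r ur]; first by rewrite mulr_ge0// l2norm_ge0.
by under eq_bigr do rewrite wshiftE; exact: sum_wshift_fun.
Qed.

(** Both sides are sums over the pairs (x, y) with [s x = Some y], indexed once by x and once by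
    y. *)
Lemma wshift_adjoint s' u v : (forall x y, s x = Some y <-> s' y = Some x) ->
  ip (wshift c s u) v = ip u (wshift (fun y x => c x y) s' v).
Proof.
move=> ss'.
have s'I : partial_inj s' by move=> y y' x /ss' h /ss'; rewrite h => -[].
have c'M : weight_bound (fun y x => c x y) s' M by move=> y x /ss' /cM.
have c'E w y : wshift (fun y x => c x y) s' w y = wshift_fun (fun y x => c x y) s' w y.
  rewrite /wshift insubdK//; apply: (@summable_le_sum _ _ _ ((M * l2norm w) ^+ 2)) => r ur.
  exact: sum_wshift_fun.
rewrite /ip; congr (_ +i* _).
  rewrite [LHS](_ : _ = rsum (fun x => if s x is Some y then
      c x y * complex.Re (u y * conjc (v x)) else 0)).
    rewrite (rsum_reindex_partial ss'); congr rsum; apply/funext => y.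
    rewrite c'E /wshift_fun; case: (s' y) => [x|]; last by rewrite conjc0 mulr0.
    by case: (u y) (v x) => [a1 b1] [a2 b2] /=; ring.
  congr rsum; apply/funext => x; rewrite wshiftE /wshift_fun.
  case: (s x) => [y|]; last by rewrite mul0r.
  by case: (u y) (v x) => [a1 b1] [a2 b2] /=; ring.
rewrite [LHS](_ : _ = rsum (fun x => if s x is Some y then
    c x y * complex.Im (u y * conjc (v x)) else 0)).
  rewrite (rsum_reindex_partial ss'); congr rsum; apply/funext => y.
  rewrite c'E /wshift_fun; case: (s' y) => [x|]; last by rewrite conjc0 mulr0.
  by case: (u y) (v x) => [a1 b1] [a2 b2] /=; ring.
congr rsum; apply/funext => x; rewrite wshiftE /wshift_fun.
case: (s x) => [y|]; last by rewrite mul0r.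
by case: (u y) (v x) => [a1 b1] [a2 b2] /=; ring.
Qed.

Lemma wshift_linear : linear (wshift c s).
Proof.
move=> k u v; apply: l2P => x; rewrite l2_add l2_scale !wshiftE /wshift_fun.
case: (s x) => [y|]; last by rewrite mulr0 addr0.
by rewrite l2_add l2_scale; ring.
Qed.

End Bounded.

End WeightedShifts.

Section BoundedOperators.
Context {R : realType} {T : choiceType}.
Local Notation H := (l2 R T).
Implicit Types (u v : H) (a b : H -> H).

Definition norm_bounded a := exists2 M : R, 0 <= M &
  forall v, l2norm (a v) <= M * l2norm v.

(** Continuity refers to the complex-valued norm; a bound there is a positive complex number, hence
    real. *)
Lemma bounded_opP a : bounded_op a <-> linear a /\ norm_bounded a.
Proof.
split=> -[la ca]; split=> //; pose f : {linear H -> H} :=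
  HB.pack a (GRing.isLinear.Build _ _ _ _ _ la).
- have /linear_boundedP/pinfty_ex_gt0 [r r0 fr] :=
    @continuous_linear_bounded _ _ _ 0 f (ca 0).
  have rE : r = (complex.Re r)%:C by rewrite RRe_real// gtr0_real.
  exists (complex.Re r) => [|v]; first by rewrite -ler0c -rE ltW.
  by have := fr v; rewrite {1}rE ler_l2norm.
- have [M M0 aM] := ca; apply: (@bounded_linear_continuous _ _ _ f).
  apply/bounded_funP => r; exists (M%:C * r) => v vr.
  apply: le_trans (_ : M%:C * `|v| <= _); first by rewrite ler_l2norm.
  by rewrite ler_wpM2l// ler0c.
Qed.

Lemma norm_bounded_comp a b :
  norm_bounded a -> norm_bounded b -> norm_bounded (fun v => a (b v)).
Proof.
move=> [M M0 aM] [N N0 bN]; exists (M * N) => [|v]; first exact: mulr_ge0.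
by apply: le_trans (aM _) _; rewrite -mulrA ler_wpM2l.
Qed.

Lemma norm_bounded_add a b :
  norm_bounded a -> norm_bounded b -> norm_bounded (fun v => a v + b v).
Proof.
move=> [M M0 aM] [N N0 bN]; exists (M + N) => [|v]; first exact: addr_ge0.
by apply: le_trans (l2normD _ _) _; rewrite mulrDl lerD.
Qed.

Lemma norm_bounded_scale (c : R[i]) a :
  norm_bounded a -> norm_bounded (fun v => c *: a v).
Proof.
move=> [M M0 aM]; exists (Num.sqrt (sqmod c) * M) => [|v].
  by rewrite mulr_ge0// sqrtr_ge0.
by rewrite l2normZ -mulrA ler_wpM2l// sqrtr_ge0.
Qed.

Lemma norm_bounded_wshift c s M : partial_inj s -> weight_bound c s M -> 0 <= M ->
  norm_bounded (@wshift R T c s).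
Proof. by move=> sI cM M0; exists M => // v; exact: l2norm_wshift. Qed.

Definition sform a b := forall u v, ip (a u) v = ip u (b v).

(* A vector is recovered from its pairings with the basis, so an operator with
   an adjoint is automatically linear. *)
Lemma adjoint_linear a b : sform a b -> linear b.
Proof.
move=> ab c u v; apply: l2P => x; rewrite -[LHS]conjcK -[RHS]conjcK; congr conjc.
by rewrite -ip_delta -ab ipDr ipZr !ab !ip_delta -rmorphM -rmorphD.
Qed.

(** The squared norm of b v is the pairing of a (b v) with v, at most M times the norms of b v and
    v; divide by the norm of b v. *)
Lemma adjoint_norm_bounded a b : sform a b -> norm_bounded a -> norm_bounded b.
Proof.
move=> ab [M M0 aM]; exists M => // v.
have [->|b0] := eqVneq (l2norm (b v)) 0; first by rewrite mulr_ge0// l2norm_ge0.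
have bpos : 0 < l2norm (b v) by rewrite lt_neqAle eq_sym b0 l2norm_ge0.
rewrite -(ler_pM2r bpos) -expr2 -Re_ip_self -ab.
apply: le_trans (_ : l2norm (a (b v)) * l2norm v <= _).
  apply: le_trans (ler_norm _) _.
  rewrite -(@ler_pXn2r _ 2)// ?nnegrE ?mulr_ge0 ?l2norm_ge0//.
  apply: le_trans (sqmod_ip_le _ _); rewrite real_normK ?num_real//.
  by rewrite /sqmod lerDl sqr_ge0.
by rewrite -mulrA (mulrC (l2norm v)) mulrA ler_wpM2r ?l2norm_ge0.
Qed.

End BoundedOperators.

Section FiniteSupport.
Context {R : realType} {T : choiceType}.
Local Notation H := (l2 R T).
Implicit Types (v : H) (F : set T) (r : seq T).

Fact cutoff_summable F v :
  (fun x => if x \in F then v x else 0) \in square_summable.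
Proof.
apply: (@summable_le_sum _ _ _ (l2norm v ^+ 2)) => r ur.
apply: le_trans (sum_sqmod_le v ur); apply: ler_sum => x _.
by case: ifP => // _; rewrite sqmod0 sqmod_ge0.
Qed.

Definition cutoff F v : H := L2 (cutoff_summable F v).

Lemma cutoffE F v x : cutoff F v x = if x \in F then v x else 0.
Proof. by []. Qed.

Lemma cutoff_id F v : (forall x, ~ F x -> v x = 0) -> cutoff F v = v.
Proof.
move=> vF; apply: l2P => x; rewrite cutoffE; case: ifPn => //.
by rewrite notin_setE => /vF ->.
Qed.

Lemma cutoff_linear F : linear (cutoff F).
Proof.
move=> c u v; apply: l2P => x; rewrite l2_add l2_scale !cutoffE.
by case: ifP; rewrite ?mulr0 ?addr0.
Qed.

Lemma l2norm_cutoff F v : l2norm (cutoff F v) <= l2norm v.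
Proof.
apply: l2norm_le_sum => [|r ur]; first exact: l2norm_ge0.
apply: le_trans (sum_sqmod_le v ur); apply: ler_sum => x _.
by rewrite cutoffE; case: ifP => // _; rewrite sqmod0 sqmod_ge0.
Qed.

Lemma cutoff_sum r v : uniq r ->
  cutoff [set` r] v = \sum_(x <- r) v x *: delta x.
Proof.
move=> ur; apply: l2P => y; rewrite cutoffE l2_sum.
under eq_bigr do rewrite l2_scale deltaE.
have -> : (y \in [set` r]) = (y \in r) by apply/idP/idP; rewrite inE.
have [yr|yr] := boolP (y \in r).
  rewrite (bigD1_seq y)//= eqxx mulr1 big1 ?addr0// => x /negbTE.
  by rewrite eq_sym => ->; rewrite mulr0.
rewrite big_seq big1// => x xr; case: eqP => [yx|_]; last by rewrite mulr0.
by rewrite yx xr in yr.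
Qed.

Lemma l2norm_sum_delta r (c : T -> R[i]) : uniq r ->
  l2norm (\sum_(x <- r) c x *: delta x : H) ^+ 2 = \sum_(x <- r) sqmod (c x).
Proof.
move=> ur; set w : H := \sum_(x <- r) _.
have wx x : x \in r -> w x = c x.
  move=> xr; rewrite /w l2_sum; under eq_bigr do rewrite l2_scale deltaE.
  rewrite (bigD1_seq x)//= eqxx mulr1 big1 ?addr0// => y /negbTE yx.
  by rewrite eq_sym yx mulr0.
rewrite -Re_ip_self {1}/w ip_suml raddf_sum; apply: eq_big_seq => x xr.
rewrite ipZl ip_delta wx//.
by case: (c x) => a b; rewrite /sqmod /=; ring.
Qed.

Lemma tail_small v (e : R) : 0 < e -> exists2 r : seq T, uniq r &
  l2norm (v - cutoff [set` r] v) <= e.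
Proof.
move=> e0; have e2 : 0 < e ^+ 2 by rewrite exprn_gt0.
have [_ [F [finF _] <-]] := ub_ereal_sup_adherent e2 (l2sum_fin v).
pose f : seq T := finmap.enum_fset (fset_set F).
move=> ltF0; have : (sqsum v - (e ^+ 2)%:E < (\sum_(x <- f) sqmod (v x))%:E)%E.
  by rewrite -sumEFin; move: ltF0; rewrite fsbig_finite.
rewrite -l2norm_sq -EFinB lte_fin => ltF.
exists f; first exact: finmap.fset_uniq.
apply: l2norm_le_sum => [|r ur]; first exact: ltW.
have -> : \sum_(x <- r) sqmod ((v - cutoff [set` f] v) x) =
    \sum_(x <- [seq x <- r | x \notin f]) sqmod (v x).
  rewrite big_filter [RHS]big_mkcond; apply: eq_bigr => x _.
  rewrite l2_sub cutoffE.
  have -> : (x \in [set` f]) = (x \in f) by apply/idP/idP; rewrite inE.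
  by case: (x \in f); rewrite ?subrr ?subr0//= sqmod0.
have := @sum_sqmod_le _ _ v ([seq x <- r | x \notin f] ++ f).
rewrite big_cat /= => /(_ _).
have -> : uniq ([seq x <- r | x \notin f] ++ f).
  rewrite cat_uniq filter_uniq// finmap.fset_uniq andbT /=.
  by apply/hasPn => x xf; rewrite /= mem_filter xf.
by move=> /(_ isT) h; lra.
Qed.

End FiniteSupport.

(** * Compactness in l2 *)

Section Topology.
Context {R : realType} {T : choiceType}.
Local Notation H := (l2 R T).
Implicit Types (u v p : H).

Lemma nbhs_l2P p (A : set H) :
  nbhs p A <-> exists2 e : R, 0 < e & forall v, l2norm (p - v) < e -> A v.
Proof.
have np : nbhs p A <-> \near p, A p by [].
rewrite np nbhs_normP; split=> -[e e0 eA].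
  have eE : e = (complex.Re e)%:C by rewrite RRe_real// gtr0_real.
  exists (complex.Re e); first by rewrite -ltcR -eE.
  by move=> v pv; apply: eA; rewrite /= l2normE eE ltcR.
exists e%:C; first by rewrite /= ltcR.
by move=> v; rewrite /= l2normE ltcR; exact: eA.
Qed.

(** A cluster point exists by compactness of the interval [-M, M]; for an ultrafilter it is a
    limit. *)
Lemma ultra_bounded_cvg (F : set_system H) (g : H -> R) (M : R) :
  UltraFilter F -> F [set v | `|g v| <= M] ->
  exists a, forall e : R, 0 < e -> F [set v | `|a - g v| < e].
Proof.
move=> FU FM; have FP : ProperFilter F by exact: ultra_proper.
have : fmap g F `[(- M), M]%classic.
  apply: (@filterS _ F _ _ _ _ FM) => v /=.
  by rewrite in_itv /= ler_norml.
move=> /(segment_compact _) [a [_ ca]]; exists a => e e0.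
have [//|FC] := in_ultra_setVsetC [set v | `|a - g v| < e] FU.
have [b [/= ba eb]] : ([set b | `|a - b| >= e] `&` [set b | `|a - b| < e]) !=set0.
  apply: ca; last by apply/nbhs_normP; exists e.
  by apply: (@filterS _ F _ _ _ _ FC) => v /= /negP; rewrite -leNgt.
by rewrite ltNge ba in eb.
Qed.

Lemma filter_all_seq (F : set_system H) (r : seq T) (P : T -> H -> Prop) : Filter F ->
  (forall x, x \in r -> F (P x)) -> F [set v | forall x, x \in r -> P x v].
Proof.
move=> FF; elim: r => [|x r IH] FP; first by apply: filterE => v y.
have {}IH := IH (fun y yr => FP y (mem_behead (s := x :: r) yr)).
apply: filterS2 (FP x (mem_head _ _)) IH => v Px Pr y.
by rewrite inE => /predU1P[->//|]; exact: Pr.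
Qed.

(** An infinite I would give a sequence whose terms are pairwise e apart, and a ball of radius e / 2
    around a cluster point would contain two of them. *)
Lemma compact_separated_finite (S : set H) (I : set T) (f : T -> H) (e : R) :
  compact S -> 0 < e -> (forall x, I x -> S (f x)) ->
  (forall x y, I x -> I y -> x <> y -> e <= l2norm (f x - f y)) -> finite_set I.
Proof.
move=> cS e0 SI sep; apply: contrapT => /infiniteP/card_leP[h].
pose g n : T := set_val (h (to_setT n)).
have gI n : I (g n) by exact: set_valP.
have ginj m n : g m = g n -> m = n.
  move=> /val_inj E; have : to_setT m = to_setT n by apply: (inj _ _ E); rewrite inE.
  by move=> /(congr1 val).
have [] := cS ((fun n => f (g n)) @ \oo) _ _.
  by exists 0%N => // n _ /=; exact/SI/gI.
move=> p [_ cp]; have e4 : 0 < e / 2 by rewrite divr_gt0.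
have pB : nbhs p [set v | l2norm (p - v) < e / 2] by apply/nbhs_l2P; exists (e / 2).
have tail N : ((fun n => f (g n)) @ \oo) [set f (g n) | n in [set n | (N <= n)%N]].
  by exists N => // n /= Nn; exists n.
have [_ [[m _ <-] pm]] := cp _ _ (tail 0%N) pB.
have [_ [[n mn <-] pn]] := cp _ _ (tail m.+1) pB.
have nm : g m <> g n by move/ginj => nm; rewrite nm /= ltnn in mn.
have := sep _ _ (gI m) (gI n) nm; apply/negP; rewrite -ltNge.
have -> : f (g m) - f (g n) = (f (g m) - p) + (p - f (g n)) by rewrite addrA subrK.
apply: le_lt_trans (l2normD _ _) _.
by rewrite (l2normB (f (g m))) [ltRHS](splitr e) ltrD.
Qed.

End Topology.

Section Multipliers.
Context {R : realType} {T : choiceType}.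
Local Notation H := (l2 R T).
Implicit Types (u v p : H) (k : T -> R[i]).

Definition mult k v : H := insubd (0 : H) (fun x => k x * v x).

Lemma sum_mult k v (M : R) (r : seq T) : (forall x, sqmod (k x) <= M ^+ 2) ->
  uniq r -> \sum_(x <- r) sqmod (k x * v x) <= (M * l2norm v) ^+ 2.
Proof.
move=> kM ur; rewrite exprMn.
apply: le_trans (_ : M ^+ 2 * \sum_(x <- r) sqmod (v x) <= _).
  by rewrite mulr_sumr; apply: ler_sum => x _; rewrite sqmodM ler_wpM2r ?sqmod_ge0.
by rewrite ler_wpM2l ?sqr_ge0// sum_sqmod_le.
Qed.

Section Bounded.
Variables (k : T -> R[i]) (M : R).
Hypothesis kM : forall x, sqmod (k x) <= M ^+ 2.

Lemma mult_coord v x : mult k v x = k x * v x.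
Proof.
rewrite /mult insubdK//; apply: (@summable_le_sum _ _ _ ((M * l2norm v) ^+ 2)) => r ur.
exact: sum_mult.
Qed.

Lemma mult_linear : linear (mult k).
Proof. by move=> c u v; apply: l2P => x; rewrite l2_add l2_scale !mult_coord l2_add l2_scale; ring. Qed.

Lemma l2norm_mult v : 0 <= M -> l2norm (mult k v) <= M * l2norm v.
Proof.
move=> M0; apply: l2norm_le_sum => [|r ur]; first by rewrite mulr_ge0// l2norm_ge0.
by under eq_bigr do rewrite mult_coord; exact: sum_mult.
Qed.

Lemma mult_bounded : 0 <= M -> bounded_op (mult k).
Proof.
move=> M0; apply/bounded_opP; split; first exact: mult_linear.
by exists M => // v; exact: l2norm_mult.
Qed.

Hypothesis k0 : forall x, k x != 0.
Hypothesis kdecay : forall e : R, 0 < e ->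
  exists r : seq T, forall x, x \notin r -> sqmod (k x) <= e ^+ 2.

(* An ultrafilter on the image of the unit ball converges coordinatewise by
   compactness of bounded intervals; the decay of k makes the convergence uniform. *)
Lemma mult_ball_compact : 0 < M -> compact (mult k @` [set v : H | l2norm v <= 1]).
Proof.
move=> M0; rewrite compact_ultra => F FU FB.
have FP : ProperFilter F by exact: ultra_proper.
pose pre v x : R[i] := v x / k x.
have preE w x : pre (mult k w) x = w x by rewrite /pre mult_coord mulrC mulKf.
have Fpre P : (forall w, l2norm w <= 1 -> P (mult k w)) -> F P.
  by move=> HP; apply: (@filterS _ F _ _ _ _ FB) => _ [w w1 <-]; exact: HP.
have w_le (w : H) (x : T) : l2norm w <= 1 -> sqmod (w x) <= 1.
  move=> w1; apply: le_trans (sqmod_le _ _) _.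
  by rewrite -(expr1n _ 2) ler_pXn2r ?nnegrE ?l2norm_ge0.
have lim x : exists a : R[i], forall e : R, 0 < e -> F [set v | sqmod (a - pre v x) <= e].
  have [|a Fa] := @ultra_bounded_cvg _ _ F (fun v => complex.Re (pre v x)) 1 FU.
    apply: Fpre => w /w_le /= /(_ x); rewrite preE /sqmod => w1.
    rewrite -(@ler_pXn2r _ 2)// ?nnegrE// expr1n real_normK ?num_real//.
    by apply: le_trans w1; rewrite lerDl sqr_ge0.
  have [|b Fb] := @ultra_bounded_cvg _ _ F (fun v => complex.Im (pre v x)) 1 FU.
    apply: Fpre => w /w_le /= /(_ x); rewrite preE /sqmod => w1.
    rewrite -(@ler_pXn2r _ 2)// ?nnegrE// expr1n real_normK ?num_real//.
    by apply: le_trans w1; rewrite lerDr sqr_ge0.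
  exists (a +i* b) => e e0; have e2 : 0 < Num.min 1 (e / 2).
    by rewrite lt_min ltr01 divr_gt0.
  apply: (@filterS2 _ F _ _ _ _ _ (Fa _ e2) (Fb _ e2)) => v /=.
  rewrite !lt_min => /andP[a1 a2] /andP[b1 b2].
  case: (pre v x) a1 a2 b1 b2 => c d /= a1 a2 b1 b2; rewrite /sqmod /=.
  rewrite -(real_normK (num_real (a - c))) -(real_normK (num_real (b - d))).
  by have := normr_ge0 (a - c); have := normr_ge0 (b - d); nra.
have [u uP] := boolp.choice lim.
have Fsum (r : seq T) (e : R) : 0 < e ->
    F [set v | \sum_(x <- r) sqmod (u x - pre v x) <= e].
  move=> e0; have e1 : 0 < e / (size r).+1%:R by rewrite divr_gt0.
  have FF : Filter F by exact: filter_filter.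
  have := @filter_all_seq _ _ F r (fun x v => sqmod (u x - pre v x) <= e / (size r).+1%:R)
    FF (fun x _ => uP x _ e1).
  apply: filterS => v vr; rewrite /=.
  apply: le_trans (_ : \sum_(x <- r) e / (size r).+1%:R <= _).
    by rewrite big_seq [leRHS]big_seq; exact: ler_sum.
  rewrite big_const_seq count_predT iter_addr_0 -[leLHS]mulr_natr -mulrA.
  by rewrite ler_piMr ?(ltW e0)// mulrC ler_pdivrMr// mul1r ler_nat.
have Fwit P : F P -> exists2 w, l2norm w <= 1 & P (mult k w).
  move=> FPs; have [v [Pv [w w1 vw]]] := @filter_ex _ F _ _ (filterI FPs FB).
  by exists w => //; rewrite vw.
(* The limit stays in the unit ball: on each finite list [u] is arbitrarily close to some [w] of
   norm at most 1. *)
have u_le (r : seq T) : uniq r -> \sum_(x <- r) sqmod (u x) <= 1.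
  move=> ur; rewrite -(expr1n _ 2) -l2norm_sum_delta//.
  rewrite ler_pXn2r ?nnegrE ?l2norm_ge0//; apply/ler_addgt0Pr => e e0.
  have e2 : 0 < e ^+ 2 by rewrite exprn_gt0.
  have [w w1 /= uw] := Fwit _ (Fsum r _ e2).
  have -> : \sum_(x <- r) u x *: delta x =
      cutoff [set` r] w + \sum_(x <- r) (u x - w x) *: delta x :> H.
    rewrite cutoff_sum// -big_split; apply: eq_bigr => x _.
    by rewrite -[RHS]scalerDl addrC subrK.
  apply: le_trans (l2normD _ _) (lerD (le_trans (l2norm_cutoff _ _) w1) _).
  rewrite -(@ler_pXn2r _ 2)// ?nnegrE ?l2norm_ge0// ?(ltW e0)//.
  rewrite l2norm_sum_delta//; apply: le_trans uw.
  by under [leRHS]eq_bigr do rewrite preE.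
have u2 : u \in square_summable by apply: (@summable_le_sum _ _ _ 1).
pose uL : H := L2 u2.
have uL1 : l2norm uL <= 1.
  by apply: l2norm_le_sum => // r ur; rewrite expr1n; exact: u_le.
exists (mult k uL); split; first by exists uL.
move=> A /nbhs_l2P[e e0 eA].
(* On [r] the squared error is at most M^2 (h / M)^2 = h^2, off [r] at most h^2 2^2; the total 5 h^2
   is below (e / 2)^2 = 9 h^2. *)
pose h := e / 6; have h0 : 0 < h by rewrite divr_gt0.
have [r0 r0P] := kdecay h0; pose r := undup r0.
have rP x : x \notin r -> sqmod (k x) <= h ^+ 2 by rewrite mem_undup; exact: r0P.
have hM : 0 < (h / M) ^+ 2 by rewrite exprn_gt0// divr_gt0.
have Fr := Fsum r _ hM.
apply: (@filterS _ F _ _ _ _ (filterI Fr FB)) => v [/= vr [w w1 vw]].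
apply: eA; apply: le_lt_trans (_ : e / 2 < e); last by rewrite ltr_pdivrMr ?ltr_pMr ?ltr1n.
have zE : mult k uL - v = mult k (uL - w).
  by rewrite -vw; apply: l2P => x; rewrite l2_sub !mult_coord l2_sub mulrBr.
have z2 : l2norm (uL - w) <= 2.
  by apply: le_trans (l2normD _ _) _; rewrite l2normN -[leRHS]/(1 + 1) lerD.
have zr : l2norm (cutoff [set` r] (uL - w)) ^+ 2 <= (h / M) ^+ 2.
  rewrite cutoff_sum ?undup_uniq// l2norm_sum_delta ?undup_uniq//.
  apply: le_trans vr; rewrite -vw.
  by under [leRHS]eq_bigr do rewrite preE.
rewrite zE; set z := uL - w in z2 zr *.
apply: l2norm_le_sum => [|t ut]; first by rewrite divr_ge0// ltW.
apply: le_trans (_ : \sum_(x <- t) (M ^+ 2 * sqmod (cutoff [set` r] z x) +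
                                   h ^+ 2 * sqmod (z x)) <= _).
  apply: ler_sum => x _; rewrite mult_coord sqmodM cutoffE.
  have -> : (x \in [set` r]) = (x \in r) by apply/idP/idP; rewrite inE.
  have z0 := sqmod_ge0 (z x); case: ifPn => [_|/rP kx].
    by rewrite -[leLHS]addr0 lerD ?ler_wpM2r// mulr_ge0// sqr_ge0.
  by rewrite sqmod0 mulr0 add0r ler_wpM2r.
have zr' := le_trans (sum_sqmod_le (cutoff [set` r] z) ut) zr.
have z2' : \sum_(x <- t) sqmod (z x) <= 2 ^+ 2.
  apply: le_trans (sum_sqmod_le z ut) _.
  by rewrite ler_pXn2r ?nnegrE ?l2norm_ge0.
rewrite big_split -!mulr_sumr.
apply: le_trans (lerD (ler_wpM2l (sqr_ge0 M) zr') (ler_wpM2l (sqr_ge0 h) z2')) _.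
rewrite -exprMn mulrCA divff ?gt_eqF// mulr1 /h; have := sqr_ge0 e; lra.
Qed.

Lemma mult_compact : 0 < M -> compact_op (mult k).
Proof.
move=> M0; split; first by apply: mult_bounded; exact: ltW.
have -> : [set v : H | `|v| <= 1] = [set v | l2norm v <= 1].
  by apply/funext => v /=; rewrite ler_l2norm1.
have cB := mult_ball_compact M0.
have clB := compact_closed (@norm_hausdorff _ _) cB.
by rewrite -((closure_id _).1 clB).
Qed.

End Bounded.

End Multipliers.

Lemma conjcM {R : realType} (c c' : R[i]) : conjc (c * c') = conjc c * conjc c'.
Proof. exact: rmorphM. Qed.

(** * Diagonal operators *)

Section DiagonalOperators.
Context {R : realType} {T : choiceType}.
Local Notation H := (l2 R T).
Implicit Types (u v w : H) (x y : T).
Variable ev : T -> R.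

Definition mdiag : set (H * H) :=
  [set vw : H * H | forall x, vw.2 x = (ev x)%:C * vw.1 x].

Lemma mdiagP u w : mdiag (u, w) <-> forall x, w x = (ev x)%:C * u x.
Proof. by []. Qed.

Lemma mdiag_delta x : mdiag (delta x, (ev x)%:C *: delta x).
Proof. by move=> y; rewrite l2_scale deltaE; case: eqP => [->//|_]; rewrite !mulr0. Qed.

(** Truncations of a vector lie in the domain, which is therefore dense. An element of the adjoint,
    tested against the basis vectors, satisfies the defining equation coordinate by coordinate. *)
Lemma mdiag_self_adjoint : self_adjoint mdiag.
Proof.
split.
  move=> O [v Ov] oO; have /nbhs_l2P[e e0 eO] : nbhs v O by apply: open_nbhs_nbhs.
  have e2 : 0 < e / 2 by rewrite divr_gt0.
  have [r ur vr] := tail_small v e2.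
  exists (cutoff [set` r] v); split.
    by apply: eO; apply: le_lt_trans vr _; rewrite ltr_pdivrMr// ltr_pMr// ltr1n.
  exists (\sum_(x <- r) ((ev x)%:C * v x) *: delta x) => x.
  rewrite (cutoff_sum _ ur) /= !l2_sum mulr_sumr; apply: eq_bigr => y _.
  rewrite !l2_scale deltaE; case: eqP => [->|_]; last by rewrite !mulr0.
  by rewrite !mulr1.
apply/seteqP; split=> -[u w] /= Duw.
  move=> x; rewrite /=.
  have := Duw _ _ (mdiag_delta x); rewrite /= ipZl !ip_delta => /(congr1 conjc).
  by rewrite conjcM conjc_real !conjcK => ->.
move=> v Dv /= vP; apply: ip_eq => x; rewrite (Duw x) (vP x) conjcM conjc_real.
by rewrite -mulrA mulrCA mulrA.
Qed.

Lemma mdiag_compact_resolvent :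
  (forall N : R, exists r : seq T, forall x, x \notin r -> N < `|ev x|) ->
  compact_resolvent mdiag.
Proof.
move=> evoo z z0.
pose k x : R[i] := ((ev x)%:C - z)^-1.
have dnz x : (ev x)%:C - z != 0.
  apply/eqP => /(congr1 (@complex.Im R)) /eqP.
  by case: z z0 {k} => a b /= b0; rewrite sub0r oppr_eq0 (negbTE b0).
have k0 x : k x != 0 by rewrite invr_eq0.
have sqV (c : R[i]) : c != 0 -> sqmod c^-1 = (sqmod c)^-1.
  move=> c0; have sc : sqmod c != 0 by apply: contra_neq c0; exact: sqmod_eq0.
  by apply: (mulfI sc); rewrite -sqmodM !divff// (sqmod_real 1) expr1n.
have sqk x : sqmod (k x) = ((ev x - complex.Re z) ^+ 2 + complex.Im z ^+ 2)^-1.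
  by rewrite sqV//; case: z {z0 k k0 dnz} => a b; rewrite /sqmod /= sub0r sqrrN.
have I0 : 0 < `|complex.Im z| by rewrite normr_gt0.
(* The eigenvalues are real, so |ev x - z| >= |Im z|. *)
pose M := `|complex.Im z|^-1.
have kM x : sqmod (k x) <= M ^+ 2.
  rewrite sqk exprVn lef_pV2 ?posrE ?exprn_gt0//.
    by rewrite real_normK ?num_real// lerDr sqr_ge0.
  by rewrite ltr_wpDl ?sqr_ge0// lt_neqAle sqr_ge0 eq_sym sqrf_eq0 z0.
have kdecay (e : R) : 0 < e -> exists r : seq T, forall x, x \notin r -> sqmod (k x) <= e ^+ 2.
  move=> e0; have [r rP] := evoo (`|complex.Re z| + e^-1); exists r => x /rP xN.
  have d0 : e^-1 < `|ev x - complex.Re z|.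
    have := ler_normD (ev x - complex.Re z) (complex.Re z).
    by rewrite subrK; lra.
  have ei : 0 < e^-1 by rewrite invr_gt0.
  rewrite sqk -[leRHS]invrK lef_pV2 ?posrE ?invr_gt0 ?exprn_gt0//; last first.
    by rewrite ltr_wpDl ?sqr_ge0// lt_neqAle sqr_ge0 eq_sym sqrf_eq0 z0.
  rewrite -exprVn -[X in _ <= X + _]real_normK ?num_real//.
  rewrite ler_wpDr ?sqr_ge0// lerXn2r ?nnegrE ?(ltW ei)//.
  exact: ltW.
have M0 : 0 < M by rewrite invr_gt0.
exists (mult k); first exact: (mult_compact kM).
move=> u v; split=> [<-|/mdiagP Duv].
  apply/mdiagP => x; rewrite l2_add l2_scale (mult_coord kM) -{1}(mulVKf (dnz x) (u x)) -/(k x).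
  by ring.
apply: l2P => x; rewrite (mult_coord kM); have := Duv x.
rewrite l2_add l2_scale => E; apply: (mulfI (dnz x)).
by rewrite mulrA /k divff// mul1r mulrBl -E addrK.
Qed.

(** The resolvent at z = i is forced to be (ev x - i)^-1 on basis vectors. Where |ev x| <= N this
    has modulus at least (N^2 + 1)^(-1/2), so the images of these basis vectors are uniformly
    separated inside a compact set. *)
Lemma compact_resolvent_finite (N : R) :
  compact_resolvent mdiag -> finite_set [set x | `|ev x| <= N].
Proof.
have i0 : complex.Im ('i : R[i]) != 0 by rewrite /= oner_eq0.
move=> /(_ _ i0) [K [[linK contK] cK] KP].
pose c x : R[i] := ((ev x)%:C - 'i)^-1.
have dnz x : (ev x)%:C - 'i != 0 :> R[i].
  by apply/eqP => /(congr1 (@complex.Im R)) /eqP; rewrite /= sub0r oppr_eq0 oner_eq0.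
have Kd x : K (delta x) = c x *: delta x.
  apply/KP/mdiagP => y; rewrite l2_add !l2_scale deltaE; case: eqP => [->|_].
    by rewrite !mulr1 -(mulfV (dnz x)) -/(c x) mulrBl subrK.
  by rewrite !mulr0 addr0.
have [N0|N0] := ltP N 0.
  rewrite (_ : [set x | _] = set0); first exact: finite_set0.
  by apply/seteqP; split=> x //=; have := normr_ge0 (ev x); lra.
pose e := Num.sqrt ((N ^+ 2 + 1)^-1).
have e2 : e ^+ 2 = (N ^+ 2 + 1)^-1.
  by rewrite sqr_sqrtr// invr_ge0 addr_ge0// sqr_ge0.
have e0 : 0 < e by rewrite sqrtr_gt0 invr_gt0 ltr_wpDl// sqr_ge0.
apply: (@compact_separated_finite _ _ _ _ (fun x => K (delta x)) e cK e0).
  move=> x _; apply: subset_closure; exists (delta x) => //=.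
  by rewrite ler_l2norm1 l2norm_delta.
move=> x y xN yN xy; rewrite !Kd.
rewrite -(@ler_pXn2r _ 2)// ?nnegrE ?l2norm_ge0 ?(ltW e0)//.
apply: le_trans (sqmod_le _ x).
rewrite l2_sub !l2_scale !deltaE eqxx.
have -> : (x == y) = false by apply/eqP.
rewrite mulr1 mulr0 subr0 e2.
have sc : sqmod ((ev x)%:C - 'i) = ev x ^+ 2 + 1.
  by rewrite /sqmod /= sub0r sqrrN expr1n subr0.
have -> : sqmod (c x) = (ev x ^+ 2 + 1)^-1.
  rewrite -sc; have s0 : sqmod ((ev x)%:C - 'i) != 0.
    by apply: contra_neq (dnz x); exact: sqmod_eq0.
  by apply: (mulfI s0); rewrite -sqmodM !divff// (sqmod_real 1) expr1n.
rewrite lef_pV2 ?posrE ?ltr_wpDl ?sqr_ge0// lerD2r.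
rewrite -(real_normK (num_real (ev x))) -(real_normK (num_real N)).
by rewrite lerXn2r ?nnegrE// (ger0_norm N0).
Qed.

Lemma mdiag_eigen (l : R) v : mdiag (v, l%:C *: v) -> forall x, ev x != l -> v x = 0.
Proof.
move=> /mdiagP Dv x evl; have := Dv x; rewrite l2_scale => /eqP.
have [//|vx] := eqVneq (v x) 0.
rewrite (inj_eq (mulIf vx)) (inj_eq (@complexI R)) eq_sym.
by rewrite (negbTE evl).
Qed.

Definition negset : set T := [set x | ev x < 0].

Definition signop v : H := v - 2 *: cutoff negset v.

Lemma signopE v x : signop v x = if ev x < 0 then - v x else v x.
Proof.
rewrite l2_sub l2_scale cutoffE /negset.
have -> : (x \in [set x | ev x < 0]) = (ev x < 0) by apply/idP/idP; rewrite inE.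
by case: ifP => _; ring.
Qed.

Lemma signop_is_sign : is_sign mdiag signop.
Proof.
split; last first.
  move=> l v Dv; have v0 := mdiag_eigen Dv; apply: l2P => x; rewrite signopE.
  have [<-|evl] := eqVneq (ev x) l; first by case: ifP.
  by case: ifP; case: ifP; rewrite ?l2_opp v0// oppr0.
apply/bounded_opP; split.
  move=> c u v; apply: l2P => x; rewrite [RHS]l2_add (l2_scale c (signop u)) !signopE.
  rewrite l2_add l2_scale.
  by case: ifP => // _; ring.
exists 1 => // v; rewrite mul1r; apply: l2norm_le_sum => [|r ur].
  exact: l2norm_ge0.
apply: le_trans (sum_sqmod_le v ur); apply: ler_sum => x _; rewrite signopE.
by case: ifP; rewrite ?sqmodN.
Qed.

(** [is_sign] prescribes F only on eigenvectors. Linearity extends this to finite combinations of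
    basis vectors, boundedness to their limits. *)
Lemma is_sign_coord F v x : is_sign mdiag F -> F v x = signop v x.
Proof.
move=> [/bounded_opP[linF [M M0 FM]] Fev].
pose f : {linear H -> H} := HB.pack F (GRing.isLinear.Build _ _ _ _ _ linF).
have Fd y : F (delta y) = signop (delta y).
  rewrite (Fev (ev y)); last exact: mdiag_delta.
  apply: l2P => z; rewrite signopE; case: ifP => evy.
    by rewrite l2_opp deltaE; case: eqP => [->|_]; rewrite ?evy ?oppr0 ?if_same.
  by rewrite deltaE; case: eqP => [->|_]; rewrite ?evy ?oppr0 ?if_same.
have Fs (r : seq T) (c : T -> R[i]) :
    F (\sum_(y <- r) c y *: delta y) x = signop (\sum_(y <- r) c y *: delta y) x.
  rewrite -[F]/(f : H -> H) linear_sum l2_sum signopE l2_sum.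
  transitivity (\sum_(y <- r) if ev x < 0 then - (c y *: delta y : H) x
                              else (c y *: delta y : H) x); last first.
    by case: ifP => // _; rewrite sumrN.
  apply: eq_bigr => y _; rewrite linearZ [LHS]l2_scale -[f (delta y)]/(F (delta y)) Fd.
  by rewrite signopE !l2_scale; case: ifP => // _; rewrite mulrN.
have dif (r : seq T) : uniq r ->
    F v x - signop v x = F (v - cutoff [set` r] v) x - signop (v - cutoff [set` r] v) x.
  move=> ur; have FB : F (v - cutoff [set` r] v) = F v - F (cutoff [set` r] v).
    by rewrite -[F]/(f : H -> H) linearB.
  rewrite FB l2_sub; have -> : F (cutoff [set` r] v) x = signop (cutoff [set` r] v) x.
    by rewrite (cutoff_sum _ ur) Fs.
  by rewrite !signopE; case: ifP => _; rewrite l2_sub; ring.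
apply/eqP; rewrite -subr_eq0; apply/eqP/sqmod_eq0/eqP.
rewrite eq_le sqmod_ge0 andbT; apply/ler_addgt0Pr => e e0; rewrite add0r.
(* The squared modulus of a difference is at most twice the sum of the squared moduli, here M^2 and
   1 times the squared norm of the tail. *)
pose C := 2 * (M ^+ 2 + 1).
have C0 : 0 < C by rewrite mulr_gt0// ltr_wpDl// sqr_ge0.
have h0 : 0 < Num.sqrt (e / C) by rewrite sqrtr_gt0 divr_gt0.
have [r ur vr] := tail_small v h0.
have wr : l2norm (v - cutoff [set` r] v) ^+ 2 <= e / C.
  rewrite -(@sqr_sqrtr _ (e / C)) ?divr_ge0 ?(ltW e0) ?(ltW C0)//.
  by rewrite lerXn2r ?nnegrE ?l2norm_ge0 ?sqrtr_ge0.
rewrite (dif r ur); set w := v - _ in wr *.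
apply: le_trans (sqmodD_le _ _ ltr01) _; rewrite invr1 sqmodN.
have Fw : sqmod (F w x) <= M ^+ 2 * l2norm w ^+ 2.
  apply: le_trans (sqmod_le _ _) _; rewrite -exprMn.
  by rewrite lerXn2r ?nnegrE ?mulr_ge0 ?l2norm_ge0.
have Sw : sqmod (signop w x) <= l2norm w ^+ 2.
  by rewrite signopE; apply: le_trans (sqmod_le _ x); case: ifP; rewrite ?sqmodN.
have wC : l2norm w ^+ 2 * C <= e by rewrite -ler_pdivlMr.
rewrite /C in wC; have := sqr_ge0 (l2norm w); nra.
Qed.

End DiagonalOperators.

(** * The generators in integer coordinates *)

Section Coordinates.

(* a = n - i, b = n + i and t = n + j are natural numbers with t <= a + b = 2n. *)
Definition ca (x : label) : nat := (sval x).1.1 - (sval x).1.2.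
Definition cb (x : label) : nat := (sval x).1.2.
Definition ct (x : label) : nat := (sval x).2.

Definition lab (a b t : nat) : option label := insub ((a + b)%N, b, t).

Lemma cab x : (ca x + cb x = (sval x).1.1)%N.
Proof. by rewrite /ca /cb subnK//; case/andP: (valP x). Qed.

Lemma ct_le x : (ct x <= ca x + cb x)%N.
Proof. by rewrite cab; case/andP: (valP x). Qed.

Lemma labP a b t x : lab a b t = Some x <-> [/\ ca x = a, cb x = b & ct x = t].
Proof.
rewrite /lab; split.
  case: insubP => // y _ yE [<-]; rewrite /ca /cb /ct.
  by rewrite -[sval y]/(val y) yE /= addnK.
move=> [<- <- <-]; rewrite cab; case: x => [[[m s] t'] xP] /=.
by rewrite insubT.
Qed.

Lemma lab_coords x : lab (ca x) (cb x) (ct x) = Some x.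
Proof. exact/labP. Qed.

Lemma lab_ex a b t : (t <= a + b)%N -> exists x, lab a b t = Some x.
Proof.
move=> tab; rewrite /lab; case: insubP => [x _ _|]; first by exists x.
by rewrite /= leq_addl tab.
Qed.

Lemma lab_out a b t : (a + b < t)%N -> lab a b t = None.
Proof.
move=> tab; rewrite /lab; case: insubP => // x /= /andP[_].
by rewrite leqNgt tab.
Qed.

Lemma coords_inj x y : ca x = ca y -> cb x = cb y -> ct x = ct y -> x = y.
Proof. by move=> aE bE tE; have := lab_coords x; rewrite aE bE tE lab_coords => -[]. Qed.

Lemma option_ext (U : Type) (o o' : option U) :
  (forall y, o = Some y <-> o' = Some y) -> o = o'.
Proof.
case: o => [y|] oE; first exact/esym/oE.
by case: o' oE => // y oE; exact/oE.
Qed.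

(* lmove sends the target of a weighted shift to its source. *)
Definition lmove (pa pb pt na nb nt : nat) (x : label) : option label :=
  if [&& pa <= ca x + na, pb <= cb x + nb & pt <= ct x + nt]%N
  then lab (ca x + na - pa) (cb x + nb - pb) (ct x + nt - pt) else None.

Lemma lmoveP pa pb pt na nb nt x y : lmove pa pb pt na nb nt x = Some y <->
  [/\ (ca y + pa = ca x + na)%N, (cb y + pb = cb x + nb)%N & (ct y + pt = ct x + nt)%N].
Proof.
rewrite /lmove; split.
  by case: and3P => // -[h1 h2 h3] /labP[-> -> ->]; rewrite !subnK.
move=> [<- <- <-]; rewrite !addnK !leq_addl /=.
exact: lab_coords.
Qed.

Lemma lmove_sym pa pb pt na nb nt x y :
  lmove pa pb pt na nb nt x = Some y <-> lmove na nb nt pa pb pt y = Some x.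
Proof. by rewrite !lmoveP; split=> -[-> -> ->]. Qed.

Lemma lmove_inj pa pb pt na nb nt : partial_inj (lmove pa pb pt na nb nt).
Proof.
move=> x x' y /lmoveP[h1 h2 h3] /lmoveP[h1' h2' h3'].
by apply: coords_inj; lia.
Qed.

Section Evaluation.
Context {R : realType}.
Local Notation H := (l2 R label).
Implicit Types (v : H).

(** Extended by 0 to triples with t > a + b, so that coordinate formulas may refer to neighbours
    outside the index set. *)
Definition crd v a b t : R[i] := if lab a b t is Some x then v x else 0.

Lemma crd_coords v x : crd v (ca x) (cb x) (ct x) = v x.
Proof. by rewrite /crd lab_coords. Qed.

Lemma crd_out v a b t : (a + b < t)%N -> crd v a b t = 0.
Proof. by move=> tab; rewrite /crd lab_out. Qed.

Lemma crdD u v a b t : crd (u + v) a b t = crd u a b t + crd v a b t.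
Proof. by rewrite /crd; case: lab => [x|]; rewrite ?addr0. Qed.

Lemma crdZ c v a b t : crd (c *: v) a b t = c * crd v a b t.
Proof. by rewrite /crd; case: lab => [x|]; rewrite ?mulr0. Qed.

Lemma crd_ext u v :
  (forall a b t, (t <= a + b)%N -> crd u a b t = crd v a b t) -> u = v.
Proof. by move=> E; apply: l2P => x; rewrite -!crd_coords E// ct_le. Qed.

(** Weights of the generators are evaluated at the source; those of the adjoints, in
    [crd_lmove_tgt], at the target. *)
Lemma crd_lmove_src (c : nat -> nat -> nat -> R) (M : R) pa pb pt na nb nt v a b t :
  (forall y, `|c (ca y) (cb y) (ct y)| <= M) -> (t <= a + b)%N ->
  crd (wshift (fun _ y => c (ca y) (cb y) (ct y)) (lmove pa pb pt na nb nt) v) a b t =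
  if [&& pa <= a + na, pb <= b + nb & pt <= t + nt]%N
  then (c (a + na - pa)%N (b + nb - pb)%N (t + nt - pt)%N)%:C *
       crd v (a + na - pa)%N (b + nb - pb)%N (t + nt - pt)%N else 0.
Proof.
move=> cM /lab_ex[x xE]; rewrite /crd xE.
rewrite (wshiftE (@lmove_inj _ _ _ _ _ _) (M := M)); last by move=> ? ? _.
rewrite /wshift_fun /lmove; move/labP: xE => [-> -> ->]; case: ifP => // _.
case E: lab => [y|]; last by rewrite mulr0.
by move/labP: E => [-> -> ->].
Qed.

Lemma crd_lmove_tgt (c : nat -> nat -> nat -> R) (M : R) pa pb pt na nb nt v a b t :
  (forall y, `|c (ca y) (cb y) (ct y)| <= M) -> (t <= a + b)%N ->
  crd (wshift (fun x _ => c (ca x) (cb x) (ct x)) (lmove pa pb pt na nb nt) v) a b t =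
  if [&& pa <= a + na, pb <= b + nb & pt <= t + nt]%N
  then (c a b t)%:C *
       crd v (a + na - pa)%N (b + nb - pb)%N (t + nt - pt)%N else 0.
Proof.
move=> cM /lab_ex[x xE]; rewrite /crd xE.
rewrite (wshiftE (@lmove_inj _ _ _ _ _ _) (M := M)); last by move=> ? ? _.
rewrite /wshift_fun /lmove; move/labP: xE => [-> -> ->]; case: ifP => // _.
by case E: lab => [y|]; last by rewrite mulr0.
Qed.

Lemma n_ofE x : n_of x = (ca x + cb x)%:R / 2 :> R.
Proof. by rewrite cab. Qed.

Lemma i_ofE x : i_of x = (cb x)%:R - (ca x + cb x)%:R / 2 :> R.
Proof. by rewrite /i_of n_ofE. Qed.

End Evaluation.
End Coordinates.

Section Coefficients.
Context {R : realType}.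
Variables (q : R) (hq : 0 < q < 1).
Implicit Types (M t b : nat).

(* K^2 + L^2 = 1, and each of a_+, a_-, b_+, b_- is, up to sign, a product of two
   of these factors, one depending on t and one on b. *)
Definition Kc M t : R := q ^+ t * Num.sqrt ((1 - q ^+ (2 * (M - t))) / (1 - q ^+ (2 * M))).
Definition Lc M t : R := Num.sqrt ((1 - q ^+ (2 * t)) / (1 - q ^+ (2 * M))).

Lemma q_ge0 : 0 <= q. Proof. by case/andP: hq => /ltW. Qed.

Lemma subX_ge0 M : 0 <= 1 - q ^+ M.
Proof. by rewrite subr_ge0 exprn_ile1 ?q_ge0//; case/andP: hq => _ /ltW. Qed.

Lemma subX_gt0 M : (0 < M)%N -> 0 < 1 - q ^+ M.
Proof. by move=> M0; rewrite subr_gt0 exprn_ilt1 ?q_ge0 -?lt0n//; case/andP: hq. Qed.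

Lemma ratio_ge0 M t : 0 <= (1 - q ^+ t) / (1 - q ^+ M).
Proof. by rewrite divr_ge0// subX_ge0. Qed.

Lemma Kc_ge0 M t : 0 <= Kc M t.
Proof. by rewrite mulr_ge0 ?exprn_ge0 ?q_ge0 ?sqrtr_ge0. Qed.

Lemma Lc_ge0 M t : 0 <= Lc M t.
Proof. exact: sqrtr_ge0. Qed.

Lemma Lc0 M : Lc M 0 = 0.
Proof. by rewrite /Lc muln0 expr0 subrr mul0r sqrtr0. Qed.

Lemma Kcn M : Kc M M = 0.
Proof. by rewrite /Kc subnn muln0 expr0 subrr mul0r sqrtr0 mulr0. Qed.

Lemma KLsqr M t : (t <= M)%N -> (0 < M)%N -> Kc M t ^+ 2 + Lc M t ^+ 2 = 1.
Proof.
move=> tM M0; have d0 : 1 - q ^+ (2 * M) != 0 by rewrite gt_eqF// subX_gt0// muln_gt0.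
rewrite /Kc /Lc exprMn !sqr_sqrtr ?ratio_ge0// -exprM mulnC mulrA mulrBr mulr1 -exprD.
by rewrite -mulnDr subnKC// -mulrDl addrC addrA subrK divff.
Qed.

Lemma Kc_le1 M t : (t <= M)%N -> Kc M t <= 1.
Proof.
move=> tM; have [M0|M0] := posnP M.
  by move: tM; rewrite M0 leqn0 => /eqP ->; rewrite Kcn ler01.
rewrite -(@ler_pXn2r _ 2)// ?nnegrE ?Kc_ge0// expr1n -(KLsqr tM M0).
by rewrite lerDl sqr_ge0.
Qed.

Lemma Lc_le1 M t : (t <= M)%N -> Lc M t <= 1.
Proof.
move=> tM; have [M0|M0] := posnP M.
  by move: tM; rewrite M0 leqn0 => /eqP ->; rewrite Lc0 ler01.
rewrite -(@ler_pXn2r _ 2)// ?nnegrE ?Lc_ge0// expr1n -(KLsqr tM M0).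
by rewrite lerDr sqr_ge0.
Qed.

(** This and the next two identities exchange the levels M and M + 1 between the factor in t and the
    factor in b. Applied to the rows of the fundamental unitary they pull out the factor in b and
    leave Clebsch-Gordan combinations in t. *)
Lemma KLqshift M t b : q * Kc M t * Lc M.+1 b = Lc M b * Kc M.+1 t.+1.
Proof.
rewrite /Kc /Lc exprS subSS; set A := 1 - q ^+ (2 * (M - t)).
have ge0 k : 0 <= 1 - q ^+ k := subX_ge0 k.
rewrite !sqrtrM ?ge0//; set s := Num.sqrt A; set u := Num.sqrt (_ - _).
by ring.
Qed.

Lemma LLsym M t b : Lc M t * Lc M.+1 b = Lc M b * Lc M.+1 t.
Proof.
have ge0 k : 0 <= 1 - q ^+ k := subX_ge0 k.
by rewrite /Lc !sqrtrM ?ge0//; ring.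
Qed.

Lemma KKsym M t b : Kc M t * Kc M.+1 b.+1 = Kc M b * Kc M.+1 t.+1.
Proof.
have ge0 k : 0 <= 1 - q ^+ k := subX_ge0 k.
by rewrite /Kc !exprS !subSS !sqrtrM ?ge0//; ring.
Qed.

Lemma Lc_gt0 M t : (0 < t)%N -> (0 < M)%N -> 0 < Lc M t.
Proof. by move=> t0 M0; rewrite sqrtr_gt0 divr_gt0// subX_gt0// muln_gt0. Qed.

Lemma Kc_gt0 M t : (t < M)%N -> 0 < Kc M t.
Proof.
move=> tM; have M0 := leq_ltn_trans (leq0n t) tM.
have q0 : 0 < q by case/andP: hq.
by rewrite mulr_gt0 ?exprn_gt0// sqrtr_gt0 divr_gt0// subX_gt0// muln_gt0// subn_gt0.
Qed.

(** (1 - q)^2 <= 1 - q <= 1 - q^(2t), and the denominator is at most 1. Being uniform in M and t,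
    the bound serves both to extract growth conditions and to invert blocks. *)
Lemma Lc_lbound M t : (0 < t)%N -> (t <= M)%N -> 1 - q <= Lc M t.
Proof.
move=> t0 tM; have M0 := leq_trans t0 tM.
have q1 : q <= 1 by case/andP: hq => _ /ltW.
have h : 1 - q <= 1 - q ^+ (2 * t).
  rewrite lerD2l lerN2 -[leRHS]expr1 ler_wiXn2l ?q_ge0//.
  by rewrite muln_gt0.
have s0 : 0 <= 1 - q by rewrite subr_ge0.
rewrite -(@ler_pXn2r _ 2)// ?nnegrE ?Lc_ge0// sqr_sqrtr ?ratio_ge0//.
rewrite ler_pdivlMr ?subX_gt0 ?muln_gt0//.
apply: le_trans h; apply: le_trans (_ : (1 - q) * 1 <= _); last by rewrite mulr1.
rewrite expr2 -mulrA ler_wpM2l// mulr_ile1 ?subX_ge0 ?lerBlDl ?lerDr ?exprn_ge0 ?q_ge0//.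
Qed.

Lemma sqrt_coef (p A B C D : R) : 0 <= p -> 0 <= A -> 0 <= B -> 
  Num.sqrt (p ^+ 2 * (A * C / (B * D))) = p * (Num.sqrt (A / B) * Num.sqrt (C / D)).
Proof.
move=> p0 A0 B0; rewrite sqrtrM ?sqr_ge0// sqrtr_sqr ger0_norm//.
by rewrite invfM mulrACA sqrtrM// divr_ge0.
Qed.

Definition cap (a b t : nat) : R := Kc (a + b).+1 t * Kc (a + b).+2 b.+1.
Definition cam (a b t : nat) : R := Lc (a + b).+1 t * Lc (a + b) b.
Definition cbp (a b t : nat) : R := - (Kc (a + b).+1 t * Lc (a + b).+2 b.+1).
Definition cbm (a b t : nat) : R := Lc (a + b).+1 t * Kc (a + b) b.

Section CoefficientsAt.
Variable x : label.
Let a := ca x.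
Let b := cb x.
Let t := ct x.
Let n : R := n_of x.
Let i : R := i_of x.
Let j : R := j_of x.

Lemma powR_nat (r : R) (k : nat) : r = k%:R -> q `^ r = q ^+ k.
Proof. by move=> ->; rewrite powR_mulrn ?q_ge0. Qed.

Let niE : n + i = b%:R. Proof. by rewrite /n /i /i_of addrC subrK. Qed.
Let njE : n + j = t%:R. Proof. by rewrite /n /j /j_of addrC subrK. Qed.
Let nE : 2 * n = (a + b)%:R. Proof. by rewrite /n n_ofE mulrC divfK ?pnatr_eq0. Qed.
Let tle : (t <= a + b)%N. Proof. exact: ct_le. Qed.

Lemma a_plusE : a_plus q n i j = cap a b t.
Proof.
rewrite /a_plus /cap /Kc mulrACA -exprD.
rewrite -sqrt_coef ?exprn_ge0 ?q_ge0 ?subX_ge0// -exprM.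
congr (Num.sqrt (_ * (_ * _ / (_ * _)))).
- apply: powR_nat; rewrite niE njE !natrM natrD -[b.+1%:R]natr1; ring.
- congr (1 - _); apply: powR_nat.
  rewrite natrM natrB; last lia.
  by rewrite -[(a + b).+1%:R]natr1 -nE -njE; ring.
- congr (1 - _); apply: powR_nat.
  rewrite natrM natrB; last lia.
  rewrite -[(a + b).+2%:R]natr1 -[(a + b).+1%:R]natr1 -[b.+1%:R]natr1 -nE -niE; ring.
- congr (1 - _); apply: powR_nat.
  by rewrite natrM -[(a + b).+1%:R]natr1 -nE; ring.
- congr (1 - _); apply: powR_nat.
  by rewrite natrM -[(a + b).+2%:R]natr1 -[(a + b).+1%:R]natr1 -nE; ring.
Qed.

Lemma b_plusE : b_plus q n i j = cbp a b t.
Proof.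
rewrite /b_plus /cbp /Kc /Lc; congr (- _); rewrite -[RHS]mulrA.
rewrite -sqrt_coef ?exprn_ge0 ?q_ge0 ?subX_ge0// -exprM.
congr (Num.sqrt (_ * (_ * _ / (_ * _)))).
- by apply: powR_nat; rewrite njE !natrM mulrC.
- congr (1 - _); apply: powR_nat.
  rewrite natrM natrB; last lia.
  by rewrite -[(a + b).+1%:R]natr1 -nE -njE; ring.
- congr (1 - _); apply: powR_nat.
  rewrite natrM -[b.+1%:R]natr1 -niE; ring.
- congr (1 - _); apply: powR_nat.
  by rewrite natrM -[(a + b).+1%:R]natr1 -nE; ring.
- congr (1 - _); apply: powR_nat.
  by rewrite natrM -[(a + b).+2%:R]natr1 -[(a + b).+1%:R]natr1 -nE; ring.
Qed.

Lemma a_minusE : a_minus q n i j = cam a b t.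
Proof.
rewrite /a_minus /cam /Lc -[RHS]mul1r.
rewrite -sqrt_coef ?ler01 ?subX_ge0// expr1n mul1r.
congr (Num.sqrt (_ * _ / _)).
- by congr (1 - _); apply: powR_nat; rewrite natrM -njE; ring.
- by congr (1 - _); apply: powR_nat; rewrite natrM -niE; ring.
rewrite mulrC; congr (_ * _).
- congr (1 - _); apply: powR_nat; rewrite natrM -[(a + b).+1%:R]natr1 -nE; ring.
- congr (1 - _); apply: powR_nat; rewrite natrM -nE; ring.
Qed.

Lemma b_minusE : b_minus q n i j = cbm a b t.
Proof.
rewrite /b_minus /cbm /Kc /Lc [RHS]mulrCA.
rewrite -sqrt_coef ?exprn_ge0 ?q_ge0 ?subX_ge0// -exprM.
congr (Num.sqrt (_ * (_ * _ / _))).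
- by apply: powR_nat; rewrite niE natrM mulrC.
- by congr (1 - _); apply: powR_nat; rewrite natrM -njE; ring.
- congr (1 - _); apply: powR_nat; rewrite natrM natrB; last lia.
  by rewrite -nE -niE; ring.
rewrite mulrC; congr (_ * _).
- congr (1 - _); apply: powR_nat; rewrite natrM -[(a + b).+1%:R]natr1 -nE; ring.
- congr (1 - _); apply: powR_nat; rewrite natrM -nE; ring.
Qed.

End CoefficientsAt.

End Coefficients.

(** * Bounded commutators *)

Section Commutators.
Context {R : realType} {T : choiceType}.
Local Notation H := (l2 R T).
Implicit Types (u v w : H) (x y : T) (a b : H -> H).
Variable ev : T -> R.

Definition bcomm a := exists2 M : R, 0 <= M & forall v Dv, mdiag ev (v, Dv) ->
  exists2 Dav, mdiag ev (a v, Dav) & l2norm (Dav - a Dv) <= M * l2norm v.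

Lemma bounded_commutatorP a : bounded_commutator (mdiag ev) a <-> bcomm a.
Proof.
split=> [[M MP]|[M M0 MP]].
  exists `|M| => // v Dv /MP[Dav DavP h]; exists Dav => //.
  move: h; rewrite ler_l2norm => /le_trans; apply.
  by rewrite ler_wpM2r ?l2norm_ge0 ?ler_norm.
by exists M => v Dv /MP[Dav DavP h]; exists Dav; rewrite // ler_l2norm.
Qed.

Lemma bcomm_id : bcomm id.
Proof. by exists 0 => // v Dv vP; exists Dv; rewrite // subrr l2norm0 mul0r. Qed.

Lemma bcomm_add a b : bcomm a -> bcomm b -> bcomm (fun v => a v + b v).
Proof.
move=> [M M0 aM] [N N0 bN]; exists (M + N) => [|v Dv vP]; first exact: addr_ge0.
have [Da /mdiagP DaP Dan] := aM _ _ vP; have [Db /mdiagP DbP Dbn] := bN _ _ vP.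
exists (Da + Db).
  by apply/mdiagP => x; rewrite !l2_add DaP DbP mulrDr.
have -> : Da + Db - (a Dv + b Dv) = (Da - a Dv) + (Db - b Dv) by rewrite opprD addrACA.
by apply: le_trans (l2normD _ _) _; rewrite mulrDl; exact: lerD.
Qed.

Lemma bcomm_scale (c : R[i]) a : bcomm a -> bcomm (fun v => c *: a v).
Proof.
move=> [M M0 aM]; exists (Num.sqrt (sqmod c) * M) => [|v Dv vP].
  by rewrite mulr_ge0// sqrtr_ge0.
have [Da /mdiagP DaP Dan] := aM _ _ vP; exists (c *: Da).
  by apply/mdiagP => x; rewrite !l2_scale DaP mulrCA.
by rewrite -scalerBr l2normZ -mulrA ler_wpM2l ?sqrtr_ge0.
Qed.

(** The Leibniz rule [D, ab] = [D, a] b + a [D, b]. *)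
Lemma bcomm_comp a b : linear a -> norm_bounded a -> norm_bounded b ->
  bcomm a -> bcomm b -> bcomm (fun v => a (b v)).
Proof.
move=> la [A A0 aA] [B B0 bB] [M M0 aM] [N N0 bN].
exists (M * B + A * N) => [|v Dv vP]; first by rewrite addr_ge0 ?mulr_ge0.
have [Db DbP Dbn] := bN _ _ vP; have [Da DaP Dan] := aM _ _ DbP.
exists Da => //.
have aB : a (Db - b Dv) = a Db - a (b Dv).
  by have := la (-1) (b Dv) Db; rewrite !scaleN1r [- b Dv + Db]addrC addrC => ->; rewrite addrC.
have -> : Da - a (b Dv) = (Da - a Db) + a (Db - b Dv) by rewrite aB addrA subrK.
apply: le_trans (l2normD _ _) _; rewrite mulrDl; apply: lerD.
  by apply: le_trans Dan _; rewrite -mulrA ler_wpM2l.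
by apply: le_trans (aA _) _; rewrite -mulrA ler_wpM2l.
Qed.

Lemma mdiag_sym v Dv w Dw : mdiag ev (v, Dv) -> mdiag ev (w, Dw) -> ip Dv w = ip v Dw.
Proof.
move=> /mdiagP vP /mdiagP wP; apply: ip_eq => x; rewrite vP wP conjcM conjc_real.
by rewrite -mulrA mulrCA.
Qed.

(* The error functional of the adjoint is controlled by duality against finitely
   supported vectors, on which the commutator with [a] is bounded. *)
Lemma bcomm_adjoint a b : sform a b -> bcomm a -> bcomm b.
Proof.
move=> ab [M M0 aM]; exists M => // v Dv vP.
pose g x : R[i] := (ev x)%:C * b v x - b Dv x.
have gM (r : seq T) : uniq r -> \sum_(x <- r) sqmod (g x) <= (M * l2norm v) ^+ 2.
  move=> ur; set S := \sum_(x <- r) _.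
  (* The test vector is the truncation of the error itself, so the pairing below equals minus its
     squared norm [S], and Cauchy-Schwarz bounds [S]. *)
  pose w : H := \sum_(x <- r) g x *: delta x.
  pose Dw : H := \sum_(x <- r) g x *: ((ev x)%:C *: delta x).
  have wP : mdiag ev (w, Dw).
    apply/mdiagP => y; rewrite /w /Dw !l2_sum mulr_sumr; apply: eq_bigr => x _.
    by have /mdiagP/(_ y) E := mdiag_delta ev x; rewrite l2_scale E l2_scale; ring.
  have wS : l2norm w ^+ 2 = S by rewrite l2norm_sum_delta.
  have [Daw DawP Dawn] := aM _ _ wP.
  have ipS : ip (Daw - a Dw) v = - S%:C.
    rewrite ipBl (mdiag_sym DawP vP) !ab /w /Dw !ip_suml -sumrB /S.
    rewrite rmorph_sum -sumrN; apply: eq_bigr => x _.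
    rewrite !ipZl !ip_delta /g.
    case: (b v x) (b Dv x) => [a1 b1] [a2 b2].
    by apply/eqP; rewrite eq_complex /sqmod /=; apply/andP; split; apply/eqP; ring.
  have S0 : 0 <= S by apply: sumr_ge0 => x _; exact: sqmod_ge0.
  have := sqmod_ip_le (Daw - a Dw) v; rewrite ipS sqmodN sqmod_real.
  have [->|Sn0] := eqVneq S 0; first by rewrite sqr_ge0.
  have Sp : 0 < S by rewrite lt_neqAle eq_sym Sn0.
  move=> h; rewrite -(ler_pM2l Sp) -expr2; apply: le_trans h _.
  rewrite -wS -exprMn lerXn2r ?nnegrE ?mulr_ge0 ?l2norm_ge0//.
  by rewrite mulrA [l2norm w * M]mulrC ler_wpM2r ?l2norm_ge0.
have g2 : g \in square_summable by exact: summable_le_sum gM.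
pose G : H := L2 g2; exists (b Dv + G).
  by apply/mdiagP => x; rewrite l2_add -[G x]/(g x) /g addrC subrK.
rewrite addrC addKr; apply: l2norm_le_sum => //.
by rewrite mulr_ge0 ?l2norm_ge0.
Qed.

(** The commutator is the weighted shift along the same [s] whose weights are multiplied by
    eigenvalue differences. *)
Lemma bcomm_wshift (c : T -> T -> R) s (M N : R) : partial_inj s ->
  weight_bound c s M -> 0 <= N ->
  (forall x y, s x = Some y -> `|c x y * (ev x - ev y)| <= N) ->
  bcomm (wshift c s).
Proof.
move=> sI cM N0 cN; exists N => // v Dv /mdiagP vP.
have cN' : weight_bound (fun x y => c x y * (ev x - ev y)) s N by [].
exists (wshift c s Dv + wshift (fun x y => c x y * (ev x - ev y)) s v).
  apply/mdiagP => x; rewrite l2_add (wshiftE sI cM) (wshiftE sI cN') (wshiftE sI cM).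
  rewrite /wshift_fun; case: (s x) => [y|]; last by rewrite mulr0 addr0.
  by rewrite vP !rmorphM rmorphB /=; ring.
by rewrite addrC addKr; exact: l2norm_wshift.
Qed.

(** The left side is the squared modulus of a matrix entry of the commutator; where the entry of [a]
    is bounded below, it bounds an eigenvalue difference. *)
Lemma bcomm_entry a : linear a -> bcomm a ->
  exists2 M : R, 0 <= M & forall x y, (ev y - ev x) ^+ 2 * sqmod (a (delta x) y) <= M ^+ 2.
Proof.
move=> la [M M0 aM]; exists M => // x y.
have [Da /mdiagP DaP Dan] := aM _ _ (mdiag_delta ev x).
have aZ : a ((ev x)%:C *: delta x) = (ev x)%:C *: a (delta x).
  have a0 : a 0 = 0.
    by have := la (-1) 0 0; rewrite scaleN1r oppr0 add0r scaleN1r addrC subrr.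
  by have := la (ev x)%:C (delta x) 0; rewrite !addr0 a0 addr0.
have := le_trans (sqmod_le (Da - a ((ev x)%:C *: delta x)) y)
  (_ : l2norm _ ^+ 2 <= M ^+ 2).
rewrite aZ l2_sub DaP l2_scale -mulrBl sqmodM -rmorphB sqmod_real; apply.
rewrite lerXn2r ?nnegrE ?l2norm_ge0// -aZ.
by apply: le_trans Dan _; rewrite l2norm_delta mulr1.
Qed.

End Commutators.

(** * The generators and their adjoints as weighted shifts *)

Section Generators.
Context {R : realType}.
Variables (q : R) (hq : 0 < q < 1).
Local Notation H := (l2 R label).
Implicit Types (v : H) (x y : label).
Local Notation srcw c := (fun _ y => c q (ca y) (cb y) (ct y)).
Local Notation tgtw c := (fun x _ => c q (ca x) (cb x) (ct x)).

Lemma cap_le1 y : `|cap q (ca y) (cb y) (ct y)| <= 1.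
Proof.
have := ct_le y => tab; rewrite /cap normrM !ger0_norm ?(Kc_ge0 hq)//.
by apply: mulr_ile1; rewrite ?(Kc_ge0 hq) ?(Kc_le1 hq)//; lia.
Qed.

Lemma cam_le1 y : `|cam q (ca y) (cb y) (ct y)| <= 1.
Proof.
have := ct_le y => tab; rewrite /cam normrM !ger0_norm ?(Lc_ge0 q)//.
by apply: mulr_ile1; rewrite ?(Lc_ge0 q) ?(Lc_le1 hq)//; lia.
Qed.

Lemma cbp_le1 y : `|cbp q (ca y) (cb y) (ct y)| <= 1.
Proof.
have := ct_le y => tab; rewrite /cbp normrN normrM !ger0_norm ?(Lc_ge0 q) ?(Kc_ge0 hq)//.
by apply: mulr_ile1; rewrite ?(Lc_ge0 q) ?(Kc_ge0 hq) ?(Lc_le1 hq) ?(Kc_le1 hq)//; lia.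
Qed.

Lemma cbm_le1 y : `|cbm q (ca y) (cb y) (ct y)| <= 1.
Proof.
have := ct_le y => tab; rewrite /cbm normrM !ger0_norm ?(Lc_ge0 q) ?(Kc_ge0 hq)//.
by apply: mulr_ile1; rewrite ?(Lc_ge0 q) ?(Kc_ge0 hq) ?(Lc_le1 hq) ?(Kc_le1 hq)//; lia.
Qed.

Definition astar v : H :=
  wshift (tgtw cap) (lmove 0 0 0 1 0 0) v + wshift (tgtw cam) (lmove 0 1 1 0 0 0) v.
Definition bstar v : H :=
  wshift (tgtw cbp) (lmove 0 0 0 0 1 0) v + wshift (tgtw cbm) (lmove 1 0 1 0 0 0) v.

Lemma insub_label (p : nat * nat * nat) y : insub p = Some y <-> sval y = p.
Proof.
split=> [|yp]; first by case: insubP => // z _ zp [<-].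
by rewrite -yp -[sval y]/(val y) valK.
Qed.

Lemma triple_eq (m s t m' s' t' : nat) :
  (m, s, t) = (m', s', t') <-> [/\ m = m', s = s' & t = t'].
Proof. by split=> [[-> -> ->]|[-> -> ->]]. Qed.

Lemma alphaE v : alpha hq v =
  wshift (srcw cap) (lmove 1 0 0 0 0 0) v + wshift (srcw cam) (lmove 0 0 0 0 1 1) v.
Proof.
apply: l2P => x; rewrite [RHS]l2_add.
rewrite (wshiftE (@lmove_inj _ _ _ _ _ _) (M := 1)); last by move=> ? y _; exact: cap_le1.
rewrite (wshiftE (@lmove_inj _ _ _ _ _ _) (M := 1)); last by move=> ? y _; exact: cam_le1.
rewrite -[alpha hq v x]/(alpha_fun q v x) /alpha_fun.
case: x => [[[m s] t] /= xP].
congr (_ + _); rewrite /pull /wshift_fun.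
  rewrite (_ : obind _ _ = lmove 1 0 0 0 0 0 (exist _ (m, s, t) xP)); last first.
    apply: option_ext => -[[[m' s'] t'] yP]; rewrite lmoveP /ca /cb /ct /=.
    have /andP[/= ? ?] := yP; case: m xP => [|m] xP; have /andP[/= ? ?] := xP.
      by split=> // -[]; lia.
    by rewrite insub_label /= triple_eq; split=> -[] *; split; lia.
  by case: lmove => // y; rewrite a_plusE.
rewrite (_ : obind _ _ = lmove 0 0 0 0 1 1 (exist _ (m, s, t) xP)); last first.
  apply: option_ext => -[[[m' s'] t'] yP]; rewrite lmoveP /ca /cb /ct /= insub_label /=.
  have /andP[/= ? ?] := yP; have /andP[/= ? ?] := xP.
  by rewrite triple_eq; split=> -[] *; split; lia.
by case: lmove => // y; rewrite a_minusE.
Qed.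

Lemma betaE v : beta hq v =
  wshift (srcw cbp) (lmove 0 1 0 0 0 0) v + wshift (srcw cbm) (lmove 0 0 0 1 0 1) v.
Proof.
apply: l2P => x; rewrite [RHS]l2_add.
rewrite (wshiftE (@lmove_inj _ _ _ _ _ _) (M := 1)); last by move=> ? y _; exact: cbp_le1.
rewrite (wshiftE (@lmove_inj _ _ _ _ _ _) (M := 1)); last by move=> ? y _; exact: cbm_le1.
rewrite -[beta hq v x]/(Defs.beta_fun q v x) /Defs.beta_fun.
case: x => [[[m s] t] /= xP].
congr (_ + _); rewrite /pull /wshift_fun.
  rewrite (_ : obind _ _ = lmove 0 1 0 0 0 0 (exist _ (m, s, t) xP)); last first.
    apply: option_ext => -[[[m' s'] t'] yP]; rewrite lmoveP /ca /cb /ct /=.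
    have /andP[/= ? ?] := yP; case: m xP => [|m] xP.
      by have /andP[/= ? ?] := xP; split=> // -[]; lia.
    case: s xP => [|s] xP; have /andP[/= ? ?] := xP; first by split=> // -[]; lia.
    by rewrite insub_label /= triple_eq; split=> -[] *; split; lia.
  by case: lmove => // y; rewrite b_plusE.
rewrite (_ : obind _ _ = lmove 0 0 0 1 0 1 (exist _ (m, s, t) xP)); last first.
  apply: option_ext => -[[[m' s'] t'] yP]; rewrite lmoveP /ca /cb /ct /= insub_label /=.
  have /andP[/= ? ?] := yP; have /andP[/= ? ?] := xP.
  by rewrite triple_eq; split=> -[] *; split; lia.
by case: lmove => // y; rewrite b_minusE.
Qed.

Lemma srcw_bound (c : R -> nat -> nat -> nat -> R) s :
  (forall y, `|c q (ca y) (cb y) (ct y)| <= 1) -> weight_bound (srcw c) s 1.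
Proof. by move=> c1 x y _; exact: c1. Qed.

Lemma linear_add (f g : H -> H) : linear f -> linear g -> linear (fun v => f v + g v).
Proof. by move=> lf lg c u v; rewrite lf lg scalerDr addrACA. Qed.

Lemma alpha_linear : linear (alpha hq).
Proof.
rewrite (_ : alpha hq = fun v => wshift (srcw cap) (lmove 1 0 0 0 0 0) v +
  wshift (srcw cam) (lmove 0 0 0 0 1 1) v); last exact/funext/alphaE.
apply: linear_add.
  exact: wshift_linear (@lmove_inj _ _ _ _ _ _) (srcw_bound cap_le1).
exact: wshift_linear (@lmove_inj _ _ _ _ _ _) (srcw_bound cam_le1).
Qed.

Lemma beta_linear : linear (beta hq).
Proof.
rewrite (_ : beta hq = fun v => wshift (srcw cbp) (lmove 0 1 0 0 0 0) v +
  wshift (srcw cbm) (lmove 0 0 0 1 0 1) v); last exact/funext/betaE.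
apply: linear_add.
  exact: wshift_linear (@lmove_inj _ _ _ _ _ _) (srcw_bound cbp_le1).
exact: wshift_linear (@lmove_inj _ _ _ _ _ _) (srcw_bound cbm_le1).
Qed.

Lemma alpha_norm_bounded : norm_bounded (alpha hq).
Proof.
rewrite (_ : alpha hq = fun v => wshift (srcw cap) (lmove 1 0 0 0 0 0) v +
  wshift (srcw cam) (lmove 0 0 0 0 1 1) v); last exact/funext/alphaE.
apply: norm_bounded_add.
  exact: norm_bounded_wshift (@lmove_inj _ _ _ _ _ _) (srcw_bound cap_le1) ler01.
exact: norm_bounded_wshift (@lmove_inj _ _ _ _ _ _) (srcw_bound cam_le1) ler01.
Qed.

Lemma beta_norm_bounded : norm_bounded (beta hq).
Proof.
rewrite (_ : beta hq = fun v => wshift (srcw cbp) (lmove 0 1 0 0 0 0) v +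
  wshift (srcw cbm) (lmove 0 0 0 1 0 1) v); last exact/funext/betaE.
apply: norm_bounded_add.
  exact: norm_bounded_wshift (@lmove_inj _ _ _ _ _ _) (srcw_bound cbp_le1) ler01.
exact: norm_bounded_wshift (@lmove_inj _ _ _ _ _ _) (srcw_bound cbm_le1) ler01.
Qed.

Lemma alpha_adjoint : sform (alpha hq) astar.
Proof.
move=> u v; rewrite alphaE ipDl /astar ipDr.
congr (_ + _).
  apply: (wshift_adjoint (@lmove_inj _ _ _ _ _ _) (srcw_bound cap_le1)).
  exact: lmove_sym.
apply: (wshift_adjoint (@lmove_inj _ _ _ _ _ _) (srcw_bound cam_le1)).
exact: lmove_sym.
Qed.

Lemma beta_adjoint : sform (beta hq) bstar.
Proof.
move=> u v; rewrite betaE ipDl /bstar ipDr.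
congr (_ + _).
  apply: (wshift_adjoint (@lmove_inj _ _ _ _ _ _) (srcw_bound cbp_le1)).
  exact: lmove_sym.
apply: (wshift_adjoint (@lmove_inj _ _ _ _ _ _) (srcw_bound cbm_le1)).
exact: lmove_sym.
Qed.

Lemma Af_linear_bounded a : Af hq a -> linear a /\ norm_bounded a.
Proof.
elim=> {a} [| | |a b _ [la na] _ [lb nb]|c a _ [la na]|a b _ [la na] _ [lb nb]
  |a b _ [la na] ab].
- by split; [exact: alpha_linear|exact: alpha_norm_bounded].
- by split; [exact: beta_linear|exact: beta_norm_bounded].
- by split=> [c u v //|]; exists 1 => // v; rewrite mul1r.
- by split; [exact: linear_add|exact: norm_bounded_add].
- split; last exact: norm_bounded_scale.
  by move=> k u v; rewrite la scalerDr !scalerA mulrC.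
- split; last exact: norm_bounded_comp.
  by move=> k u v; rewrite lb la.
- by split; [exact: adjoint_linear ab|exact: adjoint_norm_bounded ab na].
Qed.

Lemma Af_bcomm (ev : label -> R) : bcomm ev (alpha hq) -> bcomm ev (beta hq) ->
  forall a, Af hq a -> bcomm ev a.
Proof.
move=> ha hb a; elim=> {a} [//|//| |a b _ IHa _ IHb|c a _ IHa|a b Aa IHa Ab IHb|a b _ IHa ab].
- exact: bcomm_id.
- exact: bcomm_add.
- exact: bcomm_scale.
- have [la na] := Af_linear_bounded Aa; have [_ nb] := Af_linear_bounded Ab.
  exact: bcomm_comp.
- exact: bcomm_adjoint ab IHa.
Qed.

Lemma Af_astar : Af hq astar.
Proof. exact: Af_star (Af_alpha hq) alpha_adjoint. Qed.

Lemma Af_bstar : Af hq bstar.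
Proof. exact: Af_star (Af_beta hq) beta_adjoint. Qed.

Lemma Af_CSUq2 a : Af hq a -> CSUq2 hq a.
Proof.
move=> Aa; split; first exact/bounded_opP/Af_linear_bounded.
move=> e e0; exists a => // v.
by rewrite subrr ler_l2norm l2norm0 mulr_ge0 ?l2norm_ge0// ltW.
Qed.

Lemma realcM (r r' : R) : (r * r')%:C = r%:C * r'%:C.
Proof. exact: rmorphM. Qed.

(** Here and in the next three formulas the truncated predecessor is harmless: where it fails to
    decrease, the coefficient contains [Kc M M] or [Lc M 0] and vanishes. *)
Lemma crd_alpha v a b t : (t <= a + b)%N -> crd (alpha hq v) a b t =
  ((Kc q (a + b) t)%:C * (Kc q (a + b).+1 b.+1)%:C) * crd v a.-1 b t +
  ((Lc q (a + b).+2 t.+1)%:C * (Lc q (a + b).+1 b.+1)%:C) * crd v a b.+1 t.+1.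
Proof.
move=> tab; rewrite -2!realcM alphaE crdD (crd_lmove_src _ _ _ _ _ _ _ cap_le1)//.
rewrite (crd_lmove_src _ _ _ _ _ _ _ cam_le1)// !addn0 !addn1 !subn0 !andbT.
congr (_ + _); last by rewrite /cam !addnS.
case: a tab => [|a] tab /=; first by rewrite !add0n Kcn mulr0 mul0r.
by rewrite subn1 /cap.
Qed.

Lemma crd_beta v a b t : (t <= a + b)%N -> crd (beta hq v) a b t =
  - ((Kc q (a + b) t)%:C * (Lc q (a + b).+1 b)%:C) * crd v a b.-1 t +
  ((Lc q (a + b).+2 t.+1)%:C * (Kc q (a + b).+1 b)%:C) * crd v a.+1 b t.+1.
Proof.
move=> tab; rewrite -2!realcM betaE crdD (crd_lmove_src _ _ _ _ _ _ _ cbp_le1)//.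
rewrite (crd_lmove_src _ _ _ _ _ _ _ cbm_le1)// !addn0 !addn1 !subn0 !andbT.
congr (_ + _).
case: b tab => [|b] tab /=; first by rewrite Lc0 mulr0 oppr0 mul0r.
by rewrite subn1 /cbp rmorphN /= addnS.
Qed.

Lemma crd_astar v a b t : (t <= a + b)%N -> crd (astar v) a b t =
  ((Kc q (a + b).+1 t)%:C * (Kc q (a + b).+2 b.+1)%:C) * crd v a.+1 b t +
  ((Lc q (a + b).+1 t)%:C * (Lc q (a + b) b)%:C) * crd v a b.-1 t.-1.
Proof.
move=> tab; rewrite -2!realcM crdD (crd_lmove_tgt _ _ _ _ _ _ _ cap_le1)//.
rewrite (crd_lmove_tgt _ _ _ _ _ _ _ cam_le1)// !addn0 !addn1 !subn0.
congr (_ + _); rewrite /cam !subn1.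
case: b tab => [|b] tab /=; first by rewrite Lc0 mulr0 mul0r.
by case: t tab => [|t] tab //=; rewrite Lc0 mul0r mul0r.
Qed.

Lemma crd_bstar v a b t : (t <= a + b)%N -> crd (bstar v) a b t =
  - ((Kc q (a + b).+1 t)%:C * (Lc q (a + b).+2 b.+1)%:C) * crd v a b.+1 t +
  ((Lc q (a + b).+1 t)%:C * (Kc q (a + b) b)%:C) * crd v a.-1 b t.-1.
Proof.
move=> tab; rewrite -2!realcM crdD (crd_lmove_tgt _ _ _ _ _ _ _ cbp_le1)//.
rewrite (crd_lmove_tgt _ _ _ _ _ _ _ cbm_le1)// !addn0 !addn1 !subn0.
congr (_ + _); first by rewrite /cbp rmorphN.
rewrite /cbm !subn1; case: a tab => [|a] tab /=; first by rewrite add0n Kcn mulr0 mul0r.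
by case: t tab => [|t] tab //=; rewrite Lc0 mul0r mul0r.
Qed.

End Generators.

(* Ideal membership certificates: x = y follows from hypotheses l = r once ring
   writes x - y as a combination of the differences l - r. *)
Lemma lincomb2 (F : comRingType) (x y l r c l' r' c' : F) : l = r -> l' = r' ->
  x - y = (l - r) * c + (l' - r') * c' -> x = y.
Proof. by move=> -> -> /eqP; rewrite !subrr !mul0r addr0 subr_eq0 => /eqP. Qed.

Lemma lincomb1 (F : comRingType) (x y l r c : F) : l = r -> x - y = (l - r) * c -> x = y.
Proof. by move=> lr E; apply: (lincomb2 (c := c) (c' := 0) lr lr); rewrite mulr0 addr0. Qed.

Lemma lincomb4 (F : comRingType) (x y l1 r1 c1 l2 r2 c2 l3 r3 c3 l4 r4 c4 : F) :
  l1 = r1 -> l2 = r2 -> l3 = r3 -> l4 = r4 ->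
  x - y = (l1 - r1) * c1 + (l2 - r2) * c2 + (l3 - r3) * c3 + (l4 - r4) * c4 -> x = y.
Proof.
move=> E1 E2 -> -> E; apply: (lincomb2 (c := c1) (c' := c2) E1 E2).
by rewrite E !subrr !mul0r !addr0.
Qed.

(** * The fundamental unitary *)

Section FundamentalUnitary.
Context {R : realType}.
Variables (q : R) (hq : 0 < q < 1).
Local Notation H := (l2 R label).
Local Notation H2 := ('I_2 -> H).
Implicit Types (x y : H2) (a b t M : nat).
Local Notation kk M t := ((Kc q M t)%:C).
Local Notation ll M t := ((Lc q M t)%:C).
Local Notation fst2 x := (x (ord0 : 'I_2)).
Local Notation snd2 x := (x (ord_max : 'I_2)).

(* The fundamental unitary [[alpha, - q beta^*], [beta, alpha^*]] and its adjoint. *)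
Definition umx : 'M[H -> H]_2 := \matrix_(r, s)
  if r == ord0 then if s == ord0 then alpha hq else (fun v => - q%:C *: bstar q v)
  else if s == ord0 then beta hq else astar q.

Definition vmx : 'M[H -> H]_2 := \matrix_(r, s)
  if r == ord0 then if s == ord0 then astar q else bstar q
  else if s == ord0 then (fun v => - q%:C *: beta hq v) else alpha hq.

Lemma mx_act2 (g : 'M[H -> H]_2) x r :
  mx_act g x r = g r ord0 (fst2 x) + g r ord_max (snd2 x).
Proof.
rewrite /mx_act big_ord_recr big_ord_recr big_ord0 /= add0r.
by congr (g _ _ (x _) + _); apply: val_inj.
Qed.

(* Clebsch-Gordan bases of the two copies of l2: the y-coordinates of umx v are the
   x-coordinates of v, so that umx becomes a change of basis. *)
Definition xp x a b t : R[i] :=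
  kk (a + b).+1 t * crd (fst2 x) a b t - ll (a + b).+1 t * crd (snd2 x) a b t.-1.
Definition xm x a b t : R[i] :=
  ll (a + b).+1 t * crd (fst2 x) a b t + kk (a + b).+1 t * crd (snd2 x) a b t.-1.
Definition yp y a b t : R[i] :=
  kk (a + b).+2 b.+1 * crd (fst2 y) a.+1 b t - ll (a + b).+2 b.+1 * crd (snd2 y) a b.+1 t.
Definition ym y a b t : R[i] :=
  ll (a + b) b * crd (fst2 y) a b.-1 t.-1 + kk (a + b) b * crd (snd2 y) a.-1 b t.-1.

Lemma KLsqrC M t : (t <= M)%N -> (0 < M)%N -> kk M t ^+ 2 + ll M t ^+ 2 = 1.
Proof. by move=> tM M0; rewrite -!rmorphXn -rmorphD /= KLsqr. Qed.

Lemma KLqshiftC M t b : q%:C * kk M t * ll M.+1 b = ll M b * kk M.+1 t.+1.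
Proof. by rewrite -!rmorphM KLqshift. Qed.

Lemma LLsymC M t b : ll M t * ll M.+1 b = ll M b * ll M.+1 t.
Proof. by rewrite -!rmorphM LLsym. Qed.

Lemma KKsymC M t b : kk M t * kk M.+1 b.+1 = kk M b * kk M.+1 t.+1.
Proof. by rewrite -!rmorphM KKsym. Qed.

Lemma Lc0C M : ll M 0 = 0 :> R[i].
Proof. by rewrite Lc0. Qed.

Lemma KcnC M : kk M M = 0 :> R[i].
Proof. by rewrite Kcn. Qed.

Lemma crd_pm_fst x a b t : (t <= a + b)%N ->
  crd (fst2 x) a b t = kk (a + b).+1 t * xp x a b t + ll (a + b).+1 t * xm x a b t.
Proof.
move=> tab; rewrite /xp /xm; have := @KLsqrC (a + b).+1 t (leqW tab) isT.
move=> E; rewrite -[LHS]mul1r -E; ring.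
Qed.

Lemma crd_pm_snd x a b t : (t <= a + b)%N ->
  crd (snd2 x) a b t =
    - ll (a + b).+1 t.+1 * xp x a b t.+1 + kk (a + b).+1 t.+1 * xm x a b t.+1.
Proof.
move=> tab; rewrite /xp /xm /=; have := @KLsqrC (a + b).+1 t.+1 tab isT.
move=> E; rewrite -[LHS]mul1r -E; ring.
Qed.

(** With 2n = a + b, spin n tensor spin 1/2 is the sum of spins n + 1/2 and n - 1/2: [xp] has 2n + 2
    values of t, [xm] has 2n. At the two extreme values of t a vanishing coefficient replaces the
    missing [xm]. *)
Lemma pm_ext x y :
  (forall a b t, (t <= (a + b).+1)%N -> xp x a b t = xp y a b t) ->
  (forall a b t, (0 < t <= a + b)%N -> xm x a b t = xm y a b t) -> x = y.
Proof.
move=> Ep Em; apply/funext => r.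
have [->|->] : r = ord0 \/ r = ord_max.
  by case: r => -[|[|//]] h; [left|right]; apply: val_inj.
- apply: crd_ext => a b t tab; rewrite !crd_pm_fst// Ep ?leqW//.
  case: t tab => [|t] tab; last by rewrite Em.
  by rewrite Lc0 !mul0r.
- apply: crd_ext => a b t tab; rewrite !crd_pm_snd// Ep//.
  have [tab'|tab'] := ltnP t (a + b); first by rewrite Em.
  have -> : t = (a + b)%N by apply/eqP; rewrite eqn_leq tab.
  by rewrite Kcn !mul0r.
Qed.

(** Only the cells (a - 1, b) and (a, b + 1) contribute, and in [umx_snd] only (a, b - 1) and (a +
    1, b): these are the rotations of the squares of cells. *)
Lemma umx_fst x a b t : (t <= a + b)%N -> crd (fst2 (mx_act umx x)) a b t =
  kk (a + b).+1 b.+1 * xp x a.-1 b t + ll (a + b).+1 b.+1 * xm x a b.+1 t.+1.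
Proof.
move=> tab; rewrite mx_act2 !mxE /= crdD crdZ crd_alpha// crd_bstar//.
rewrite /xm addnS /=.
have E1 := KLqshiftC (a + b).+1 t b.+1; have E2 := KLqshiftC (a + b) b t.
case: a tab E1 E2 => [|a] tab E1 E2.
  rewrite !add0n in tab E1 E2 *; rewrite !Kcn !mulr0 !mul0r.
  by apply: (lincomb1 (c := crd (snd2 x) 0 b.+1 t) E1); ring.
rewrite /xp /= -!addSn in E1 E2 *.
by apply: (lincomb2 (c := crd (snd2 x) a.+1 b.+1 t) (c' := - crd (snd2 x) a b t.-1) E1 E2); ring.
Qed.

Lemma umx_snd x a b t : (t <= a + b)%N -> crd (snd2 (mx_act umx x)) a b t =
  - ll (a + b).+1 b * xp x a b.-1 t + kk (a + b).+1 b * xm x a.+1 b t.+1.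
Proof.
move=> tab; rewrite mx_act2 !mxE /= crdD crd_beta// crd_astar//.
rewrite /xm addSn /=.
have E1 := LLsymC (a + b) t b; have E2 := KKsymC (a + b).+1 t b.
case: b tab E1 E2 => [|b] tab E1 E2.
  rewrite !Lc0C.
  by apply: (lincomb1 (c := crd (snd2 x) a.+1 0 t) E2); ring.
rewrite /xp /= -!addnS in E1 E2 *.
by apply: (lincomb2 (c := - crd (snd2 x) a b t.-1) (c' := crd (snd2 x) a.+1 b.+1 t) E1 E2); ring.
Qed.

Lemma vmx_fst y a b t : (t <= a + b)%N -> crd (fst2 (mx_act vmx y)) a b t =
  kk (a + b).+1 t * yp y a b t + ll (a + b).+1 t * ym y a b t.
Proof.
move=> tab; rewrite mx_act2 !mxE /= crdD crd_astar// crd_bstar//.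
by rewrite /yp /ym; ring.
Qed.

Lemma vmx_snd y a b t : (t <= a + b)%N -> crd (snd2 (mx_act vmx y)) a b t =
  - ll (a + b).+1 t.+1 * yp y a b t.+1 + kk (a + b).+1 t.+1 * ym y a b t.+1.
Proof.
move=> tab; rewrite mx_act2 !mxE /= crdD crdZ crd_beta// crd_alpha//.
rewrite /yp /ym /=.
have E1 := KLqshiftC (a + b) t b; have E2 := KLqshiftC (a + b).+1 b t.+1.
have E3 := KKsymC (a + b) t b; have E4 := LLsymC (a + b).+1 t.+1 b.+1.
apply: (lincomb4 (c1 := crd (fst2 y) a b.-1 t) (c2 := - crd (fst2 y) a.+1 b t.+1)
  (c3 := crd (snd2 y) a.-1 b t) (c4 := - crd (snd2 y) a b.+1 t.+1) E1 E2 E3 E4).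
by ring.
Qed.

Lemma xp_vmx y a b t : (t <= (a + b).+1)%N -> xp (mx_act vmx y) a b t = yp y a b t.
Proof.
move=> tab; have E := @KLsqrC (a + b).+1 t tab isT; rewrite /xp.
case: t tab E => [|t] tab E.
  rewrite vmx_fst// Lc0C in E *; apply: (lincomb1 (c := yp y a b 0) E); ring.
rewrite vmx_snd//=; move: tab; rewrite leq_eqVlt => /predU1P[[tE]|tab].
  (* At t = a + b + 1 the first component is out of range and its coefficient [Kc M M] is 0, so the
     second component alone gives the result. *)
  rewrite [X in kk _ _ * X]crd_out ?tE//.
  rewrite tE in E; have k0 := KcnC (a + b).+1.
  rewrite k0 in E *; apply: (lincomb1 (c := yp y a b (a + b).+1) E); ring.
rewrite vmx_fst//; apply: (lincomb1 (c := yp y a b t.+1) E); ring.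
Qed.

Lemma xm_vmx y a b t : (0 < t <= a + b)%N -> xm (mx_act vmx y) a b t = ym y a b t.
Proof.
case: t => [//|t] /= tab; have E := @KLsqrC (a + b).+1 t.+1 (leqW tab) isT.
rewrite /xm vmx_fst// vmx_snd 1?ltnW//=.
by apply: (lincomb1 (c := ym y a b t.+1) E); ring.
Qed.

Lemma yp_umx x a b t : (t <= (a + b).+1)%N -> yp (mx_act umx x) a b t = xp x a b t.
Proof.
move=> tab; have E := @KLsqrC (a + b).+2 b.+1 _ isT.
rewrite /yp umx_fst 1?umx_snd /= ?addSn ?addnS//.
have {}E := E (ltac:(lia)).
by apply: (lincomb1 (c := xp x a b t) E); ring.
Qed.

Lemma ym_umx x a b t : (0 < t <= a + b)%N -> ym (mx_act umx x) a b t = xm x a b t.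
Proof.
case: t => [//|t] /= tab; have E := @KLsqrC (a + b) b (leq_addl _ _) (leq_trans (ltn0Sn t) tab).
rewrite /ym /=; case: a tab E => [|a] tab E.
  case: b tab E => [|b] //= tab E; rewrite umx_fst//= !add0n in E *.
  rewrite !KcnC in E *.
  by apply: (lincomb1 (c := xm x 0 b.+1 t.+1) E); ring.
case: b tab E => [|b] tab E.
  rewrite Lc0C umx_snd /=; last by lia.
  rewrite Lc0C addSn in E *.
  by apply: (lincomb1 (c := xm x a.+1 0 t.+1) E); ring.
rewrite umx_fst /=; last by lia.
rewrite umx_snd /=; last by lia.
rewrite -!addSnnS in E *.
by apply: (lincomb1 (c := xm x a.+1 b.+1 t.+1) E); ring.
Qed.

Lemma vmxK : cancel (mx_act vmx) (mx_act umx).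
Proof.
move=> y; apply/funext => r.
have [->|->] : r = ord0 \/ r = ord_max.
  by case: r => -[|[|//]] h; [left|right]; apply: val_inj.
- apply: crd_ext => a b t tab; rewrite umx_fst// xm_vmx; last by lia.
  have E := @KLsqrC (a + b).+1 b.+1 _ isT; have {}E := E (ltac:(lia)).
  case: a tab E => [|a] tab E.
    rewrite /ym /= !add0n in E *; rewrite !KcnC in E *.
    by apply: (lincomb1 (c := crd (fst2 y) 0 b t) E); ring.
  rewrite xp_vmx /=; last by lia.
  rewrite /yp /ym /= -?addSn ?addnS in E *.
  by apply: (lincomb1 (c := crd (fst2 y) a.+1 b t) E); ring.
- apply: crd_ext => a b t tab; rewrite umx_snd// xm_vmx; last by lia.
  have E := @KLsqrC (a + b).+1 b _ isT; have {}E := E (ltac:(lia)).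
  case: b tab E => [|b] tab E.
    rewrite /ym /= !Lc0C addSn in E *.
    by apply: (lincomb1 (c := crd (snd2 y) a 0 t) E); ring.
  rewrite xp_vmx /=; last by lia.
  rewrite /yp /ym /= ?addSn ?addnS in E *.
  by apply: (lincomb1 (c := crd (snd2 y) a b.+1 t) E); ring.
Qed.

Lemma umxK : cancel (mx_act umx) (mx_act vmx).
Proof.
move=> x; apply: pm_ext => a b t tab.
  by rewrite xp_vmx// yp_umx.
by rewrite xm_vmx// ym_umx.
Qed.

Lemma umx_GL : GL_CSUq2 hq umx.
Proof.
split.
  move=> r s; apply: Af_CSUq2; rewrite mxE; case: ifP => _; case: ifP => _.
  - exact: Af_alpha.
  - exact/Af_scale/Af_bstar.
  - exact: Af_beta.
  - exact: Af_astar.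
exists vmx; split; [|exact: umxK|exact: vmxK].
move=> r s; apply: Af_CSUq2; rewrite mxE; case: ifP => _; case: ifP => _.
- exact: Af_astar.
- exact: Af_bstar.
- exact/Af_scale/Af_beta.
- exact: Af_alpha.
Qed.

End FundamentalUnitary.

(** * Dimension counts for Fredholm indices *)

Section FredholmAlgebra.
Context {R : realType} {V : lmodType R[i]}.
Local Notation C := R[i].
Implicit Types (A B X Y : set V) (f g h : V -> V).

Definition lin_subspace A := A 0 /\ forall c u v, A u -> A v -> A (c *: u + v).

Lemma lin_subspaceD A u v : lin_subspace A -> A u -> A v -> A (u + v).
Proof. by move=> [_ AL] Au Av; have := AL 1 _ _ Au Av; rewrite scale1r. Qed.

Lemma lin_subspaceZ A c v : lin_subspace A -> A v -> A (c *: v).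
Proof. by move=> [A0 AL] Av; have := AL c _ _ Av A0; rewrite addr0. Qed.

Lemma lin_subspaceB A u v : lin_subspace A -> A u -> A v -> A (u - v).
Proof. by move=> sA Au Av; apply: lin_subspaceD => //; rewrite -scaleN1r; exact: lin_subspaceZ. Qed.

Lemma lin_subspace_sum A (I : Type) (r : seq I) (F : I -> V) :
  lin_subspace A -> (forall i, A (F i)) -> A (\sum_(i <- r) F i).
Proof.
move=> sA AF; elim/big_ind: _ => //; first by case: sA.
by move=> u v; exact: lin_subspaceD.
Qed.

Lemma lin_subspace0 : lin_subspace [set 0].
Proof. by split=> // c u v -> ->; rewrite scaler0 addr0. Qed.

Lemma linear_fun0 f : linear f -> f 0 = 0.
Proof. by move=> lf; have := lf (-1) 0 0; rewrite !scaleN1r oppr0 addr0 addNr. Qed.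

Lemma linear_funB f u v : linear f -> f (u - v) = f u - f v.
Proof. by move=> lf; rewrite addrC -scaleN1r lf scaleN1r addrC. Qed.

Definition lc n (e : 'I_n -> V) (c : 'rV[C]_n) : V := \sum_i c 0 i *: e i.

Lemma lc_mul m n (e : 'I_n -> V) (c : 'rV[C]_m) (M : 'M[C]_(m, n)) :
  lc e (c *m M) = lc (fun k => lc e (row k M)) c.
Proof.
rewrite /lc; under eq_bigr do rewrite mxE scaler_suml.
rewrite exchange_big; apply: eq_bigr => k _; rewrite scaler_sumr.
by apply: eq_bigr => i _; rewrite scalerA mxE.
Qed.

Lemma lcB n (e : 'I_n -> V) c c' : lc e (c - c') = lc e c - lc e c'.
Proof. by rewrite /lc -sumrB; apply: eq_bigr => i _; rewrite !mxE scalerBl. Qed.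

Lemma lc0 n (e : 'I_n -> V) : lc e 0 = 0.
Proof. by rewrite /lc big1// => i _; rewrite mxE scale0r. Qed.

Lemma lin_subspace_lc A n (e : 'I_n -> V) c : lin_subspace A -> (forall i, A (e i)) -> A (lc e c).
Proof. by move=> sA Ae; apply: lin_subspace_sum => // i; exact: lin_subspaceZ. Qed.

Lemma linear_lc f n (e : 'I_n -> V) c : linear f -> f (lc e c) = lc (fun i => f (e i)) c.
Proof.
move=> lf; pose F : {linear V -> V} := HB.pack f (GRing.isLinear.Build _ _ _ _ _ lf).
rewrite -[f]/(F : V -> V) /lc linear_sum; apply: eq_bigr => i _.
by rewrite linearZ.
Qed.

(** Coefficient families become row vectors, so that bases and complements can be taken from row
    spaces of matrices. *)
Lemma quotient_dimP A B n : quotient_dim A B n <-> exists e : 'I_n -> V,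
  [/\ forall k, A (e k), forall c, B (lc e c) -> c = 0
    & forall v, A v -> exists c, B (v - lc e c)].
Proof.
split=> -[e [Ae ind span]]; exists e; split=> //.
- move=> c Bc; apply/rowP => i; rewrite mxE; exact: ind (fun i => c 0 i) Bc i.
- move=> v /span[c Bc]; exists (\row_i c i).
  by rewrite /lc; under eq_bigr do rewrite mxE.
- move=> c Bc k; have E : \row_i c i = 0.
    by apply: ind; rewrite /lc; under eq_bigr do rewrite mxE.
  by have := congr1 (fun w : 'rV_n => w 0 k) E; rewrite !mxE.
- by move=> v /span[c Bc]; exists (fun i => c 0 i).
Qed.

(** Expanding one basis in the other modulo B gives a matrix without left kernel: a kernel vector
    would be a relation among the first basis modulo B. *)
Lemma quotient_dim_le A B n n' : lin_subspace B ->
  quotient_dim A B n -> quotient_dim A B n' -> (n <= n')%N.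
Proof.
move=> sB /quotient_dimP[e [Ae ind _]] /quotient_dimP[e' [_ _ span]].
have [M MP] := boolp.choice (fun k => span _ (Ae k)).
pose W := \matrix_k M k : 'M[C]_(n, n').
have rW : row_free W.
  apply/row_freeP; suff /eqP kW : kermx W == 0.
    have : row_free W by rewrite -kermx_eq0 kW.
    by move/row_freeP.
  apply/eqP/row_matrixP => k; rewrite row0; apply: ind.
  have -> : lc e (row k (kermx W)) =
      lc (fun k => e k - lc e' (M k)) (row k (kermx W)).
    have E : lc e' (row k (kermx W) *m W) = 0 by rewrite -row_mul mulmx_ker row0 lc0.
    rewrite lc_mul in E; rewrite -[LHS]subr0 -E /lc -sumrB; apply: eq_bigr => i _.
    by rewrite rowK scalerBr.
  exact: lin_subspace_lc.
by rewrite -(eqP rW) rank_leq_col.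
Qed.

Lemma quotient_dim_uniq A B n n' : lin_subspace B ->
  quotient_dim A B n -> quotient_dim A B n' -> n = n'.
Proof.
by move=> sB h h'; apply/eqP; rewrite eqn_leq (quotient_dim_le sB h h') (quotient_dim_le sB h' h).
Qed.

Lemma lin_subspace_image f X : linear f -> lin_subspace X -> lin_subspace (f @` X).
Proof.
move=> lf [X0 XL]; split.
  by exists 0 => //; exact: linear_fun0.
by move=> c _ _ [u Xu <-] [v Xv <-]; exists (c *: u + v); [exact: XL|rewrite lf].
Qed.

(** For the matrix W of f in the given bases, the kernel comes from [kermx W] and the cokernel from
    a complement of its row space. *)
Lemma rank_nullity X Y f p r : linear f -> lin_subspace X -> lin_subspace Y ->
  (forall x, X x -> Y (f x)) -> quotient_dim X [set 0] p -> quotient_dim Y [set 0] r ->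
  exists m n : nat, [/\ quotient_dim (X `&` [set v | f v = 0]) [set 0] m,
    quotient_dim Y (f @` X) n & (m + r = n + p)%N].
Proof.
move=> lf sX sY fXY /quotient_dimP[eX [XeX indX spanX]] /quotient_dimP[eY [YeY indY spanY]].
have spanX' v : X v -> exists c, v = lc eX c.
  by move=> /spanX[c /eqP]; rewrite subr_eq0 => /eqP; exists c.
have spanY' v : Y v -> exists c, v = lc eY c.
  by move=> /spanY[c /eqP]; rewrite subr_eq0 => /eqP; exists c.
have [M MP] := boolp.choice (fun k => spanY' _ (fXY _ (XeX k))).
pose W := \matrix_k M k : 'M[C]_(p, r).
have fW c : f (lc eX c) = lc eY (c *m W).
  rewrite linear_lc// lc_mul; congr lc; apply/funext => k.
  by rewrite MP rowK.
have lcX c c' : lc eX c = lc eX c' -> c = c'.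
  by move=> E; apply/eqP; rewrite -subr_eq0; apply/eqP/indX; rewrite lcB E subrr.
have lcY c c' : lc eY c = lc eY c' -> c = c'.
  by move=> E; apply/eqP; rewrite -subr_eq0; apply/eqP/indY; rewrite lcB E subrr.
exists (\rank (kermx W)), (\rank (W^C)%MS); split.
- apply/quotient_dimP; exists (fun k => lc eX (row k (row_base (kermx W)))); split.
  + move=> k; split; first exact: lin_subspace_lc.
    rewrite /= fW; have : (row k (row_base (kermx W)) <= kermx W)%MS.
      by apply: submx_trans (row_sub _ _) _; rewrite eq_row_base.
    by move/sub_kermxP => ->; rewrite lc0.
  + move=> c; rewrite -lc_mul => /indX => E.
    apply: (row_free_inj (row_base_free (kermx W))).
    by rewrite E mul0mx.
  + move=> v [/spanX'[c ->]] /=; rewrite fW => E.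
    have cW : c *m W = 0 by apply: lcY; rewrite lc0.
    have : (c <= row_base (kermx W))%MS by rewrite eq_row_base; apply/sub_kermxP.
    by move=> /submxP[d ->]; exists d; rewrite -lc_mul /= subrr.
- apply/quotient_dimP; exists (fun k => lc eY (row k (row_base (W^C)%MS))); split.
  + by move=> k; exact: lin_subspace_lc.
  + move=> c; rewrite -lc_mul => -[x /spanX'[d ->]]; rewrite fW => /lcY E.
    apply: (row_free_inj (row_base_free (W^C)%MS)); rewrite mul0mx -E.
    apply/eqP; rewrite -submx0 -(capmx_compl W) sub_capmx submxMl /=.
    by rewrite E; apply: submx_trans (submxMl _ _) _; rewrite eq_row_base.
  + move=> v /spanY'[c ->].
    have : (c <= W + W^C)%MS by apply: submx_full; exact: addsmx_compl_full.
    move=> /sub_addsmxP[[d1 d2] /= cE].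
    have : (d2 *m (W^C)%MS <= row_base (W^C)%MS)%MS by rewrite eq_row_base submxMl.
    move=> /submxP[d dE]; exists d; exists (lc eX d1); first exact: lin_subspace_lc.
    by rewrite -lc_mul -dE -lcB cE addrK fW.
- rewrite mxrank_ker mxrank_compl; have := rank_leq_row W; have := rank_leq_col W.
  by lia.
Qed.

(** Let X be the preimage of Y in A. The kernel of f lies in X, and since f(A) + Y = A the quotient
    A / f(A) is isomorphic to Y / f(X). The index is that of the restriction X -> Y. *)
Lemma fredholm_index_split A Y f p r : linear f -> lin_subspace A -> lin_subspace Y ->
  (forall v, A v -> A (f v)) -> Y `<=` A ->
  (forall v, A v -> exists2 a, A a & Y (v - f a)) ->
  quotient_dim [set x | A x /\ Y (f x)] [set 0] p -> quotient_dim Y [set 0] r ->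
  fredholm_index A f (p%:Z - r%:Z).
Proof.
move=> lf sA sY fA YA AY dX dY; set X := [set x | _] in dX.
have sX : lin_subspace X.
  split.
    by split; [case: sA|rewrite (linear_fun0 lf); case: sY].
  move=> c u v [Au Yu] [Av Yv]; split; first by case: sA => _; apply.
  by rewrite lf; case: sY => _; apply.
have [m [n [dk dc mn]]] := rank_nullity lf sX sY (fun x (h : X x) => h.2) dX dY.
split=> //; exists m, n; split.
- suff <- : X `&` [set v | f v = 0] = A `&` [set v | f v = 0] by [].
  apply/seteqP; split=> v [h /= fv0]; split=> //; first by case: h.
  by split=> //; rewrite fv0; case: sY.
- move/quotient_dimP: dc => [e [Ye ind span]]; apply/quotient_dimP; exists e; split.
  + by move=> k; exact/YA.
  + move=> c [a Aa fa]; apply: ind; exists a => //; split=> //.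
    by rewrite fa; exact: lin_subspace_lc.
  + move=> v /AY[a Aa Yv]; have [c [x [Ax Yx] fx]] := span _ Yv; exists c.
    exists (a + x); first exact: lin_subspaceD.
    have := lf 1 a x; rewrite !scale1r => ->; rewrite fx.
    by rewrite addrA; congr (_ - _); rewrite addrC subrK.
- by lia.
Qed.

(** The index is given through some m and n, so uniqueness of dimensions is needed to compare them
    with those of [rank_nullity]. *)
Lemma fredholm_index_finite A f p z : linear f -> lin_subspace A ->
  quotient_dim A [set 0] p -> fredholm_index A f z -> z = 0.
Proof.
move=> lf sA dA [fA [m [n [dk dc ->]]]].
have [m' [n' [dk' dc' mn]]] := rank_nullity lf sA sA fA dA dA.
rewrite (quotient_dim_uniq lin_subspace0 dk dk').
rewrite (quotient_dim_uniq (lin_subspace_image lf sA) dc dc').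
by lia.
Qed.

Section Cofinite.
Variables (P g h : V -> V).
Hypotheses (lP : linear P) (lg : linear g) (lh : linear h).
Hypotheses (PP : forall v, P (P v) = P v) (gh : cancel g h) (hg : cancel h g).

Let Q v := v - P v.

Let PE v : range P v <-> P v = v.
Proof. by split=> [[u _ <-]|Pv]; [exact: PP|exists v]. Qed.

Let QE v : range Q v <-> P v = 0.
Proof.
split=> [[u _ <-]|Pv]; first by rewrite /Q (linear_funB _ _ lP) PP subrr.
by exists v => //; rewrite /Q Pv subr0.
Qed.

(* Schur complement: the compressions of g to range P and of its inverse to
   range (1 - P) have isomorphic kernels and cokernels. *)
Lemma fredholm_index_cofinite p z : quotient_dim (range Q) [set 0] p ->
  fredholm_index (range P) (fun v => P (g (P v))) z -> z = 0.
Proof.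
move=> dQ [_ [m [n [dk dc ->]]]].
have PB u v : P (u - v) = P u - P v by exact: linear_funB.
have hB u v : h (u - v) = h u - h v by exact: linear_funB.
have lQ : linear Q by move=> c u v; rewrite /Q lP scalerBr opprD addrACA.
have QB u v : Q (u - v) = Q u - Q v by exact: linear_funB.
have sQ : lin_subspace (range Q).
  split; first exact/QE/(linear_fun0 lP).
  by move=> c u v /QE Pu /QE Pv; apply/QE; rewrite lP Pu Pv scaler0 addr0.
have lf : linear (fun v => Q (h (Q v))) by move=> c u v; rewrite lQ lh lQ.
apply: (@fredholm_index_finite (range Q) (fun v => Q (h (Q v))) p _ lf sQ dQ).
split; first by move=> v _; exists (h (Q v)).
exists m, n; split=> //.
(* Between the kernels the isomorphism is [g], with inverse [h]. *)
- move/quotient_dimP: dk => [e [Ae ind span]]; apply/quotient_dimP.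
  exists (fun k => g (e k)); split.
  + move=> k; have [/PE Pe /= Pge] := Ae k; rewrite Pe in Pge; split; first exact/QE.
    by rewrite /= {2}/Q Pge subr0 gh /Q Pe subrr.
  + move=> c /=; rewrite -linear_lc// => E; apply: ind.
    by rewrite /= -(gh (lc e c)) E (linear_fun0 lh).
  + move=> v [/QE Pv /=]; rewrite {2}/Q Pv subr0 /Q => /eqP; rewrite subr_eq0 => /eqP Phv.
    have [|c /eqP] := span (h v).
      by split; [exact/PE|rewrite /= -Phv hg].
    rewrite subr_eq0 => /eqP hv; exists c; rewrite /= -linear_lc// -hv hg subrr//.
(* Between the cokernels the isomorphism is induced by v |-> Q (h v). *)
- move/quotient_dimP: dc => [e [Ae ind span]]; apply/quotient_dimP.
  exists (fun k => Q (h (e k))); split.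
  + by move=> k; exists (h (e k)).
  + move=> c [b /QE Pb]; rewrite {2}/Q Pb subr0 => E.
    have Pe : P (lc e c) = lc e c.
      by rewrite linear_lc//; congr lc; apply/funext => k; exact/PE.
    have lQh : linear (fun v => Q (h v)) by move=> d u v; rewrite lh lQ.
    rewrite -(linear_lc e c lQh) in E; apply: ind.
    exists (P (h (lc e c - b))); first by exists (h (lc e c - b)).
    have Phw : P (h (lc e c - b)) = h (lc e c - b).
      have : Q (h (lc e c - b)) = 0.
        by rewrite hB QB E subrr.
      by move/eqP; rewrite subr_eq0 => /eqP.
    by rewrite PP Phw hg PB Pe Pb subr0.
  + move=> b /QE Pb; have [|c [_ [a' _ <-]]] := span (P (g b)); first by exists (g b).
    rewrite PP => E; exists c.
    have lQh : linear (fun v => Q (h v)) by move=> d u v; rewrite lh lQ.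
    rewrite -(linear_lc e c lQh).
    exists (Q (g b - g (P a'))); first by exists (g b - g (P a')).
    have QQ v : Q (Q v) = Q v by rewrite {1}/Q {2}/Q PB PP subrr subr0.
    have lcE : lc e c = P (g b) - P (g (P a')) by rewrite E opprB addrC subrK.
    set w := g b - g (P a').
    have QwE : Q w = w - lc e c by rewrite /Q /w PB -lcE.
    rewrite QQ QwE hB QB; congr (_ - _).
    by rewrite /w hB !gh QB {2}/Q PP subrr subr0 /Q Pb subr0.
Qed.

End Cofinite.

End FredholmAlgebra.

Section CoordinateBasis.
Context {R : realType} {V : lmodType R[i]}.

(** A dual family that separates the points of X replaces a spanning argument: a vector minus its
    expansion has all coordinates 0. *)
Lemma quotient_dim_coords (X : set V) (J : finType) (e : J -> V) (phi : J -> V -> R[i]) :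
  (forall j c u v, phi j (c *: u + v) = c * phi j u + phi j v) ->
  (forall j j', phi j (e j') = (j == j')%:R) -> lin_subspace X -> (forall j, X (e j)) ->
  (forall x, X x -> (forall j, phi j x = 0) -> x = 0) ->
  quotient_dim X [set 0] #|J|.
Proof.
move=> lphi phie sX Xe phi0; pose e' (k : 'I_#|J|) := e (enum_val k).
have phi00 j : phi j 0 = 0.
  by have := lphi j (-1) 0 0; rewrite scaler0 addr0 mulN1r addNr.
have phi_lc j c : phi j (lc e' c) = c 0 (enum_rank j).
  transitivity (\sum_i c 0 i * phi j (e' i)).
    rewrite /lc; elim/big_rec2: _ => [//|i a b _ <-].
    by rewrite lphi.
  rewrite (bigD1 (enum_rank j))//= phie enum_rankK eqxx mulr1 big1 ?addr0// => i ij.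
  rewrite phie; case: eqP => [ji|]; last by rewrite mulr0.
  by rewrite ji enum_valK eqxx in ij.
apply/quotient_dimP; exists e'; split.
- by move=> k; exact: Xe.
- move=> c /= c0; apply/rowP => i; have := phi_lc (enum_val i) c.
  by rewrite c0 phi00 enum_valK mxE.
- move=> v Xv; exists (\row_i phi (enum_val i) v); apply: phi0 => [|j].
    exact: (lin_subspaceB sX Xv (lin_subspace_lc _ sX (fun i => Xe _))).
  by rewrite addrC -scaleN1r lphi phi_lc mxE enum_rankK mulN1r addNr.
Qed.

End CoordinateBasis.

Section Amplification.
Context {R : realType} {k : nat}.
Local Notation H := (l2 R label).
Local Notation Hk := ('I_k -> H).
Implicit Types (g : 'M[H -> H]_k) (v : Hk) (P : H -> H).

Lemma amplify_linear P : linear P -> linear (amplify P : Hk -> Hk).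
Proof. by move=> lP c u v; apply/funext => r; rewrite /amplify lP. Qed.

Lemma mx_act_linear g : (forall r s, linear (g r s)) -> linear (mx_act g : Hk -> Hk).
Proof.
move=> lg c u v; apply/funext => r.
rewrite /mx_act -[RHS]/(c *: (\sum_s g r s (u s)) + \sum_s g r s (v s)).
rewrite scaler_sumr -big_split; apply: eq_bigr => s _.
exact: lg.
Qed.

End Amplification.

(** * Index of the compressed fundamental unitary *)

Section BlockIndex.
Context {R : realType}.
Variables (q : R) (hq : 0 < q < 1).
Local Notation H := (l2 R label).
Local Notation H2 := ('I_2 -> H).
Local Notation kk M t := ((Kc q M t)%:C).
Local Notation ll M t := ((Lc q M t)%:C).
Local Notation fst2 x := (x (ord0 : 'I_2)).
Local Notation snd2 x := (x (ord_max : 'I_2)).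
Implicit Types (x y v : H2) (a b t M : nat).

Lemma ord2P (r : 'I_2) : r = ord0 \/ r = ord_max.
Proof. by case: r => -[|[|//]] h; [left|right]; apply: val_inj. Qed.

(* chi marks the cells (a, b) in the negative spectral subspace: constant for
   a > k, and eventually constant along each row a <= k. *)
Variables (chi : nat -> nat -> bool) (k l : nat) (tau : bool) (rho : nat -> bool).
Hypothesis chiT : forall a b, (k < a)%N -> chi a b = tau.
Hypothesis chiS : forall a b, (a <= k)%N -> (l < b)%N -> chi a b = rho a.

Definition chiset : set label := [set x | chi (ca x) (cb x)].
Local Notation P := (amplify (cutoff chiset) : H2 -> H2).
Local Notation U := (mx_act (umx hq) : H2 -> H2).
Local Notation W := (mx_act (vmx hq) : H2 -> H2).

Lemma crd_cutoff (v : H) a b t :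
  crd (cutoff chiset v) a b t = if chi a b then crd v a b t else 0.
Proof.
rewrite /crd; case E: (lab a b t) => [x|]; last by rewrite if_same.
move/labP: E => [<- <- _]; rewrite cutoffE.
by have -> : (x \in chiset) = chi (ca x) (cb x) by apply/idP/idP; rewrite inE.
Qed.

(** Both terms of [xp] live in the cell (a, b), so P acts on Clebsch-Gordan coordinates by a factor
    depending on the cell only. *)
Lemma xp_P x a b t : xp q (P x) a b t = if chi a b then xp q x a b t else 0.
Proof. by rewrite /xp /amplify !crd_cutoff; case: ifP; rewrite ?mulr0 ?subrr. Qed.

Lemma xm_P x a b t : xm q (P x) a b t = if chi a b then xm q x a b t else 0.
Proof. by rewrite /xm /amplify !crd_cutoff; case: ifP; rewrite ?mulr0 ?addr0. Qed.

Lemma P_idem x : P (P x) = P x.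
Proof.
apply/funext => r; apply: crd_ext => a b t _.
by rewrite /amplify !crd_cutoff; case: (chi a b).
Qed.

Lemma rangeP x : range P x <->
  forall r a b t, ~~ chi a b -> crd (x r) a b t = 0.
Proof.
split=> [[y _ <-] r a b t /negbTE ab|x0]; first by rewrite /amplify crd_cutoff ab.
exists x => //; apply/funext => r; apply: crd_ext => a b t _.
by rewrite /amplify crd_cutoff; case: ifPn => // /x0 ->.
Qed.

Lemma range_fix x : range P x -> P x = x.
Proof. by move=> [y _ <-]; exact: P_idem. Qed.

Lemma P_linear : linear P.
Proof. by apply: amplify_linear; exact: cutoff_linear. Qed.

Lemma U_linear : linear U.
Proof.
apply: mx_act_linear => r s; have [/(_ r s) [[//]]] := umx_GL hq.
Qed.

Lemma same_next a b : (k < a)%N || (l < b)%N -> chi a b.+1 = chi a b.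
Proof.
have [ak /= _|ak /= lb] := ltnP k a; first by rewrite !chiT.
by rewrite !chiS// ltnS ltnW.
Qed.

Lemma same_next_up a b : (k.+1 < a)%N || (l < b)%N -> chi a.-1 b.+1 = chi a.-1 b.
Proof. by move=> h; apply: same_next; case: a h => [|a] //=; rewrite ltnS. Qed.

(** The outputs of the squares with lower corner in a <= k, b <= l: the first component sits at (a +
    1, b), the second at (a, b + 1). The cells on the axes, whose squares degenerate, are
    included. *)
Definition inY0 a b := (a <= k.+1)%N && (b <= l)%N.
Definition inY1 a b := (a <= k)%N && (b <= l.+1)%N.

(* A finite-dimensional space with P U P (range P) + Yspace = range P: the index of
   P U P is then dim (P U P)^-1 Yspace - dim Yspace. *)
Definition Yspace : set H2 := [set y | [/\ range P y,
  forall a b t, ~~ inY0 a b -> crd (fst2 y) a b t = 0 &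
  forall a b t, ~~ inY1 a b -> crd (snd2 y) a b t = 0]].

(** The first component at (a, b) shares its square with row a - 1, the second with row a + 1. If
    that row is cut off, going back by the inverse and forward by the unitary returns L^2 times the
    component, which the weight corrects. For a = 0 in [m0] the test falls on the cell itself. *)
Definition m0 a b : R := if chi a.-1 b then 1 else (Lc q (a + b).+1 b.+1 ^+ 2)^-1.
Definition m1 a b : R := if chi a.+1 b then 1 else (Lc q (a + b).+1 b ^+ 2)^-1.

(** L = 0 occurs in [m1] at b = 0, where 0^-1 = 0 keeps the weight bounded. *)
Lemma weight_le (c : bool) (L : R) : L = 0 \/ 1 - q <= L ->
  sqmod (if c then 1 else (L ^+ 2)^-1)%:C <= ((1 - q) ^- 2) ^+ 2.
Proof.
have [q0 q1] := andP hq; have d0 : 0 < 1 - q by rewrite subr_gt0.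
have d1 : 1 - q <= 1 by rewrite lerBlDr lerDl ltW.
rewrite sqmod_real => LP; rewrite lerXn2r ?nnegrE//.
- by case: c => //; rewrite invr_ge0 sqr_ge0.
- by rewrite invr_ge0 sqr_ge0.
case: c; first by rewrite invf_ge1 ?exprn_gt0// exprn_ile1// ltW.
case: LP => [->|Lq]; first by rewrite expr0n invr0 invr_ge0 sqr_ge0.
rewrite lef_pV2 ?posrE ?exprn_gt0//; last exact: lt_le_trans Lq.
by rewrite lerXn2r ?nnegrE ?(ltW d0)// (le_trans _ Lq)// ltW.
Qed.

Definition rescale v : H2 := fun r => mult (fun x : label =>
  (if r == ord0 then m0 (ca x) (cb x) else m1 (ca x) (cb x))%:C) (v r).

Lemma crd_rescale v r a b t : crd (rescale v r) a b t =
  (if r == ord0 then m0 a b else m1 a b)%:C * crd (v r) a b t.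
Proof.
rewrite /crd; case E: (lab a b t) => [x|]; last by rewrite mulr0.
rewrite /rescale (mult_coord (M := (1 - q) ^- 2)).
  by move/labP: E => [-> -> _].
move=> y; case: ifP => _; apply: weight_le.
  by right; apply: Lc_lbound => //; lia.
case: (cb y) => [|b']; first by left; exact: Lc0.
by right; apply: Lc_lbound => //; lia.
Qed.

Lemma crd_range0 v r a b t : range P v -> chi a b = false -> crd (v r) a b t = 0.
Proof. by move=> /rangeP vP ab; apply: vP; rewrite ab. Qed.

Lemma LcC_sqV M b : (0 < b)%N -> (b <= M)%N ->
  ll M b ^+ 2 * ((Lc q M b ^+ 2)^-1)%:C = 1.
Proof.
move=> b0 bM; rewrite -rmorphXn -rmorphM divff// expf_neq0// gt_eqF//.
by apply: Lc_gt0 => //; exact: leq_trans bM.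
Qed.

(** The preimage P W (rescale v) is exact outside the exceptional squares: K^2 + L^2 = 1 settles
    squares of constant sign, the rescaling those whose rows have different signs. *)
Lemma Yspace_cover v : range P v ->
  exists2 a, range P a & Yspace (v - P (U (P a))).
Proof.
move=> vP; pose z := rescale v; exists (P (W z)); first by exists (W z).
have crdB r a b t : crd ((v - P (U (P (P (W z))))) r) a b t =
    crd (v r) a b t - crd (P (U (P (P (W z)))) r) a b t.
  rewrite -[(v - _) r]/(v r - P (U (P (P (W z)))) r) -scaleN1r crdD crdZ.
  by rewrite mulN1r.
rewrite P_idem in crdB *; split.
- have sR : lin_subspace (range P).
    split; first by exists 0 => //; exact: linear_fun0 P_linear.
    by move=> c _ _ [u _ <-] [w _ <-]; exists (c *: u + w) => //; exact: P_linear.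
  by apply: lin_subspaceB => //; exists (U (P (W z))).
- move=> a b t off; rewrite crdB.
  have [tab|tab] := leqP t (a + b); last by rewrite !crd_out// subrr.
  rewrite /amplify crd_cutoff; have [ab|ab] := boolP (chi a b); last first.
    by rewrite (crd_range0 _ _ vP) ?subrr//; exact: negbTE.
  have reg : (k.+1 < a)%N || (l < b)%N by move: off; rewrite negb_and -!ltnNge.
  have ab1 : chi a b.+1 by rewrite same_next// orbC; case/orP: reg => [/ltnW -> |->]//; rewrite orbT.
  rewrite -/(amplify (cutoff chiset)) umx_fst// xp_P xm_P ab1 (xm_vmx hq); last by lia.
  have E := @KLsqrC _ _ hq (a + b).+1 b.+1 _ isT; have {}E := E (ltac:(lia)).
  case: a tab off ab reg ab1 E => [|a] tab off ab reg ab1 E.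
    rewrite /ym /= !add0n in E *; rewrite !KcnC in E *.
    rewrite crd_rescale /m0 /= ab mul1r.
    by apply: (lincomb1 (c := - crd (fst2 v) 0 b t) E); ring.
  rewrite /= (xp_vmx hq); last by lia.
  rewrite /yp /ym /= !crd_rescale /= /m0 /m1 /=.
  rewrite !addSn ?addnS in E *; set M := (a + b).+2 in E *.
  have LV := @LcC_sqV M b.+1 isT (ltac:(lia)).
  have [ab0|ab0] := boolP (chi a b).
    case: ifP => _.
      by apply: (lincomb1 (c := - crd (fst2 v) a.+1 b t) E); ring.
    by apply: (lincomb1 (c := - crd (fst2 v) a.+1 b t) E); ring.
  (* Row a is cut off: the other output of the square vanishes, and only the L^2 term with its
     weight remains. *)
  have ab01 : chi a b.+1 = false.
    by rewrite (same_next_up (a := a.+1))//; exact: negbTE.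
  rewrite (crd_range0 _ _ vP ab01).
  by apply: (lincomb1 (c := - crd (fst2 v) a.+1 b t) LV); ring.
- move=> a b t off; rewrite crdB.
  have [tab|tab] := leqP t (a + b); last by rewrite !crd_out// subrr.
  rewrite /amplify crd_cutoff; have [ab|ab] := boolP (chi a b); last first.
    by rewrite (crd_range0 _ _ vP) ?subrr//; exact: negbTE.
  have reg : (k < a)%N || (l.+1 < b)%N by move: off; rewrite negb_and -!ltnNge.
  rewrite -/(amplify (cutoff chiset)) umx_snd// xp_P xm_P.
  rewrite (xm_vmx hq); last by lia.
  have E := @KLsqrC _ _ hq (a + b).+1 b _ isT; have {}E := E (ltac:(lia)).
  case: b tab off ab reg E => [|b] tab off ab reg E.
    have ak : (k < a)%N by move: reg; rewrite orbF.
    have ab1 : chi a.+1 0 by rewrite chiT ?(leqW ak)// -(chiT 0 ak).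
    rewrite /ym ab1 !addn0 in E *; rewrite !Lc0C in E *.
    rewrite !crd_rescale /m1 /= ab1.
    by apply: (lincomb1 (c := - crd (snd2 v) a 0 t) E); ring.
  have ab1 : chi a b by rewrite -same_next//; case/orP: reg => [->//|]; rewrite ltnS => ->; rewrite orbT.
  rewrite ab1 (xp_vmx hq); last by lia.
  rewrite /yp /ym /= !crd_rescale /= /m0 /m1 /=.
  rewrite !addSn ?addnS in E *; set M := (a + b).+2 in E *.
  have LV := @LcC_sqV M b.+1 isT (ltac:(lia)).
  have [ab0|ab0] := boolP (chi a.+1 b.+1).
    case: ifP => _.
      by apply: (lincomb1 (c := - crd (snd2 v) a b.+1 t) E); ring.
    by apply: (lincomb1 (c := - crd (snd2 v) a b.+1 t) E); ring.
  have ab01 : chi a.+1 b = false.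
    apply/negbTE; apply: contra ab0; rewrite same_next//.
    by case/orP: reg => [/leqW ->//|]; rewrite ltnS => ->; rewrite orbT.
  rewrite (crd_range0 _ _ vP ab01).
  by apply: (lincomb1 (c := - crd (snd2 v) a b.+1 t) LV); ring.
Qed.

(** The inputs of the same squares: [xp] at the lower corner (a, b), [xm] at the upper corner (a +
    1, b + 1). *)
Definition inXp a b := (a <= k)%N && (b <= l)%N.
Definition inXm a b := (a <= k.+1)%N && (b <= l.+1)%N.

(** Outside the exceptional squares the compression is injective. Where both outputs vanish the
    rotation is inverted by [yp_umx] and [ym_umx]; where only one output survives, it is the single
    surviving input times a nonzero factor L. *)
Lemma Xspace_vanish x : range P x -> Yspace (P (U (P x))) ->
  (forall a b t, (t <= (a + b).+1)%N -> ~~ inXp a b -> xp q x a b t = 0) /\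
  (forall a b t, (0 < t <= a + b)%N -> ~~ inXm a b -> xm q x a b t = 0).
Proof.
move=> xP [_ Y0 Y1]; rewrite (range_fix xP) in Y0 Y1.
have U0 a b t : ~~ inY0 a b -> chi a b -> crd (fst2 (U x)) a b t = 0.
  by move=> off ab; have := Y0 _ _ t off; rewrite /amplify crd_cutoff ab.
have U1 a b t : ~~ inY1 a b -> chi a b -> crd (snd2 (U x)) a b t = 0.
  by move=> off ab; have := Y1 _ _ t off; rewrite /amplify crd_cutoff ab.
have xp0 a b t : chi a b = false -> xp q x a b t = 0.
  by move=> ab; rewrite /xp !(crd_range0 _ _ xP ab) !mulr0 subrr.
have xm0 a b t : chi a b = false -> xm q x a b t = 0.
  by move=> ab; rewrite /xm !(crd_range0 _ _ xP ab) !mulr0 addr0.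
have Lx M b (c : R[i]) : (0 < b)%N -> (0 < M)%N -> ll M b * c = 0 -> c = 0.
  move=> b0 M0 /eqP; rewrite mulf_eq0 => /orP[|/eqP//].
  by rewrite (inj_eq (@complexI R) _ 0) gt_eqF// Lc_gt0.
have vp a b t : (t <= (a + b).+1)%N -> ~~ inXp a b -> xp q x a b t = 0.
  move=> tab off; have [ab|/negbTE/xp0//] := boolP (chi a b).
  have reg : (k < a)%N || (l < b)%N by move: off; rewrite negb_and -!ltnNge.
  have ab1 : chi a b.+1 by rewrite same_next.
  have U1b : crd (snd2 (U x)) a b.+1 t = 0.
    by apply: U1 => //; rewrite negb_and -!ltnNge ltnS.
  rewrite -(yp_umx hq x tab) /yp U1b mulr0 subr0.
  have [a1b|a1b] := boolP (chi a.+1 b).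
    by rewrite U0 ?mulr0// negb_and -!ltnNge ltnS.
  (* The sign changes from row a to row a + 1, so a <= k and [reg] must hold through l < b. Then row
     a + 1 is unmarked at b + 1 too, and the second output is -L times [xp]. *)
  have lb : (l < b)%N.
    by case/orP: reg => // ka; move: a1b; rewrite chiT ?leqW// -(chiT b ka) ab.
  have a1b1 : chi a.+1 b.+1 = false by rewrite same_next ?lb ?orbT//; exact: negbTE.
  have := umx_snd hq x (_ : (t <= a + b.+1)%N); rewrite addnS => /(_ tab).
  rewrite U1b xm0// mulr0 addr0 /= => /esym/eqP; rewrite mulNr oppr_eq0 => /eqP/Lx xpE.
  have : yp q (U x) a b t = 0 by rewrite yp_umx// xpE.
  by rewrite /yp U1b mulr0 subr0.
split=> // a b t tab off; have [ab|/negbTE/xm0//] := boolP (chi a b).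
have reg : (k.+1 < a)%N || (l.+1 < b)%N by move: off; rewrite negb_and -!ltnNge.
case: t tab => [//|t] /= tab.
case: b tab ab off reg => [|b] tab ab off reg.
  have ka : (k.+1 < a)%N by move: reg; rewrite orbF.
  case: a ka ab tab off reg => [//|a] ka ab tab off reg.
  rewrite -(ym_umx hq x (_ : (0 < t.+1 <= a.+1 + 0)%N))// /ym Lc0C mul0r add0r /=.
  have -> : crd (snd2 (U x)) a 0 t = 0; last by rewrite mulr0.
  apply: U1; first by rewrite negb_and -!ltnNge -ltnS ka.
  by rewrite chiT// -(chiT 0 (ltnW ka)).
have ab' : chi a b by rewrite -same_next//; case/orP: reg => [/ltnW ->//|]; rewrite ltnS => ->; rewrite orbT.
have U0b : crd (fst2 (U x)) a b t = 0.
  by apply: U0 => //; rewrite negb_and -!ltnNge -(ltnS l).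
have ymE := ym_umx hq x (_ : (0 < t.+1 <= a + b.+1)%N).
case: a tab ab off reg ab' U0b ymE => [|a] tab ab off reg ab' U0b ymE.
  by rewrite -ymE// /ym /= U0b add0n KcnC !mulr0 mul0r addr0.
have [a'b|a'b] := boolP (chi a b.+1).
  by rewrite -ymE// /ym /= U0b mulr0 add0r U1 ?mulr0.
have lb : (l < b)%N.
  case/orP: reg => // ka; move: a'b; rewrite chiT; last by rewrite -ltnS.
  by rewrite -(chiT b.+1 (ltnW ka)) ab.
have ab0 : chi a b = false by rewrite -same_next ?lb ?orbT//; exact: negbTE.
have := umx_fst hq x (_ : (t <= a.+1 + b)%N).
rewrite U0b /= xp0// mulr0 add0r -ltnS -addnS => /(_ tab) /esym/Lx; exact.
Qed.

Lemma Xspace_intro x : range P x ->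
  (forall a b t, (t <= (a + b).+1)%N -> ~~ inXp a b -> xp q x a b t = 0) ->
  (forall a b t, (0 < t <= a + b)%N -> ~~ inXm a b -> xm q x a b t = 0) ->
  Yspace (P (U (P x))).
Proof.
move=> xP vp vm; rewrite (range_fix xP); split; first by exists (U x).
- move=> a b t off; have reg : (k.+1 < a)%N || (l < b)%N by move: off; rewrite negb_and -!ltnNge.
  rewrite /amplify crd_cutoff; case: ifP => // ab.
  have [tab|tab] := leqP t (a + b); last by rewrite crd_out.
  rewrite umx_fst// vm ?mulr0 ?addr0; last 2 first.
  + by lia.
  + by rewrite negb_and -!ltnNge ltnS.
  case: a tab off reg ab => [|a] tab off reg ab; first by rewrite add0n KcnC mul0r.
  by rewrite vp ?mulr0//= negb_and -!ltnNge.
- move=> a b t off; have reg : (k < a)%N || (l.+1 < b)%N by move: off; rewrite negb_and -!ltnNge.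
  rewrite /amplify crd_cutoff; case: ifP => // ab.
  have [tab|tab] := leqP t (a + b); last by rewrite crd_out.
  rewrite umx_snd// vm ?mulr0 ?addr0; last 2 first.
  + by lia.
  + by rewrite negb_and -!ltnNge ltnS.
  case: b tab off reg ab => [|b] tab off reg ab; first by rewrite Lc0C oppr0 mul0r.
  by rewrite vp ?mulr0//= -?addnS// negb_and -!ltnNge.
Qed.

Definition dlt a b t : H := if lab a b t is Some x then delta x else 0.

Lemma crd_dlt a b t a' b' t' : (t <= a + b)%N ->
  crd (dlt a b t) a' b' t' = ((a == a') && (b == b') && (t == t'))%:R.
Proof.
move=> /lab_ex[x xE]; rewrite /crd /dlt xE; case E: (lab a' b' t') => [y|].
  rewrite deltaE; congr (_%:R); congr nat_of_bool.
  move/labP: xE => [<- <- <-]; move/labP: E => [<- <- <-].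
  apply/eqP/idP => [->|]; first by rewrite !eqxx.
  by move=> /andP[/andP[/eqP ha /eqP hb] /eqP ht]; apply: coords_inj.
case: andP => // -[/andP[/eqP ha /eqP hb] /eqP ht].
by rewrite ha hb ht E in xE.
Qed.

(** In the relevant cells t <= a + b <= k + l + 2. *)
Definition box := ('I_2 * 'I_k.+2 * 'I_l.+2 * 'I_(k + l).+3)%type.

Definition predY (j : box) : bool :=
  let: (r, a, b, t) := j in
  [&& (t <= a + b)%N, chi a b & if r == ord0 then inY0 a b else inY1 a b].

(** In the cells with a = k + 1 or b = l + 1 only the [xm] summand is free; its a + b dimensions are
    indexed by the second component at t < a + b. *)
Definition predX (j : box) : bool :=
  let: (r, a, b, t) := j in
  [&& (t <= a + b)%N, chi a b & inXp a b || (r != ord0) && (t < a + b)%N].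

Definition slot (r : 'I_2) (v : H) : H2 := fun r' => if r' == r then v else 0.

Lemma crd0 a b t : crd (0 : H) a b t = 0.
Proof. by rewrite /crd; case: lab. Qed.

Lemma crd_slot (r : 'I_2) (v : H) r' a b t :
  crd (slot r v r') a b t = if r' == r then crd v a b t else 0.
Proof. by rewrite /slot; case: ifP; rewrite ?crd0. Qed.

Definition coordf (j : box) (x : H2) : R[i] :=
  let: (r, a, b, t) := j in crd (x r) a b t.

Lemma coordf_linear j c x y : coordf j (c *: x + y) = c * coordf j x + coordf j y.
Proof.
case: j => [[[r a] b] t]; rewrite /coordf -[(c *: x + y) r]/(c *: x r + y r).
by rewrite crdD crdZ.
Qed.

Definition basisY (j : box) : H2 := let: (r, a, b, t) := j in slot r (dlt a b t).

(** Off [inXp] the first component is chosen so that [xp] cancels at t + 1; the denominator is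
    nonzero because t < a + b. *)
Definition basisX (j : box) : H2 :=
  let: (r, a, b, t) := j in
  if inXp a b then slot r (dlt a b t)
  else fun r' => if r' == ord0
    then (ll (a + b).+1 t.+1 / kk (a + b).+1 t.+1) *: dlt a b t.+1 else dlt a b t.

Lemma Yspace_subspace : lin_subspace Yspace.
Proof.
split.
  split; [by apply/rangeP => r a b t _; rewrite crd0| |]; by move=> *; rewrite crd0.
move=> c u v [/rangeP uP u0 u1] [/rangeP vP v0 v1].
have E r a b t : crd ((c *: u + v) r) a b t = c * crd (u r) a b t + crd (v r) a b t.
  by rewrite -[(c *: u + v) r]/(c *: u r + v r) crdD crdZ.
split; [apply/rangeP => r a b t ab|move=> a b t ab|move=> a b t ab]; rewrite E.
+ by rewrite uP// vP// mulr0 addr0.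
+ by rewrite u0// v0// mulr0 addr0.
+ by rewrite u1// v1// mulr0 addr0.
Qed.

Lemma quotient_dimY : quotient_dim Yspace [set 0] #|{: {j | predY j}}|.
Proof.
apply: (@quotient_dim_coords _ _ _ _ (fun j => basisY (val j)) (fun j => coordf (val j))).
- by move=> j c u v; exact: coordf_linear.
- move=> j j'; rewrite -(inj_eq val_inj); have := valP j'.
  case: (val j) => [[[r a] b] t]; case: (val j') => [[[r' a'] b'] t'] /and3P[tab' _ _].
  rewrite /coordf /basisY crd_slot !xpair_eqE crd_dlt//.
  case: (r == r') => //=.
  by rewrite [_ == a :> nat]eq_sym [_ == b :> nat]eq_sym [_ == t :> nat]eq_sym.
- exact: Yspace_subspace.
- move=> [[[[r a] b] t] /= /and3P[tab ab reg]] /=.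
  have z r' a' b' t' : ~~ ((r' == r) && (a' == a :> nat) && (b' == b :> nat)) ->
      crd (slot r (dlt a b t) r') a' b' t' = 0.
    rewrite crd_slot; case: eqP => //= _; rewrite crd_dlt// [a == _ :> nat]eq_sym [b == _ :> nat]eq_sym.
    by move=> /negbTE ->.
  split; [apply/rangeP => r' a' b' t' ab'|move=> a' b' t' off|move=> a' b' t' off]; apply: z.
  + by apply: contra ab' => /andP[/andP[_ /eqP ->] /eqP ->].
  + by apply: contra off => /andP[/andP[/eqP rr /eqP ->] /eqP ->]; rewrite -rr in reg.
  + by apply: contra off => /andP[/andP[/eqP rr /eqP ->] /eqP ->]; rewrite -rr in reg.
- move=> x [/rangeP xP x0 x1] xz; apply/funext => r; apply: crd_ext => a b t tab.
  rewrite crd0; have [ab|/xP//] := boolP (chi a b).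
  have [reg|off] := boolP (if r == ord0 then inY0 a b else inY1 a b); last first.
    by move: off; case: (ord2P r) => -> /= off; [exact: x0|exact: x1].
  have [ak bl] : (a < k.+2)%N /\ (b < l.+2)%N.
    by move: reg; rewrite /inY0 /inY1; case: ifP => _ /andP[] *; split; lia.
  have tkl : (t < (k + l).+3)%N by lia.
  pose j : box := (r, Ordinal ak, Ordinal bl, Ordinal tkl).
  have pj : predY j by rewrite /predY /j /= tab ab reg.
  exact: (xz (exist _ j pj)).
Qed.

Lemma range_subspace : lin_subspace (range P).
Proof.
split; first by exists 0 => //; exact: linear_fun0 P_linear.
by move=> c _ _ [u _ <-] [w _ <-]; exists (c *: u + w) => //; exact: P_linear.
Qed.

Lemma compression_linear : linear (fun v => P (U (P v))).
Proof. by move=> c u v; rewrite P_linear U_linear P_linear. Qed.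

Definition Xspace : set H2 := [set x | range P x /\ Yspace (P (U (P x)))].

Lemma Xspace_subspace : lin_subspace Xspace.
Proof.
have [R0 RL] := range_subspace; have [Y0 YL] := Yspace_subspace; split.
  by split=> //; rewrite (linear_fun0 compression_linear).
move=> c u v [uR uY] [vR vY]; split; first exact: RL.
by rewrite compression_linear; exact: YL.
Qed.

Lemma quotient_dimX : quotient_dim Xspace [set 0] #|{: {j | predX j}}|.
Proof.
apply: (@quotient_dim_coords _ _ _ _ (fun j => basisX (val j)) (fun j => coordf (val j))).
- by move=> j c u v; exact: coordf_linear.
- move=> j j'; rewrite -(inj_eq val_inj); have := valP j; have := valP j'.
  case: (val j) => [[[r a] b] t]; case: (val j') => [[[r' a'] b'] t'].
  move=> /and3P[tab' _ reg'] /and3P[tab _ reg].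
  rewrite /coordf /basisX !xpair_eqE.
  case: ifP reg' => /= [_ _|inX' /andP[r'0 t'lt]].
    rewrite crd_slot crd_dlt//; case: (r == r') => //=.
    by rewrite [_ == a :> nat]eq_sym [_ == b :> nat]eq_sym [_ == t :> nat]eq_sym.
  have r'1 : r' = ord_max by case: (ord2P r') r'0 => ->.
  rewrite r'1; have [r0|r1] := ord2P r.
    rewrite r0 /= in reg *; rewrite crdZ crd_dlt//.
    have ab : (a' == a :> nat) && (b' == b :> nat) = false.
      apply/negP => /andP[/eqP ha /eqP hb]; move: reg; rewrite orbF.
      by rewrite /inXp -ha -hb -/(inXp _ _) inX'.
    by rewrite ab mulr0.
  rewrite r1 /= crd_dlt//.
  by rewrite [_ == a :> nat]eq_sym [_ == b :> nat]eq_sym [_ == t :> nat]eq_sym.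
- exact: Xspace_subspace.
- move=> j; have := valP j; case: (val j) => [[[r a] b] t] /and3P[tab ab reg].
  have bz r' a' b' t' : ~~ ((a' == a :> nat) && (b' == b :> nat)) ->
      crd (basisX (r, a, b, t) r') a' b' t' = 0.
    rewrite [a' == _ :> nat]eq_sym [b' == _ :> nat]eq_sym => /negbTE ne.
    rewrite /basisX; case: ifP reg => /= [_ _|_ /andP[_ t1]].
      by rewrite crd_slot crd_dlt// ne if_same.
    by case: ifP => _; rewrite ?crdZ crd_dlt// ne ?mulr0.
  have bR : range P (basisX (r, a, b, t)).
    apply/rangeP => r' a' b' t' ab'; apply: bz; apply: contra ab' => /andP[/eqP -> /eqP ->].
    exact: ab.
  split=> //; apply: Xspace_intro => // a' b' t' tab' off.
    have [/andP[/eqP aE /eqP bE]|ne] := boolP ((a' == a :> nat) && (b' == b :> nat)); last first.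
      by rewrite /xp !bz// !mulr0 subrr.
    subst a' b'; move: reg; rewrite /xp /basisX (negbTE off) /= => /andP[_ t1].
    rewrite crdZ !crd_dlt// !eqxx /=.
    case: t' tab' => [|t'] tab' /=; first by rewrite Lc0C mul0r mulr0 mulr0 subrr.
    rewrite eqSS; case: eqP => [<-|_]; last by rewrite !mulr0 subrr.
    have K0 : kk (a + b).+1 t.+1 != 0.
      by rewrite (inj_eq (@complexI R) _ 0) gt_eqF// Kc_gt0.
    by rewrite !mulr1 mulrC divfK// subrr.
  have ne : ~~ ((a' == a :> nat) && (b' == b :> nat)).
    apply: contra off => /andP[/eqP -> /eqP ->].
    by apply/andP; split; [exact: (ltn_ord a)|exact: (ltn_ord b)].
  by rewrite /xm !bz// !mulr0 addr0.
- move=> x [xR xY] xz; have [vp vm] := Xspace_vanish xR xY.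
  have xj r a b t : (t <= a + b)%N -> (a <= k.+1)%N -> (b <= l.+1)%N ->
      inXp a b || (r != ord0) && (t < a + b)%N -> crd (x r) a b t = 0.
    move=> tab ak bl reg; have [ab|ab] := boolP (chi a b); last first.
      by rewrite (crd_range0 _ _ xR)//; exact: negbTE.
    have tkl : (t < (k + l).+3)%N by lia.
    pose j : box := (r, Ordinal (ak : (a < k.+2)%N), Ordinal (bl : (b < l.+2)%N), Ordinal tkl).
    have pj : predX j by rewrite /predX /j /= tab ab reg.
    exact: (xz (exist _ j pj)).
  have out r a b t : (t <= a + b)%N -> ~~ inXm a b -> crd (x r) a b t = 0.
    move=> tab off; have off' : ~~ inXp a b.
      by apply: contra off => /andP[ak bl]; rewrite /inXm !leqW.
    have [->|->] := ord2P r.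
      rewrite (crd_pm_fst hq)// vp//; last exact: leqW.
      case: t tab => [|t] tab; first by rewrite Lc0C mul0r mulr0 addr0.
      by rewrite vm// !mulr0 addr0.
    rewrite (crd_pm_snd hq)// vp//; move: tab; rewrite leq_eqVlt => /predU1P[->|tab].
      by rewrite KcnC mul0r mulr0 addr0.
    by rewrite vm// !mulr0 addr0.
  apply/funext => r; apply: crd_ext => a b t tab; rewrite crd0.
  have [/andP[ak bl]|off] := boolP (inXm a b); last exact: out.
  have [inX|notX] := boolP (inXp a b); first by apply: xj => //; rewrite inX.
  (* For s < a + b this is a chosen coordinate; at s = a + b the [xm] term has coefficient [Kc M M]
     = 0 and [xp] is already known to vanish. *)
  have x1 s : (s <= a + b)%N -> crd (snd2 x) a b s = 0.
    rewrite leq_eqVlt => /predU1P[->|sab].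
      by rewrite (crd_pm_snd hq)// vp// KcnC mul0r mulr0 addr0.
    by apply: xj => //; [exact: ltnW|rewrite sab orbT].
  have [->|->] := ord2P r; last exact: x1.
  case: t tab => [|t] tab.
    by rewrite (crd_pm_fst hq)// vp// Lc0C mul0r mulr0 addr0.
  have := vp a b t.+1 (leqW tab) notX; rewrite /xp /= (x1 t (ltnW tab)) mulr0 subr0.
  move/eqP; rewrite mulf_eq0 => /orP[|/eqP//].
  by rewrite (inj_eq (@complexI R) _ 0) gt_eqF// Kc_gt0.
Qed.

Lemma sum_ltn (N n : nat) : (n <= N)%N -> (\sum_(t < N) (t < n : nat) = n)%N.
Proof.
move=> nN; suff -> : (\sum_(t < N) (t < n : nat) = minn N n)%N by lia.
elim: N {nN} => [|N IH]; first by rewrite big_ord0 min0n.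
by rewrite big_ord_recr /= IH; case: ltnP; lia.
Qed.

Lemma sum_cellY (a : 'I_k.+2) (b : 'I_l.+2) :
  (\sum_(t < (k + l).+3) (predY (ord0, a, b, t) + predY (ord_max, a, b, t)) =
   chi a b * ((inY0 a b + inY1 a b) * (a + b).+1))%N.
Proof.
have ab : ((a + b).+1 <= (k + l).+3)%N by have := ltn_ord a; have := ltn_ord b; lia.
rewrite -(sum_ltn ab) !big_distrr /=; apply: eq_bigr => t _; rewrite /predY /= ltnS.
by case: (t <= a + b)%N; case: (chi a b); rewrite ?mul1n ?mul0n ?muln1 ?muln0.
Qed.

Lemma sum_cellX (a : 'I_k.+2) (b : 'I_l.+2) :
  (\sum_(t < (k + l).+3) (predX (ord0, a, b, t) + predX (ord_max, a, b, t)) =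
   chi a b * (if inXp a b then (a + b).+1 + (a + b).+1 else a + b))%N.
Proof.
have ab : ((a + b).+1 <= (k + l).+3)%N by have := ltn_ord a; have := ltn_ord b; lia.
transitivity (\sum_(t < (k + l).+3) chi a b * (if inXp a b
    then (t < (a + b).+1) + (t < (a + b).+1) else (t < a + b)%N))%N.
  apply: eq_bigr => t _; rewrite /predX /= ltnS.
  case: (chi a b); rewrite ?andbF ?mul0n// mul1n.
  case: (inXp a b); rewrite ?andbT//=.
  by case: ltngtP => // _; rewrite andbF.
rewrite -big_distrr /=; congr (_ * _)%N; case: ifP => _.
  by rewrite big_split /= !sum_ltn.
by rewrite sum_ltn// ltnW.
Qed.

(** In a marked cell the dimensions of X and Y agree inside the box, X has one less on exactly one
    of the sides a = k + 1, b = l + 1, and a + b more at their common corner. *)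
Definition edge (a b : nat) : bool := (a == k.+1) (+) (b == l.+1).
Definition corner (a b : nat) : bool := (a == k.+1) && (b == l.+1).

Lemma cell_balance (a b : nat) : (a < k.+2)%N -> (b < l.+2)%N ->
  ((if inXp a b then (a + b).+1 + (a + b).+1 else a + b) + edge a b =
   (inY0 a b + inY1 a b) * (a + b).+1 + corner a b * (a + b))%N.
Proof.
rewrite !ltnS /edge /corner /inXp /inY0 /inY1 => ak bl.
have -> : (a <= k)%N = (a != k.+1) by rewrite -ltnS ltn_neqAle ak andbT.
have -> : (b <= l)%N = (b != l.+1) by rewrite -ltnS ltn_neqAle bl andbT.
by rewrite ak bl /= andbT; case: eqP => _; case: eqP => _ /=; lia.
Qed.

Lemma card_pred (p : pred box) : #|{: {j | p j}}| =
  (\sum_(a < k.+2) \sum_(b < l.+2) \sum_(t < (k + l).+3)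
    (p (ord0, a, b, t) + p (ord_max, a, b, t)))%N.
Proof.
rewrite card_sig -sum1_card big_mkcond /=.
transitivity (\sum_(r < 2) \sum_(a < k.+2) \sum_(b < l.+2) \sum_(t < (k + l).+3) p (r, a, b, t))%N.
  rewrite pair_bigA pair_bigA pair_bigA; apply: eq_bigr => -[[[r a] b] t] _ /=.
  by rewrite unfold_in /=; case: (p _).
rewrite big_ord_recr big_ord_recr big_ord0 /= add0n -big_split.
apply: eq_bigr => a _; rewrite -big_split; apply: eq_bigr => b _.
rewrite -big_split; apply: eq_bigr => t _ /=.
by congr (p (_, _, _, _) + p (_, _, _, _))%N; apply: val_inj.
Qed.

(** Equivalently, dim X - dim Y is the sum of tau - rho a over a <= k: all nonzero terms have the
    same sign, so one row of deviating sign makes the index nonzero. *)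
Lemma card_balance :
  (#|{: {j | predX j}}| + (\sum_(a < k.+1) rho a + l.+1 * tau) =
   #|{: {j | predY j}}| + tau * (k.+1 + l.+1))%N.
Proof.
have row (a : nat) : (\sum_(b < l.+2) chi a b * edge a b =
    if a == k.+1 then l.+1 * tau else chi a l.+1)%N.
  rewrite big_ord_recr /= /edge eqxx; case: eqP => [->|_] /=.
    rewrite muln0 addn0 (eq_bigr (fun=> tau : nat)).
      by rewrite sum_nat_const card_ord.
    by move=> b _; rewrite chiT// (ltn_eqF (ltn_ord b)) muln1.
  rewrite muln1 big1// => b _.
  by rewrite (ltn_eqF (ltn_ord b)) muln0.
have E : (\sum_(a < k.+1) rho a + l.+1 * tau =
    \sum_(a < k.+2) \sum_(b < l.+2) chi a b * edge a b)%N.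
  rewrite [RHS]big_ord_recr /= row eqxx; congr (_ + _)%N.
  apply: eq_bigr => a _; rewrite row (ltn_eqF (ltn_ord a)) chiS//.
  by rewrite -ltnS.
have C : (tau * (k.+1 + l.+1) =
    \sum_(a < k.+2) \sum_(b < l.+2) chi a b * (corner a b * (a + b)))%N.
  rewrite big_ord_recr /= big1 ?add0n => [|a _]; last first.
    by rewrite big1// => b _; rewrite /corner (ltn_eqF (ltn_ord a)) mul0n muln0.
  rewrite big_ord_recr /= big1 ?add0n => [|b _]; last first.
    by rewrite /corner (ltn_eqF (ltn_ord b)) andbF mul0n muln0.
  by rewrite /corner !eqxx mul1n chiT.
rewrite E C !card_pred -!big_split; apply: eq_bigr => a _ /=.
rewrite -!big_split; apply: eq_bigr => b _ /=.
rewrite sum_cellX sum_cellY -!mulnDr; congr (_ * _)%N.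
exact: cell_balance.
Qed.

Lemma fredholm_index_blocks (a0 : nat) : (a0 <= k)%N -> rho a0 != tau ->
  exists2 z : int, z != 0 & fredholm_index (range P) (fun v => P (U (P v))) z.
Proof.
move=> a0k a0tau.
exists (#|{: {j | predX j}}|%:Z - #|{: {j | predY j}}|%:Z); last first.
  apply: fredholm_index_split.
  - exact: compression_linear.
  - exact: range_subspace.
  - exact: Yspace_subspace.
  - by move=> v _; exists (U (P v)).
  - by move=> y [].
  - exact: Yspace_cover.
  - exact: quotient_dimX.
  - exact: quotient_dimY.
rewrite subr_eq0; apply/eqP => -[E]; have := card_balance.
rewrite E => /addnI; rewrite (bigD1 (Ordinal (a0k : (a0 < k.+1)%N)))//=.
case: tau a0tau => /= a0tau; last first.
  by rewrite muln0 mul0n addn0; case: (rho a0) a0tau.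
have -> : rho a0 = false by case: (rho a0) a0tau.
rewrite muln1 mul1n add0n => /eqP; rewrite eqn_add2r => /eqP.
(* The balance would require all k + 1 rows to be marked, but row a0 is not and the others
   contribute at most k. *)
have : (\sum_(i < k.+1 | i != Ordinal (a0k : (a0 < k.+1)%N)) rho i <=
        \sum_(i < k.+1 | i != Ordinal (a0k : (a0 < k.+1)%N)) 1)%N.
  by apply: leq_sum => i _; case: (rho i).
rewrite sum1dep_card => le1 E1; move: le1; rewrite E1.
have := cardC1 (Ordinal (a0k : (a0 < k.+1)%N)); rewrite card_ord /=.
rewrite (_ : #|predC1 _| = #|[set i : 'I_k.+1 | i != Ordinal (a0k : (a0 < k.+1)%N)]%SET|).
  by move=> ->; rewrite ltnn.
by rewrite cardsE.
Qed.

End BlockIndex.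

(** * Equivariance *)

Section Equivariance.
Context {R : realType}.
Local Notation H := (l2 R label).
Implicit Types (v w : H) (x y : label) (d : R -> R -> R).

Definition dab d (a b : nat) : R := d ((b%:R + a%:R) / 2) ((b%:R - a%:R) / 2).

Definition evd d x : R := d (n_of x) (i_of x).

Lemma evdE d x : evd d x = dab d (ca x) (cb x).
Proof.
rewrite /evd /dab n_ofE i_ofE natrD addrC; congr d.
by field.
Qed.

Lemma diagE d : diag d = mdiag (evd d).
Proof. by []. Qed.

Lemma finite_supp_seq v : finite_supp v ->
  exists2 r : seq label, uniq r & forall x, (v x != 0) = (x \in r).
Proof.
move=> /finite_seqP[r rE]; exists (undup r) => [|x]; first exact: undup_uniq.
rewrite mem_undup; apply/idP/idP => h.
  by have : [set` r] x by rewrite -rE.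
by have : [set x | v x != 0] x by rewrite rE.
Qed.

Lemma lin_ext_seq (f : label -> H) v (r : seq label) : uniq r ->
  (forall x, v x != 0 -> x \in r) -> lin_ext f (v, \sum_(x <- r) v x *: f x).
Proof.
move=> ur vr; pose r' := [seq x <- r | v x != 0].
have rE : [set x | v x != 0] = [set` r'].
  apply/seteqP; split=> x /=; rewrite mem_filter; first by move=> h; rewrite h vr.
  by case/andP.
split=> /=; first by rewrite /finite_supp rE; exact: finite_seq.
rewrite rE -fsbig_seq ?filter_uniq// big_filter [RHS]big_mkcond.
by apply: eq_bigr => x _; case: eqP => // ->; rewrite scale0r.
Qed.

Lemma lin_ext_inv (f : label -> H) v w : lin_ext f (v, w) ->
  exists r : seq label, [/\ uniq r, (forall x, x \notin r -> v x = 0) &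
    w = \sum_(x <- r) v x *: f x].
Proof.
move=> [/= /finite_supp_seq[r ur rE] ->]; exists r; split=> //.
  by move=> x; rewrite -rE negbK => /eqP.
have -> : [set x | v x != 0] = [set` r] by apply/seteqP; split=> x /=; rewrite rE.
by rewrite -fsbig_seq.
Qed.

(** The operators to be tested change only j, on which the eigenvalue does not depend, so they send
    a basis vector to an eigenvector of the same eigenvalue. *)
Lemma commute_on_span_eigen (ev : label -> R) (f : label -> H) (S : set (H * H)) :
  (forall x, mdiag ev (f x, (ev x)%:C *: f x)) ->
  (forall v (r : seq label), uniq r -> (forall x, v x != 0 -> x \in r) ->
    S (v, \sum_(x <- r) v x *: f x)) ->
  commute_on_span (mdiag ev) S.
Proof.
move=> fev SP v /finite_supp_seq[r ur vr].
pose Dv : H := \sum_(x <- r) ((ev x)%:C * v x) *: delta x.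
have DvE x : Dv x = (ev x)%:C * v x.
  rewrite /Dv l2_sum; under eq_bigr do rewrite l2_scale deltaE.
  have [xr|xr] := boolP (x \in r).
    rewrite (bigD1_seq x)//= eqxx mulr1 big1 ?addr0// => y /negbTE yx.
    by rewrite eq_sym yx mulr0.
  have -> : v x = 0 by apply/eqP; move: xr; rewrite -vr negbK.
  rewrite mulr0 big_seq big1// => y yr; case: eqP => [xy|_]; last by rewrite mulr0.
  by rewrite xy yr in xr.
exists Dv, (\sum_(x <- r) v x *: f x), (\sum_(x <- r) Dv x *: f x); split.
- exact/mdiagP.
- by apply: SP => // x; rewrite vr.
- apply/mdiagP => y; rewrite !l2_sum mulr_sumr; apply: eq_bigr => x _.
  have /mdiagP/(_ y) := fev x; rewrite !l2_scale DvE => E.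
  by rewrite mulrCA -E mulrA [v x * _]mulrC.
- apply: SP => // x; rewrite DvE -vr; apply: contraNN => /eqP ->.
  by rewrite mulr0.
Qed.

Variable q : R.

Lemma ebasis_label x : ebasis (n_of x) (i_of x) (j_of x) = delta x :> H.
Proof.
apply: l2P => y; rewrite deltaE -[ebasis _ _ _ y]/(e_fun _ _ _ y).
rewrite (@e_fun_in _ _ _ _ (sval x).1.1 (sval x).1.2 (sval x).2); last 3 first.
- by rewrite /n_of mulrC divfK// pnatr_eq0.
- by rewrite /i_of addrC subrK.
- by rewrite /j_of addrC subrK.
by congr (_%:R); congr nat_of_bool; rewrite -(inj_eq val_inj) /= -!surjective_pairing.
Qed.

Definition up x := lmove 0 0 0 0 0 1 x.
Definition down x := lmove 0 0 1 0 0 0 x.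
Definition odelta (o : option label) : H := if o is Some y then delta y else 0.

Lemma odeltaE o y : odelta o y = (o == Some y)%:R.
Proof. by case: o => [z|]; rewrite /odelta ?deltaE ?l2_zero// eq_sym. Qed.

Lemma upP x y : up x = Some y <-> down y = Some x.
Proof. exact: lmove_sym. Qed.

Lemma evd_up d x y : up x = Some y -> evd d y = evd d x.
Proof. by move=> /lmoveP[]; rewrite !addn0 !evdE => -> ->. Qed.

Lemma ebasis_up x : ebasis (n_of x) (i_of x) (j_of x + 1) = odelta (up x) :> H.
Proof.
apply: l2P => y; rewrite odeltaE -[ebasis _ _ _ y]/(e_fun _ _ _ y).
rewrite (@e_fun_in _ _ _ _ (sval x).1.1 (sval x).1.2 (sval x).2.+1); last 3 first.
- by rewrite /n_of mulrC divfK// pnatr_eq0.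
- by rewrite /i_of addrC subrK.
- by rewrite /j_of -[_.+1%:R]natr1; ring.
congr (_%:R); congr nat_of_bool.
have xP := cab x; have yP := cab y.
apply/eqP/eqP => [E|/lmoveP[]].
  by apply/lmoveP; rewrite /ca /cb /ct E /=; split; lia.
rewrite /ct; move: xP yP; rewrite /ca /cb.
by case: (sval y) => [[m' s'] t'] /= => *; congr (_, _, _); lia.
Qed.

Definition a1c x : R := a1_coef q (n_of x) (j_of x).

Lemma A1E : A1 q = lin_ext (fun x => (a1c x)%:C *: odelta (up x)).
Proof. by rewrite /A1; congr lin_ext; apply/funext => x; rewrite ebasis_up. Qed.

(** The adjoint of [A1] on a basis vector. *)
Definition lower y : H := if down y is Some x then (a1c x)%:C *: delta x else 0.

Lemma lowerE y x : lower y x = (a1c x)%:C * (up x == Some y)%:R.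
Proof.
rewrite /lower; case E: (down y) => [z|]; last first.
  case: eqP => [/upP|_]; first by rewrite E.
  by rewrite mulr0.
rewrite l2_scale deltaE; move/upP: E => E.
have [->|xz] := eqVneq x z; first by rewrite E eqxx.
case: eqP => [|_]; last by rewrite !mulr0.
move=> /upP; move/upP: E => -> [zx].
by rewrite zx eqxx in xz.
Qed.

Lemma adjoint_A1 v (r : seq label) : uniq r -> (forall x, v x != 0 -> x \in r) ->
  adjoint (A1 q) (v, \sum_(x <- r) v x *: lower x).
Proof.
move=> ur vr v' Av'; rewrite A1E => /lin_ext_inv[r' [ur' v'r' ->]] /=.
have {2}-> : v' = \sum_(x <- r') v' x *: delta x.
  by rewrite -cutoff_sum// cutoff_id// => x /= /negP/v'r'.
rewrite !ip_suml; apply: eq_bigr => x _; rewrite !ipZl; congr (_ * _).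
rewrite ip_delta l2_sum.
under eq_bigr do rewrite l2_scale lowerE.
case E: (up x) => [y|] /=; last first.
  by rewrite ip0l mulr0 big1 ?rmorph0// => z _; rewrite !mulr0.
rewrite ip_delta; have [yr|yr] := boolP (y \in r).
  rewrite (bigD1_seq y)//= eqxx mulr1 big1 ?addr0 => [|z zy].
    by rewrite mulrC rmorphM /= oppr0.
  by case: eqP => [[yz]|_]; rewrite ?mulr0//; rewrite yz eqxx in zy.
have vy : v y = 0 by apply/eqP; apply: contraNT yr; exact: vr.
rewrite vy rmorph0 mulr0 big_seq big1 ?rmorph0// => z zr.
by case: eqP => [[yz]|_]; rewrite ?mulr0//; rewrite yz zr in yr.
Qed.

Lemma equivariant_diag d : equivariant q (diag d).
Proof.
split; first by exists d.
split; rewrite diagE.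
- apply: (@commute_on_span_eigen _ (fun x => (q `^ j_of x)%:C *: delta x)).
    move=> x; apply/mdiagP => y; rewrite !l2_scale deltaE.
    by case: eqP => [->|_]; rewrite ?mulr0// !mulr1.
  move=> v r ur vr; rewrite /A0.
  rewrite (_ : (fun x => _) = (fun x => (q `^ j_of x)%:C *: delta x)).
    exact: lin_ext_seq.
  by apply/funext => x; rewrite ebasis_label.
- apply: (@commute_on_span_eigen _ (fun x => (a1c x)%:C *: odelta (up x))).
    move=> x; apply/mdiagP => y; rewrite !l2_scale odeltaE.
    by case: eqP => [/evd_up ->|_]; rewrite ?mulr0.
  by move=> v r ur vr; rewrite A1E; exact: lin_ext_seq.
- apply: (@commute_on_span_eigen _ lower); last exact: adjoint_A1.
  move=> y; apply/mdiagP => x; rewrite l2_scale lowerE.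
  by case: eqP => [/evd_up ->|_]; rewrite ?mulr0.
Qed.

End Equivariance.

(** * Growth conditions and signs of the eigenvalues *)

Section Increments.
Context {R : realType}.
Local Notation H := (l2 R label).
Implicit Types (v w : H) (x y : label) (d : R -> R -> R).

Lemma admissible_nat (n i : R) : admissible n i <->
  exists a b : nat, n = (b%:R + a%:R) / 2 /\ i = (b%:R - a%:R) / 2.
Proof.
split=> [[m [s [sm -> ->]]]|[a [b [-> ->]]]].
  exists (m - s)%N, s; rewrite natrB//; split; [congr (_ / _); ring|by field].
by exists (a + b)%N, b; rewrite leq_addl natrD; split=> //; [congr (_ / _); ring|by field].
Qed.

Lemma bounded_incr_b d M :
  (forall n i, admissible n i -> `|d (n + 1/2) (i + 1/2) - d n i| <= M) <->
  (forall a b, `|dab d a b.+1 - dab d a b| <= M).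
Proof.
have E (a b : nat) : dab d a b.+1 =
    d ((b%:R + a%:R) / 2 + 1/2) ((b%:R - a%:R) / 2 + 1/2).
  by rewrite /dab -natr1; congr d; field.
split=> [h a b|h n i /admissible_nat[a [b [-> ->]]]]; last by have := h a b; rewrite E.
by rewrite E; apply/h/admissible_nat; exists a, b.
Qed.

Lemma bounded_incr_a d M :
  (forall n i, admissible n i -> `|d (n + 1/2) (i - 1/2) - d n i| <= M * (n + i + 1)) <->
  (forall a b, `|dab d a.+1 b - dab d a b| <= M * b.+1%:R).
Proof.
have E (a b : nat) : dab d a.+1 b =
    d ((b%:R + a%:R) / 2 + 1/2) ((b%:R - a%:R) / 2 - 1/2).
  by rewrite /dab -natr1; congr d; field.
have E' (a b : nat) : (b%:R + a%:R) / 2 + (b%:R - a%:R) / 2 + 1 = b.+1%:R :> R.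
  by rewrite -natr1; field.
split=> [h a b|h n i /admissible_nat[a [b [-> ->]]]]; last by have := h a b; rewrite E E'.
by rewrite E -(E' a); apply/h/admissible_nat; exists a, b.
Qed.

Variables (q : R) (hq : 0 < q < 1).

Lemma Kc0 M : Kc q M.+1 0 = 1.
Proof.
rewrite /Kc subn0 expr0 mul1r divff ?sqrtr1// gt_eqF//.
by apply: (subX_gt0 hq).
Qed.

Lemma Kc_leX M t : (t <= M)%N -> Kc q M t <= q ^+ t.
Proof.
move=> tM; rewrite -[leRHS]mulr1; apply: ler_wpM2l; first by rewrite exprn_ge0 ?(q_ge0 hq).
by apply: (Lc_le1 hq); lia.
Qed.

(** (b + 1) q^b is at most the geometric sum 1 + q + ... + q^b. This balances coefficients O(q^b)
    against eigenvalue differences O(b + 1). *)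
Lemma natX_bound (b : nat) : q ^+ b * b.+1%:R <= (1 - q)^-1.
Proof.
have [q0 q1] := andP hq; have d0 : 0 < 1 - q by lra.
rewrite -[leRHS]mul1r ler_pdivlMr//.
suff h : q ^+ b * b.+1%:R * (1 - q) <= 1 - q ^+ b.+1.
  by apply: le_trans h _; rewrite lerBlDr lerDl exprn_ge0// ltW.
elim: b => [|b IH]; first by rewrite expr0 expr1 !mul1r.
have qb : q ^+ b.+1 <= 1 by rewrite exprn_ile1 ?ltW.
have qb0 : 0 <= q ^+ b by rewrite exprn_ge0 ?ltW.
move: IH qb; rewrite !exprS -[b.+2%:R]natr1; set u := q ^+ b in qb0 *.
set n := b.+1%:R => IH qb.
have : q * (u * n * (1 - q)) <= q * (1 - q * u) by rewrite ler_pM2l.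
by nra.
Qed.

Lemma entry_lbound (c e M : R) : 0 < c -> 0 <= M -> e ^+ 2 * c ^+ 2 <= M ^+ 2 ->
  `|e| <= M / c.
Proof.
move=> c0 M0; rewrite -exprMn -[(e * c) ^+ 2]real_normK ?num_real//.
rewrite ler_pXn2r ?nnegrE// => h; rewrite ler_pdivlMr//.
by move: h; rewrite normrM (gtr0_norm c0).
Qed.

Lemma crd_delta x a b t :
  crd (delta x : H) a b t = [&& ca x == a, cb x == b & ct x == t]%:R.
Proof.
rewrite /crd; case E: (lab a b t) => [y|].
  move/labP: E => [<- <- <-]; rewrite deltaE; congr (_%:R); congr nat_of_bool.
  apply/eqP/and3P => [->|[/eqP h1 /eqP h2 /eqP h3]]; first by split.
  exact: coords_inj.
case: and3P => // -[/eqP h1 /eqP h2 /eqP h3].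
by rewrite -h1 -h2 -h3 lab_coords in E.
Qed.

Lemma crd_lab v a b t x : lab a b t = Some x -> v x = crd v a b t.
Proof. by rewrite /crd => ->. Qed.

Lemma bcomm_beta_incr d : bcomm (evd d) (beta hq) ->
  exists M, forall a b, `|dab d a b.+1 - dab d a b| <= M.
Proof.
have [q0 q1] := andP hq.
move=> /(bcomm_entry (beta_linear hq))[M M0 MP]; exists (M / (1 - q)) => a b.
have [x xE] := @lab_ex a b 0 (leq0n _); have [y yE] := @lab_ex a b.+1 0 (leq0n _).
have [xa xb xt] : [/\ ca x = a, cb x = b & ct x = 0%N] by exact/labP.
have [ya yb _] : [/\ ca y = a, cb y = b.+1 & ct y = 0%N] by exact/labP.
apply: entry_lbound => //; first lra.
have := MP x y; rewrite !evdE xa xb ya yb; apply: le_trans.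
rewrite ler_wpM2l ?sqr_ge0// (crd_lab _ yE) crd_beta ?leq0n //.
rewrite (_ : crd (delta x) a b.+1.-1 0 = 1); last by rewrite crd_delta xa xb xt !eqxx.
rewrite (_ : crd (delta x) _ _ 1 = 0); last by rewrite crd_delta xt !andbF.
rewrite mulr0 addr0 mulr1 addnS Kc0 mul1r sqmodN sqmod_real.
rewrite ler_pXn2r ?nnegrE ?(Lc_ge0 q)//; last lra.
by apply: (Lc_lbound hq) => //; lia.
Qed.

Lemma bcomm_alpha_incr d : bcomm (evd d) (alpha hq) ->
  exists M, forall a, `|dab d a.+1 0 - dab d a 0| <= M.
Proof.
have [q0 q1] := andP hq.
move=> /(bcomm_entry (alpha_linear hq))[M M0 MP]; exists (M / (q * (1 - q))) => a.
have [x xE] := @lab_ex a 0 0 (leq0n _); have [y yE] := @lab_ex a.+1 0 0 (leq0n _).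
have [xa xb xt] : [/\ ca x = a, cb x = 0%N & ct x = 0%N] by exact/labP.
have [ya yb _] : [/\ ca y = a.+1, cb y = 0%N & ct y = 0%N] by exact/labP.
have c0 : 0 < q * (1 - q) by apply: mulr_gt0; lra.
apply: entry_lbound => //.
have := MP x y; rewrite !evdE xa xb ya yb; apply: le_trans.
rewrite ler_wpM2l ?sqr_ge0// (crd_lab _ yE) crd_alpha ?leq0n //.
rewrite (_ : crd (delta x) a.+1.-1 0 0 = 1); last by rewrite crd_delta xa xb xt !eqxx.
rewrite (_ : crd (delta x) _ _ 1 = 0); last by rewrite crd_delta xt !andbF.
rewrite mulr0 addr0 mulr1 addn0 Kc0 mul1r sqmod_real.
rewrite ler_pXn2r ?nnegrE ?(Kc_ge0 hq)//; last exact: ltW.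
(* The remaining square root is [Lc] M (M - 1) with M = a + 2. *)
rewrite /Kc expr1 ler_pM2l//.
by apply: (Lc_lbound hq) => //; lia.
Qed.

Lemma incr_a_bound d (M0 M1 : R) :
  (forall a b, `|dab d a b.+1 - dab d a b| <= M1) ->
  (forall a, `|dab d a.+1 0 - dab d a 0| <= M0) ->
  forall a b, `|dab d a.+1 b - dab d a b| <= (M0 + 2 * M1) * b.+1%:R.
Proof.
move=> h1 h0 a b.
have M10 : 0 <= M1 by apply: le_trans (h1 0%N 0%N).
have M00 : 0 <= M0 by apply: le_trans (h0 0%N).
have h : `|dab d a.+1 b - dab d a b| <= M0 + 2 * M1 * b%:R.
  elim: b => [|b IH]; first by rewrite mulr0 addr0.
  have -> : dab d a.+1 b.+1 - dab d a b.+1 = (dab d a.+1 b.+1 - dab d a.+1 b) +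
     ((dab d a.+1 b - dab d a b) - (dab d a b.+1 - dab d a b)) by ring.
  rewrite -natr1; apply: le_trans (ler_normD _ _) _.
  have := ler_normB (dab d a.+1 b - dab d a b) (dab d a b.+1 - dab d a b).
  have := h1 a b; have := h1 a.+1 b; lra.
apply: le_trans h _; rewrite -natr1; have := ler0n R b; nra.
Qed.

Lemma incr_bcomm d (M1 M2 : R) :
  (forall a b, `|dab d a b.+1 - dab d a b| <= M1) ->
  (forall a b, `|dab d a.+1 b - dab d a b| <= M2 * b.+1%:R) ->
  bcomm (evd d) (alpha hq) /\ bcomm (evd d) (beta hq).
Proof.
move=> h1 h2.
have [q0 q1] := andP hq; have d0 : 0 < 1 - q by lra.
have M10 : 0 <= M1 by apply: le_trans (h1 0%N 0%N).
have M20 : 0 <= M2.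
  by have := le_trans (normr_ge0 _) (h2 0%N 0%N); rewrite mulr1.
have Nq : 0 <= M2 / (1 - q) by rewrite divr_ge0// ltW.
(* [small] serves the steps in a, whose eigenvalue differences grow with b; [large] serves the steps
   in b, where the differences are bounded. *)
have small (c : R) b (e : R) : `|c| <= q ^+ b -> `|e| <= M2 * b.+1%:R ->
    `|c * e| <= M2 / (1 - q).
  move=> cb eb; rewrite normrM; apply: le_trans (ler_pM _ _ cb eb) _ => //.
  by rewrite mulrCA; apply: ler_wpM2l => //; exact: natX_bound.
have large (c e : R) : `|c| <= 1 -> `|e| <= M1 -> `|c * e| <= M1.
  move=> c1 eM; rewrite normrM; apply: le_trans (ler_pM _ _ c1 eM) _ => //.
  by rewrite mul1r.
have qS b : q ^+ b.+1 <= q ^+ b by rewrite exprS ler_piMl ?exprn_ge0 ?ltW.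
split.
  rewrite (_ : alpha hq = fun v =>
    wshift (fun _ y => cap q (ca y) (cb y) (ct y)) (lmove 1 0 0 0 0 0) v +
    wshift (fun _ y => cam q (ca y) (cb y) (ct y)) (lmove 0 0 0 0 1 1) v);
    last exact/funext/alphaE.
  apply: bcomm_add.
    apply: (bcomm_wshift (@lmove_inj _ _ _ _ _ _) (srcw_bound (cap_le1 hq)) Nq).
    move=> x y /lmoveP[]; rewrite !addn0 addn1 => ya yb yt.
    apply: (small _ (cb y)); last by rewrite !evdE -ya -yb.
    have yct := ct_le y; rewrite /cap normrM !ger0_norm ?(Kc_ge0 hq)//.
    rewrite -[leRHS]mul1r; apply: ler_pM; rewrite ?(Kc_ge0 hq) ?(Kc_le1 hq)//; first lia.
    by apply: le_trans (Kc_leX _) (qS _); lia.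
  apply: (bcomm_wshift (@lmove_inj _ _ _ _ _ _) (srcw_bound (cam_le1 hq)) M10).
  move=> x y /lmoveP[]; rewrite !addn0 !addn1 => ya yb yt.
  apply: large; first exact: (cam_le1 hq).
  by rewrite !evdE ya yb distrC.
rewrite (_ : beta hq = fun v =>
  wshift (fun _ y => cbp q (ca y) (cb y) (ct y)) (lmove 0 1 0 0 0 0) v +
  wshift (fun _ y => cbm q (ca y) (cb y) (ct y)) (lmove 0 0 0 1 0 1) v);
  last exact/funext/betaE.
apply: bcomm_add.
  apply: (bcomm_wshift (@lmove_inj _ _ _ _ _ _) (srcw_bound (cbp_le1 hq)) M10).
  move=> x y /lmoveP[]; rewrite !addn0 addn1 => ya yb yt.
  apply: large; first exact: (cbp_le1 hq).
  by rewrite !evdE -ya -yb.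
apply: (bcomm_wshift (@lmove_inj _ _ _ _ _ _) (srcw_bound (cbm_le1 hq)) Nq).
move=> x y /lmoveP[]; rewrite !addn0 !addn1 => ya yb yt.
apply: (small _ (cb x)); last by rewrite !evdE ya yb distrC.
have yct := ct_le y; rewrite /cbm normrM !ger0_norm ?(Kc_ge0 hq) ?(Lc_ge0 q)//.
rewrite -[leRHS]mul1r -yb; apply: ler_pM; rewrite ?(Kc_ge0 hq) ?(Lc_ge0 q) ?(Lc_le1 hq)//.
  by lia.
by apply: Kc_leX; lia.
Qed.

End Increments.

(** * Vanishing of the pairing when P or 1 - P has finite rank *)

Section Projections.
Context {R : realType} {T : choiceType}.
Local Notation H := (l2 R T).
Implicit Types (v w : H) (x y : T).

Lemma cutoffK F v : cutoff F (cutoff F v) = cutoff F v.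
Proof. by apply: l2P => x; rewrite !cutoffE; case: (x \in F). Qed.

Lemma cutoffC F v : v - cutoff F v = cutoff (~` F) v.
Proof.
apply: l2P => x; rewrite l2_sub !cutoffE in_setC.
by case: ifP => _ /=; rewrite ?subrr ?subr0.
Qed.

Lemma ip_deltar v x : ip v (delta x) = v x.
Proof. by rewrite ipC ip_delta conjcK. Qed.

Variable ev : T -> R.

Lemma negset_in x : (x \in negset ev) = (ev x < 0).
Proof. by apply/idP/idP; rewrite inE. Qed.

Lemma cutoff_projection :
  orthogonal_projection (cutoff (negset ev)) [set v | signop ev v = - v].
Proof.
move=> v; split=> [|u /= uE].
  apply: l2P => x; rewrite signopE l2_opp cutoffE negset_in.
  by case: (ev x < 0); rewrite ?oppr0.
rewrite cutoffC -[RHS](ip0l u); apply: ip_eq => x; rewrite l2_zero mul0r cutoffE in_setC negset_in.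
have := congr1 (fun w : H => w x) uE; rewrite signopE l2_opp.
case: ifP => _ /=; first by rewrite mul0r.
by move=> /eqP; rewrite -addr_eq0 -mulr2n mulrn_eq0 /= => /eqP ->; rewrite rmorph0 mulr0.
Qed.

(** [index_pairing] only asserts that some F and P exist. Both are forced, which allows every value
    of the pairing to be computed on one projection. *)
Lemma projection_cutoff F P : is_sign (mdiag ev) F ->
  orthogonal_projection P [set v | F v = - v] -> P = cutoff (negset ev).
Proof.
move=> FE PE; apply/funext => v; apply: l2P => x; rewrite cutoffE negset_in.
have [/= Pv vP] := PE v.
case: ifP => ex.
  have Fx : F (delta x) = - delta x.
    apply: l2P => y; rewrite (is_sign_coord _ _ FE) signopE l2_opp deltaE.
    by case: eqP => [->|_]; rewrite ?ex// oppr0 if_same.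
  by have := vP _ Fx; rewrite ip_deltar l2_sub => /eqP; rewrite subr_eq0 => /eqP.
have := congr1 (fun w : H => w x) Pv; rewrite (is_sign_coord _ _ FE) signopE ex l2_opp => /eqP.
by rewrite -addr_eq0 -mulr2n mulrn_eq0 /= => /eqP.
Qed.

End Projections.

Section TrivialIndex.
Context {R : realType}.
Variables (q : R) (hq : 0 < q < 1) (ev : label -> R).
Local Notation H := (l2 R label).

Lemma dim_range_cutoff (F : set label) (n : nat) : finite_set F ->
  exists p, quotient_dim (range (amplify (cutoff F) : ('I_n -> H) -> 'I_n -> H)) [set 0] p.
Proof.
move=> /finite_seqP[r ->].
pose e (j : 'I_n * seq_sub r) : 'I_n -> H := fun i => if i == j.1 then delta (val j.2) else 0.
pose phi (j : 'I_n * seq_sub r) (v : 'I_n -> H) : R[i] := v j.1 (val j.2).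
exists #|{: 'I_n * seq_sub r}|; apply: (@quotient_dim_coords _ _ _ _ e phi).
- by move=> j c u v; rewrite /phi -[(c *: u + v) _]/(c *: u j.1 + v j.1) l2_add l2_scale.
- move=> [i y] [i' y']; rewrite /phi /e /= xpair_eqE.
  case: eqP => _; last by rewrite l2_zero.
  by rewrite deltaE -(inj_eq val_inj).
- split; first by exists 0 => //; apply: linear_fun0; exact/amplify_linear/cutoff_linear.
  move=> c _ _ [u _ <-] [w _ <-]; exists (c *: u + w) => //.
  exact/amplify_linear/cutoff_linear.
- move=> [i y]; exists (e (i, y)) => //; apply/funext => i'; rewrite /amplify /e.
  apply: cutoff_id => x /= xr; case: ifP => _; last by rewrite l2_zero.
  by rewrite deltaE; case: eqP => // xy; case: xr; rewrite xy; exact: valP y.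
move=> _ [u _ <-] u0; apply/funext => i; apply: l2P => x; rewrite /amplify cutoffE l2_zero.
case: ifPn => // xr; have xr' : x \in r by move: xr; rewrite inE.
by have := u0 (i, SeqSub xr'); rewrite /phi /amplify cutoffE xr.
Qed.

Lemma GL_linear k (g : 'M[H -> H]_k) : (forall r s, CSUq2 hq (g r s)) ->
  linear (mx_act g : ('I_k -> H) -> 'I_k -> H).
Proof. by move=> gC; apply: mx_act_linear => r s; have [[]] := gC r s. Qed.

Lemma index_pairing_finite k (g : 'M[H -> H]_k) z : GL_CSUq2 hq g ->
  finite_set (negset ev) \/ finite_set (~` negset ev) ->
  index_pairing (mdiag ev) g z -> z = 0.
Proof.
move=> [gC [h [hC gh hg]]] fin [F [P [FE PE]]].
rewrite (projection_cutoff FE PE) => idx; apply/eqP; rewrite -oppr_eq0; apply/eqP.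
have lP : linear (amplify (cutoff (negset ev)) : ('I_k -> H) -> 'I_k -> H).
  exact/amplify_linear/cutoff_linear.
have lg := GL_linear gC.
case: fin => [/(dim_range_cutoff k)[p dp]|/(dim_range_cutoff k)[p dp]].
  apply: (fredholm_index_finite _ _ dp idx).
    by move=> c u v /=; rewrite lP lg lP.
  split; first by exists 0 => //; exact: linear_fun0 lP.
  by move=> c _ _ [u _ <-] [w _ <-]; exists (c *: u + w) => //; exact: lP.
apply: (fredholm_index_cofinite lP lg (GL_linear hC) _ gh hg _ idx (p := p)).
  by move=> v; apply/funext => i; exact: cutoffK.
rewrite (_ : (fun v => _) = amplify (cutoff (~` negset ev)))//.
by apply/funext => v; apply/funext => i; exact: cutoffC.
Qed.

End TrivialIndex.

(** * Signs of the eigenvalues outside a finite box *)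

Section Tails.
Context {R : realType}.
Implicit Types (d : R -> R -> R) (u : nat -> R).

Definition gaps u (n0 : nat) (N : R) :=
  (forall n, (n0 <= n)%N -> N < u n) \/ (forall n, (n0 <= n)%N -> u n < - N).

Lemma gaps_of_steps u n0 (N M : R) : 0 <= N ->
  (forall n, (n0 <= n)%N -> N + M < `|u n|) ->
  (forall n, `|u n.+1 - u n| <= M) -> gaps u n0 N.
Proof.
move=> N0 uN uM; have M0 : 0 <= M by apply: le_trans (uM 0%N).
have := uN _ (leqnn n0); rewrite lter_normr => /orP[un|un]; [left|right].
  suff h m : N + M < u (n0 + m)%N by move=> n /subnKC <-; have := h (n - n0)%N; lra.
  elim: m => [|m IH]; first by rewrite addn0.
  have := uN (n0 + m.+1)%N (leq_addr _ _); have := uM (n0 + m)%N.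
  rewrite addnS ler_norml lter_normr => /andP[h1 h2] /orP[//|h3].
  by exfalso; lra.
suff h m : N + M < - u (n0 + m)%N by move=> n /subnKC <-; have := h (n - n0)%N; lra.
elim: m => [|m IH]; first by rewrite addn0.
have := uN (n0 + m.+1)%N (leq_addr _ _); have := uM (n0 + m)%N.
rewrite addnS ler_norml lter_normr => /andP[h1 h2] /orP[h3|//].
by exfalso; lra.
Qed.

Definition sided (N : R) (X : set R) := X `<=` [set x | N < x] \/ X `<=` [set x | x < - N].

Lemma finite_set_coords (F : set label) : finite_set F ->
  exists K : nat, forall x, F x -> (ca x + cb x <= K)%N.
Proof.
move=> /finite_seqP[r ->]; exists (\max_(x <- r) (ca x + cb x)) => x /= xr.
exact: (@leq_bigmax_seq _ _ xpredT (fun x => ca x + cb x)%N).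
Qed.

Lemma coords_finite (k l : nat) :
  exists r : seq label, forall x, (ca x <= k)%N -> (cb x <= l)%N -> x \in r.
Proof.
pose I := iota 0 (k + l).+1.
exists (pmap insub [seq (p, t) | p <- [seq (m, s) | m <- I, s <- I], t <- I]) => x xk xl.
have [xab xt] := (cab x, ct_le x).
rewrite mem_pmap; apply/mapP; exists (sval x); last by rewrite -[sval x]/(val x) valK.
rewrite [sval x]surjective_pairing [(sval x).1]surjective_pairing.
apply: allpairs_f; last by rewrite mem_iota -[_.2]/(ct x); lia.
by apply: allpairs_f; rewrite mem_iota; [rewrite -xab|rewrite -[_.2]/(cb x)]; lia.
Qed.

(** A label outside the finite box a <= k, b <= l has its eigenvalue in T(k) or in some S(l, a), so
    |d| exceeds N there. *)
Lemma tails_sided_compact d :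
  (forall N : R, 0 <= N -> exists k l : nat,
    [/\ (0 < k)%N, (0 < l)%N & forall X, tail_sets d k l X -> sided N X]) ->
  compact_resolvent (mdiag (evd d)).
Proof.
move=> tails; apply: mdiag_compact_resolvent => N.
have N0 : 0 <= Num.max N 0 by rewrite le_max lexx orbT.
have [k [l [_ _ kl]]] := tails _ N0; have [r rP] := coords_finite k l.
exists r => x xr; rewrite evdE; apply: le_lt_trans (_ : N <= Num.max N 0) _.
  by rewrite le_max lexx.
have side X y : tail_sets d k l X -> X y -> Num.max N 0 < `|y|.
  by move=> /kl[XN /XN|XN /XN] /= h; rewrite lter_normr ?h// ltrNr h orbT.
have [ak|ak] := leqP (ca x) k; last first.
  by apply: (side (T_set d k)); [left|exists (ca x), (cb x)].
have [bl|bl] := leqP (cb x) l; last first.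
  by apply: (side (S_set d l (ca x))); [right; exists (ca x)|exists (cb x)].
by rewrite rP in xr.
Qed.

(* Outside a finite set |d| exceeds N plus the step size, so d cannot change sign
   along a row; the column b = 0 links the rows of T(k). *)
Lemma compact_tails_sided d (M1 M2 : R) :
  (forall a b, `|dab d a b.+1 - dab d a b| <= M1) ->
  (forall a b, `|dab d a.+1 b - dab d a b| <= M2 * b.+1%:R) ->
  compact_resolvent (mdiag (evd d)) ->
  forall N : R, 0 <= N -> exists k l : nat,
    [/\ (0 < k)%N, (0 < l)%N & forall X, tail_sets d k l X -> sided N X].
Proof.
move=> h1 h2 cpt N N0; pose M := Num.max M1 M2.
have M1M : M1 <= M by rewrite le_max lexx.
have M2M : M2 <= M by rewrite le_max lexx orbT.
have [K KP] := finite_set_coords (compact_resolvent_finite (N + M) cpt).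
have big a b : (K < a + b)%N -> N + M < `|dab d a b|.
  move=> Kab; have [x /labP[xa xb _]] := @lab_ex a b 0 (leq0n _).
  rewrite ltNge; apply/negP => h; have := KP x; rewrite /= evdE xa xb => /(_ h).
  by rewrite leqNgt Kab.
have row a n0 : (K < a + n0)%N -> gaps (dab d a) n0 N.
  move=> Kan; apply: (gaps_of_steps (M := M) N0) => [n n0n|n].
    by apply: big; lia.
  exact: le_trans (h1 _ _) M1M.
have col : gaps (fun a => dab d a 0) K.+1 N.
  apply: (gaps_of_steps (M := M) N0) => [n Kn|n]; first by apply: big; lia.
  by apply: le_trans (h2 _ _) _; rewrite mulr1.
exists K.+1, K.+1; split=> // _ [->|[r rK ->]]; last first.
  have /row[h|h] : (K < r + K.+1)%N by lia.
    by left=> _ [b [Kb ->]]; apply: h; exact: ltnW.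
  by right=> _ [b [Kb ->]]; apply: h; exact: ltnW.
case: col => [h|h]; [left|right] => _ [a [b [Ka ->]]] /=.
  have /row[h'|h'] : (K < a + 0)%N by lia.
    exact: h'.
  by have := h' 0%N isT; have := h a (ltnW Ka); lra.
have /row[h'|h'] : (K < a + 0)%N by lia.
  by have := h' 0%N isT; have := h a (ltnW Ka); lra.
exact: h'.
Qed.

End Tails.

(** * Nontrivial pairing and tails of opposite sign *)

Section ChernCharacter.
Context {R : realType}.
Variables (q : R) (hq : 0 < q < 1).
Local Notation H := (l2 R label).
Implicit Types (d : R -> R -> R).

Definition opposite_tails d := exists k l : nat,
  [/\ (0 < k)%N, (0 < l)%N,
      forall X, tail_sets d k l X -> X `<=` [set x | 0 < x] \/ X `<=` [set x | x < 0]
    & exists X Y, [/\ tail_sets d k l X, tail_sets d k l Y,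
        X `<=` [set x | 0 < x] & Y `<=` [set x | x < 0]]].

(** If all tails had the sign of T(k), the negative eigenvalues, or the nonnegative ones, would
    occur only in the box a <= k, b <= l, and every index would vanish. *)
Lemma chern_opposite_tails d :
  (exists k l : nat,
    [/\ (0 < k)%N, (0 < l)%N & forall X, tail_sets d k l X -> sided 0 X]) ->
  nontrivial_chern hq (diag d) -> opposite_tails d.
Proof.
move=> [k [l [k0 l0 kl]]] [n [g [z [gGL gz z0]]]].
have {}kl X : tail_sets d k l X -> X `<=` [set x | 0 < x] \/ X `<=` [set x | x < 0].
  by move=> /kl; rewrite /sided oppr0.
have TT : tail_sets d k l (T_set d k) by left.
have SS r : (r <= k)%N -> tail_sets d k l (S_set d l r) by move=> rk; right; exists r.
have inT x : (k < ca x)%N -> T_set d k (evd d x).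
  by move=> kx; exists (ca x), (cb x); rewrite evdE.
have inS x : (l < cb x)%N -> S_set d l (ca x) (evd d x).
  by move=> lx; exists (cb x); rewrite evdE.
have box (F : set label) : (forall x, F x -> (ca x <= k)%N /\ (cb x <= l)%N) -> finite_set F.
  have [r rP] := coords_finite k l => Fkl.
  by apply: (sub_finite_set _ (finite_seq r)) => x /Fkl[]; exact: rP.
exists k, l; split=> //; apply: contrapT => nopp.
suff /(index_pairing_finite gGL)/(_ gz)/eqP :
    finite_set (negset (evd d)) \/ finite_set (~` negset (evd d)).
  by rewrite (negbTE z0).
have [Tpos|Tneg] := kl _ TT; [left|right]; apply: box => x /=.
  rewrite /negset /= => ex.
  have xk : (ca x <= k)%N.
    by rewrite leqNgt; apply/negP => /inT/Tpos /=; lra.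
  split=> //; rewrite leqNgt; apply/negP => lx.
  have [Sp|Sn] := kl _ (SS _ xk); first by have := Sp _ (inS _ lx); move=> /=; lra.
  by apply: nopp; exists (T_set d k), (S_set d l (ca x)); split=> //; exact: SS.
rewrite /negset /= => /negP; rewrite -leNgt => ex.
have xk : (ca x <= k)%N.
  by rewrite leqNgt; apply/negP => /inT/Tneg /=; lra.
split=> //; rewrite leqNgt; apply/negP => lx.
have [Sp|Sn] := kl _ (SS _ xk); last by have := Sn _ (inS _ lx); move=> /=; lra.
by apply: nopp; exists (S_set d l (ca x)), (T_set d k); split=> //; exact: SS.
Qed.

Lemma opposite_tails_chern d : opposite_tails d -> nontrivial_chern hq (diag d).
Proof.
move=> [k [l [k0 l0 kl [X [Y [XT YT Xpos Yneg]]]]]].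
have signs Z y y' : tail_sets d k l Z -> Z y -> Z y' -> (y < 0) = (y' < 0).
  move=> /kl[Zs|Zs] /Zs /= h /Zs /= h'; last by rewrite h h'.
  by rewrite !ltNge !ltW.
pose chi a b := dab d a b < 0.
have TT : tail_sets d k l (T_set d k) by left.
have SS r : (r <= k)%N -> tail_sets d k l (S_set d l r) by move=> rk; right; exists r.
have inT a b : (k < a)%N -> T_set d k (dab d a b) by move=> ka; exists a, b.
have inS a b : (l < b)%N -> S_set d l a (dab d a b) by move=> lb; exists b.
have chiT a b : (k < a)%N -> chi a b = chi k.+1 0.
  by move=> ka; apply: (signs _ _ _ TT); exact: inT.
have chiS a b : (a <= k)%N -> (l < b)%N -> chi a b = chi a l.+1.
  by move=> ak lb; apply: (signs _ _ _ (SS _ ak)); exact: inS.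
(* T(k) cannot share the sign of both the positive and the negative tail set, so one of the two is a
   row S(l, a0) of sign different from that of T(k). *)
have [a0 a0k a0tau] : exists2 a0, (a0 <= k)%N & chi a0 l.+1 != chi k.+1 0.
  case: XT Xpos => [->|[r rk ->]] Xpos; case: YT Yneg => [->|[r' r'k ->]] Yneg.
  - have := Xpos _ (inT k.+1 0%N (ltnSn _)); have := Yneg _ (inT k.+1 0%N (ltnSn _)).
    by move=> /=; lra.
  - exists r' => //; rewrite /chi (Yneg _ (inS _ _ (ltnSn _))) eq_sym eqb_id -leNgt ltW//.
    exact: Xpos _ (inT _ _ (ltnSn _)).
  - exists r => //; rewrite /chi (Yneg _ (inT _ _ (ltnSn _))) eqb_id -leNgt ltW//.
    exact: Xpos _ (inS _ _ (ltnSn _)).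
  - have [h|h] := boolP (chi k.+1 0).
      exists r => //; rewrite eqb_id /chi -leNgt ltW//.
      exact: Xpos _ (inS _ _ (ltnSn _)).
    exists r' => //; rewrite /chi (Yneg _ (inS _ _ (ltnSn _)))//.
have [z z0 idx] := fredholm_index_blocks hq chiT chiS a0k a0tau.
exists 2, (umx hq), (- z); split; [exact: umx_GL| |by rewrite oppr_eq0].
have chiE : chiset chi = negset (evd d).
  by apply/seteqP; split=> x; rewrite /chiset /negset /= evdE.
exists (signop (evd d)), (cutoff (negset (evd d))); split.
- exact: signop_is_sign.
- exact: cutoff_projection.
- by rewrite opprK -chiE.
Qed.

End ChernCharacter.

Theorem theorem4p6 (R : realType) (q : R) (hq : 0 < q < 1)
    (D : set (l2 R label * l2 R label)) :
  [/\ odd_spectral_triple hq D, equivariant q D & nontrivial_chern hq D] <->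
  exists d : R -> R -> R,
    D = diag d /\
    [/\ exists M : R, forall n i, admissible n i ->
          `|d (n + 1/2) (i + 1/2) - d n i| <= M,
        exists M : R, forall n i, admissible n i ->
          `|d (n + 1/2) (i - 1/2) - d n i| <= M * (n + i + 1),
        forall N : R, 0 <= N -> exists k l : nat,
          [/\ (0 < k)%N, (0 < l)%N
            & forall X, tail_sets d k l X ->
                X `<=` [set x | N < x] \/ X `<=` [set x | x < - N]]
      & exists k l : nat,
          [/\ (0 < k)%N, (0 < l)%N,
              forall X, tail_sets d k l X ->
                X `<=` [set x | 0 < x] \/ X `<=` [set x | x < 0]
            & exists X Y, [/\ tail_sets d k l X, tail_sets d k l Y,
                X `<=` [set x | 0 < x] & Y `<=` [set x | x < 0]]]].
Proof.
split=> [[[saD cptD bddD] [[d dE] _] chernD]|[d [-> [[M1 h1] [M2 h2] tails opp]]]].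
  subst D; exists d; split=> //.
  have [M1 h1] := bcomm_beta_incr (hq := hq) ((bounded_commutatorP _ _).1 (bddD _ (Af_beta hq))).
  have [M0 h0] := bcomm_alpha_incr (hq := hq) ((bounded_commutatorP _ _).1 (bddD _ (Af_alpha hq))).
  have h2 := incr_a_bound h1 h0.
  have tails := compact_tails_sided h1 h2 cptD.
  split.
  - by exists M1; exact/bounded_incr_b.
  - by exists (M0 + 2 * M1); exact/bounded_incr_a.
  - exact: tails.
  - exact: chern_opposite_tails (tails 0 (lexx 0)) chernD.
have [ha hb] := incr_bcomm hq ((bounded_incr_b d M1).1 h1) ((bounded_incr_a d M2).1 h2).
split; [split| |].
- exact: mdiag_self_adjoint.
- exact: tails_sided_compact.
- by move=> a /(Af_bcomm ha hb) ?; exact/bounded_commutatorP.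
- exact: equivariant_diag.
- exact: opposite_tails_chern.
Qed.
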